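(* Assume: (a) $c$ is twice continuously differentiable on $\omega_0\times\omega_1$; (b) $\operatorname{supp}(\bar u)\subset\operatorname{int}(\omega_1)$; (c) $\bar\varphi\in C^1(\omega_1)$ is a Kantorovich potential for $\bar u$ which is twice continuously differentiable on $\operatorname{supp}(\bar u)+B_{\hat\varepsilon}(0)\subset\operatorname{int}(\omega_1)$ for some $\hat\varepsilon>0$; (d) there are a map $\bar T\colon\omega_0\to\omega_1$ and $\gamma>0$ with $$c(x,\eta)-\bar\varphi(\eta)\ge c(x,\bar T(x))-\bar\varphi(\bar T(x))+\frac\gamma2|\eta-\bar T(x)|^2\qquad\forall x\in\omega_0,\ \eta\in\omega_1.$$ Then $$\frac12\mathcal D''(\bar u,\bar\varphi;\Phi)=\inf\Big\{\frac12\int_{\omega_1}\rho^\top H\rho\,d\bar u:\ \rho\in L^2(\bar u;\mathbb R^d),\ \Phi=[\![0,\rho\bar u]\!]\Big\}$$ holds for all $\Phi\in C^1(\omega_1)^*$. The infimum is attained whenever the set on the right-hand side is not empty. Further, $\mathcal D$ is weak-$\star$ twice epi-differentiable at $\bar u$ for $\bar\varphi$.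
   Context: Standing assumptions: $d\in\mathbb N$; $\omega_0,\omega_1\subset\mathbb R^d$ are compact; $\omega_1$ is the closure of its interior and $\operatorname{int}\omega_1$ is uniformly locally quasiconvex (a set $A\subset\mathbb R^d$ is so if there are $r>0$, $C\ge1$ such that any $x,y\in A$ with $|x-y|\le r$ can be joined by a curve $\gamma\in C([0,1];A)$, $\gamma(0)=x,\gamma(1)=y$, with Lipschitz constant at most $C|x-y|$); $c\colon\omega_0\times\omega_1\to\mathbb R$ is continuous; $u_0\in\mathcal M(\omega_0)$, $u_0\ge0$, $u_0(\omega_0)>0$, $\operatorname{supp}(u_0)=\omega_0$; $\bar u\in\mathcal M(\omega_1)$ is fixed with $\bar u\ge0$, $\bar u(\omega_1)=u_0(\omega_0)$. $\mathcal M(\omega)=C(\omega)^*$ denotes the (signed, finite) Borel measures on $\omega$. $B_r(x)$ is the closed ball. Spaces: $C^1(\omega_1)$ is the Banach space of $\varphi\in C(\omega_1)$ continuously differentiable on $\operatorname{int}\omega_1$ with $\nabla\varphi$ extending continuously to $\omega_1$, normed by $\max\{\|\varphi\|_{C(\omega_1)},\|\nabla\varphi\|_{C(\omega_1;\mathbb R^d)}\}$; $C^1(\omega_1)^*$ is its dual. For $\mu\in\mathcal M(\omega_1)$, $\nu\in\mathcal M(\omega_1;\mathbb R^d)$, $[\![\mu,\nu]\!]\in C^1(\omega_1)^*$ is $\varphi\mapsto\int\varphi\,d\mu+\int\nabla\varphi\cdot d\nu$; in particular $\langle[\![0,\rho\bar u]\!],\varphi\rangle=\int_{\omega_1}\rho^\top\nabla\varphi\,d\bar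 u$. $\Pi\mu:=[\![\mu,0]\!]$ is injective on $\mathcal M(\omega_1)$, and $\bar u$ is identified with $\Pi\bar u$. Functionals: $D(u)=\inf\{\int c\,d\pi:\pi\in\mathcal M(\omega_0\times\omega_1),\pi\ge0,P_0\#\pi=u_0,P_1\#\pi=u\}$, $P_i$ the projection onto $\omega_i$ ($\inf\emptyset=+\infty$). $\mathcal D\colon C^1(\omega_1)^*\to\mathbb R\cup\{\infty\}$ is $\mathcal D(\Pi u)=D(u)$, and $\mathcal D=\infty$ outside $\operatorname{ran}\Pi$. Kantorovich potential for $u$: $\psi\in C(\omega_1)$ with $\int\psi\,du+\int\psi^{\bar c}\,du_0=D(u)$, where $\psi^{\bar c}(x)=\inf_{\eta\in\omega_1}c(x,\eta)-\psi(\eta)$. Weak-$\star$ second subderivative: $\mathcal D''(\bar u,\bar\varphi;h)=\inf\{\liminf_{k\to\infty}\frac{\mathcal D(\bar u+t_kh_k)-\mathcal D(\bar u)-t_k\langle\bar\varphi,h_k\rangle}{t_k^2/2}\}$, infimum over all $(t_k)\subset(0,\infty)$, $t_k\to0$ and $(h_k)\subset C^1(\omega_1)^*$, $h_k\stackrel{\star}{\rightharpoonup}h$. $\mathcal D$ is weak-$\star$ twice epi-differentiable at $\bar u$ for $\bar\varphi$ if for every $h\in C^1(\omega_1)^*$ and every $(t_k)\subset(0,\infty)$ with $t_k\to0$ there is $(h_k)\subset C^1(\omega_1)^*$ with $h_k\stackrel{\star}{\rightharpoonup}h$ and $\mathcal D''(\bar u,\bar\varphi;h)=\lim_{k\to\infty}\frac{\mathcal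 D(\bar u+t_kh_k)-\mathcal D(\bar u)-t_k\langle\bar\varphi,h_k\rangle}{t_k^2/2}$. The matrix $H$: under (a)–(d), $\bar T(x)$ is the unique minimizer of $c(x,\cdot)-\bar\varphi$ on $\omega_1$, $\bar T$ is continuous and $\bar u=\bar T\#u_0$. By disintegration there is a family $\{\hat u_\eta\}_{\eta\in\omega_1}$ of probability measures on $\omega_0$ with $\eta\mapsto\hat u_\eta(B)$ Borel measurable for Borel $B$, $\hat u_\eta(\omega_0\setminus\bar T^{-1}(\{\eta\}))=0$ for $\bar u$-a.e. $\eta$, and $\int_{\omega_0}f\,du_0=\int_{\omega_1}\int_{\bar T^{-1}(\{\eta\})}f\,d\hat u_\eta\,d\bar u(\eta)$ for all Borel $f\colon\omega_0\to[0,\infty]$. Then, for $\bar u$-a.e. $\eta$, $H(\eta):=\big(\int_{\bar T^{-1}(\{\eta\})}[\nabla^2_{\eta\eta}c(y,\eta)-\nabla^2\bar\varphi(\eta)]^{-1}d\hat u_\eta(y)\big)^{-1}\in\mathbb R^{d\times d}$. *)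

(* Defs.v *)
From HB Require Import structures.
From mathcomp Require Import all_boot all_order all_algebra.
From mathcomp Require Import all_classical all_reals all_analysis measurable_realfun.

Set Implicit Arguments.
Unset Strict Implicit.
Unset Printing Implicit Defensive.

Import Order.TTheory GRing.Theory Num.Theory.
Import numFieldNormedType.Exports.

Local Open Scope classical_set_scope.
Local Open Scope ring_scope.

(* 'rV[R]_d carries the maximum norm in MathComp-Analysis: its topology is the
   usual one, but metric notions go through the Euclidean norm below. *)
Definition enorm (R : realType) (d : nat) (x : 'rV[R]_d) : R :=
  Num.sqrt (\sum_(i < d) x ord0 i ^+ 2).

Definition dot (R : realType) (d : nat) (x y : 'rV[R]_d) : R :=
  \sum_(i < d) x ord0 i * y ord0 i.

Definition closed_eball (R : realType) (d : nat) (x : 'rV[R]_d) (r : R) :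
    set 'rV[R]_d :=
  [set y | enorm (y - x) <= r].

Definition set_add (V : zmodType) (A B : set V) : set V :=
  [set x + y | x in A & y in B].

Definition borel (R : realType) (d : nat) :=
  g_sigma_algebraType (@open 'rV[R]_d).

Definition unif_loc_quasiconvex (R : realType) (d : nat) (A : set 'rV[R]_d) : Prop :=
  exists r C : R, [/\ 0 < r, 1 <= C &
    forall x y, A x -> A y -> enorm (x - y) <= r ->
      exists g : R -> 'rV[R]_d,
        [/\ {within `[0, 1], continuous g},
            forall s, 0 <= s <= 1 -> A (g s),
            g 0 = x, g 1 = y &
            forall s t, 0 <= s <= 1 -> 0 <= t <= 1 ->
              enorm (g s - g t) <= C * enorm (x - y) * `|s - t|]].

(* Measures on a compact set [w] are Borel measures on R^d vanishing outside
   [w]; for signed measures all Borel subsets of the complement count. *)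
Definition carried_by (R : realType) (d : nat) (w : set 'rV[R]_d)
    (m : set (borel R d) -> \bar R) : Prop :=
  forall A : set (borel R d), measurable A -> A `<=` ~` w -> m A = 0%E.

Definition msupp (R : realType) (d : nat)
    (m : {measure set (borel R d) -> \bar R}) : set 'rV[R]_d :=
  [set x | forall U : set 'rV[R]_d, open U -> U x -> (0 < m U)%E].

Definition charge_integral (d : measure_display) (T : measurableType d)
    (R : realType) (m : {charge set T -> \bar R}) (A : set T) (f : T -> R) : R :=
  let mPN := projT2 (cid (projT2 (cid (Hahn_decomposition m)))) in
  Rintegral (jordan_pos mPN) A f - Rintegral (jordan_neg mPN) A f.

Definition cont_diff_open (R : realType) (V : normedModType R) (U : set V)
    (f : V -> R) : Prop :=
  (forall x, U x -> differentiable f x) /\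
  (forall v x, U x -> {for x, continuous ('D_v f)}).

Definition cont_diff2_open (R : realType) (V : normedModType R) (U : set V)
    (f : V -> R) : Prop :=
  (forall x, U x -> differentiable f x) /\
  (forall v, cont_diff_open U ('D_v f)).

(* C^2 on a set that need not be open (nor have interior points): existence of
   a C^2 extension to an open neighbourhood. *)
Definition cont_diff2_on (R : realType) (V : normedModType R) (A : set V)
    (f : V -> R) : Prop :=
  exists (U : set V) (g : V -> R),
    [/\ open U, A `<=` U, cont_diff2_open U g & {in A, f =1 g}].

Definition grad (R : realType) (d : nat) (f : 'rV[R]_d -> R) (x : 'rV[R]_d) :
    'rV[R]_d :=
  \row_(i < d) 'D_(delta_mx ord0 i) f x.

Definition hess (R : realType) (d : nat) (f : 'rV[R]_d -> R) (x : 'rV[R]_d) :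
    'M[R]_d :=
  \matrix_(i < d, j < d) 'D_(delta_mx ord0 j) ('D_(delta_mx ord0 i) f) x.

(* Elements of C^1(w) are represented by functions on all of R^d whose values
   outside w are irrelevant. *)
Definition C1 (R : realType) (d : nat) (w : set 'rV[R]_d) (f : 'rV[R]_d -> R) : Prop :=
  [/\ {within w, continuous f},
      forall x, w° x -> differentiable f x &
      exists2 G : 'rV[R]_d -> 'rV[R]_d,
        {within w, continuous G} & forall x, w° x -> G x = grad f x].

(* The continuous extension of the gradient to w, for w the closure of its
   interior and f in C^1(w). *)
Definition gradc (R : realType) (d : nat) (w : set 'rV[R]_d) (f : 'rV[R]_d -> R)
    (x : 'rV[R]_d) : 'rV[R]_d :=
  lim (grad f y @[y --> within w° (nbhs x)]).

Definition C1_norm (R : realType) (d : nat) (w : set 'rV[R]_d) (f : 'rV[R]_d -> R) : R :=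
  Num.max (sup [set `|f x| | x in w]) (sup [set enorm (gradc w f x) | x in w]).

(* Bounded linear functionals on C^1(w). Boundedness forces the value at [f] to
   depend only on the restriction of [f] to w; the values at functions that are
   not in C^1(w) are irrelevant, hence equality of functionals is [dual_eq]. *)
Definition C1_dual (R : realType) (d : nat) (w : set 'rV[R]_d)
    (h : ('rV[R]_d -> R) -> R) : Prop :=
  (forall (a : R) f g, C1 w f -> C1 w g ->
     h (fun x => a * f x + g x) = a * h f + h g) /\
  (exists M : R, forall f, C1 w f -> `|h f| <= M * C1_norm w f).

Definition dual_eq (R : realType) (d : nat) (w : set 'rV[R]_d)
    (h k : ('rV[R]_d -> R) -> R) : Prop :=
  forall f, C1 w f -> h f = k f.

Definition wstar_cvg (R : realType) (d : nat) (w : set 'rV[R]_d)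
    (hk : nat -> ('rV[R]_d -> R) -> R) (h : ('rV[R]_d -> R) -> R) : Prop :=
  forall f, C1 w f -> hk k f @[k --> \oo] --> h f.

(* Pi m = [[m, 0]] *)
Definition Pi (R : realType) (d : nat) (w : set 'rV[R]_d)
    (m : {charge set (borel R d) -> \bar R}) (f : 'rV[R]_d -> R) : R :=
  charge_integral m w f.

(* [[0, rho m]] *)
Definition bracket0 (R : realType) (d : nat) (w : set 'rV[R]_d)
    (m : {measure set (borel R d) -> \bar R}) (rho : 'rV[R]_d -> 'rV[R]_d)
    (f : 'rV[R]_d -> R) : R :=
  \int[m]_(x in w) dot (rho x) (gradc w f x).

Definition L2 (R : realType) (d : nat) (w : set 'rV[R]_d)
    (m : {measure set (borel R d) -> \bar R}) (rho : 'rV[R]_d -> 'rV[R]_d) : Prop :=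
  measurable_fun (w : set (borel R d)) (rho : borel R d -> borel R d) /\
  (\int[m]_(x in w) ((enorm (rho x) ^+ 2)%:E) < +oo)%E.

Definition coupling (R : realType) (d : nat) (w0 w1 : set 'rV[R]_d)
    (u0 u : set (borel R d) -> \bar R)
    (p : {measure set (borel R d * borel R d) -> \bar R}) : Prop :=
  [/\ p (~` (w0 `*` w1)) = 0%E,
      forall A : set (borel R d), measurable A -> pushforward p fst A = u0 A &
      forall A : set (borel R d), measurable A -> pushforward p snd A = u A].

Definition transport_cost (R : realType) (d : nat) (w0 w1 : set 'rV[R]_d)
    (c : 'rV[R]_d -> 'rV[R]_d -> R) (u0 u : set (borel R d) -> \bar R) : \bar R :=
  ereal_inf [set (\int[p]_(z in w0 `*` w1) ((c z.1 z.2)%:E))%E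
            | p in coupling w0 w1 u0 u].

(* As Pi is injective, the infimum runs over at most one measure [m]; it is
   +oo outside the range of Pi. *)
Definition transport_dual (R : realType) (d : nat) (w0 w1 : set 'rV[R]_d)
    (c : 'rV[R]_d -> 'rV[R]_d -> R) (u0 : set (borel R d) -> \bar R)
    (h : ('rV[R]_d -> R) -> R) : \bar R :=
  ereal_inf [set transport_cost w0 w1 c u0 m
            | m in [set m : {charge set (borel R d) -> \bar R} |
                    carried_by w1 m /\ dual_eq w1 h (Pi w1 m)]].

Definition c_transform (R : realType) (d : nat) (w1 : set 'rV[R]_d)
    (c : 'rV[R]_d -> 'rV[R]_d -> R) (psi : 'rV[R]_d -> R) (x : 'rV[R]_d) : R :=
  inf [set c x y - psi y | y in w1].

Definition kantorovich_potential (R : realType) (d : nat) (w0 w1 : set 'rV[R]_d)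
    (c : 'rV[R]_d -> 'rV[R]_d -> R) (u0 u : {measure set (borel R d) -> \bar R})
    (psi : 'rV[R]_d -> R) : Prop :=
  {within w1, continuous psi} /\
  ((\int[u]_(y in w1) psi y + \int[u0]_(x in w0) c_transform w1 c psi x)%:E =
     transport_cost w0 w1 c u0 u)%E.

Definition second_quotient (R : realType) (d : nat)
    (F : (('rV[R]_d -> R) -> R) -> \bar R) (u : ('rV[R]_d -> R) -> R)
    (phi : 'rV[R]_d -> R) (t : R) (h : ('rV[R]_d -> R) -> R) : \bar R :=
  ((F (fun f => (u f + t * h f)%R) - F u - (t * h phi)%:E) *
     ((t ^+ 2 / 2)^-1)%:E)%E.

Definition null_seq (R : realType) (t : nat -> R) : Prop :=
  (forall k, 0 < t k) /\ t k @[k --> \oo] --> (0 : R).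

Definition dual_seq (R : realType) (d : nat) (w : set 'rV[R]_d)
    (hk : nat -> ('rV[R]_d -> R) -> R) (h : ('rV[R]_d -> R) -> R) : Prop :=
  (forall k, C1_dual w (hk k)) /\ wstar_cvg w hk h.

Definition second_subderivative (R : realType) (d : nat) (w : set 'rV[R]_d)
    (F : (('rV[R]_d -> R) -> R) -> \bar R) (u : ('rV[R]_d -> R) -> R)
    (phi : 'rV[R]_d -> R) (h : ('rV[R]_d -> R) -> R) : \bar R :=
  ereal_inf [set l | exists (t : nat -> R) (hk : nat -> ('rV[R]_d -> R) -> R),
    [/\ null_seq t, dual_seq w hk h &
        l = limn_einf (fun k => second_quotient F u phi (t k) (hk k))]].

Definition twice_epi_differentiable (R : realType) (d : nat) (w : set 'rV[R]_d)
    (F : (('rV[R]_d -> R) -> R) -> \bar R) (u : ('rV[R]_d -> R) -> R)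
    (phi : 'rV[R]_d -> R) : Prop :=
  forall h, C1_dual w h -> forall t : nat -> R, null_seq t ->
    exists2 hk : nat -> ('rV[R]_d -> R) -> R, dual_seq w hk h &
      second_quotient F u phi (t k) (hk k) @[k --> \oo] -->
        second_subderivative w F u phi h.

Definition disintegration (R : realType) (d : nat) (w0 w1 : set 'rV[R]_d)
    (u0 u : {measure set (borel R d) -> \bar R}) (T : 'rV[R]_d -> 'rV[R]_d)
    (uh : 'rV[R]_d -> probability (borel R d) R) : Prop :=
  [/\ forall y, w1 y -> uh y w0 = 1%E,
      forall B : set (borel R d), measurable B ->
        measurable_fun (w1 : set (borel R d)) (fun y : borel R d => uh y B),
      {ae u, forall y, w1 y -> uh y (w0 `\` T @^-1` [set y]) = 0%E} &
      forall f : borel R d -> \bar R, measurable_fun (w0 : set (borel R d)) f ->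
        (forall x, w0 x -> (0 <= f x)%E) ->
        (\int[u0]_(x in w0) f x =
         \int[u]_(y in w1) \int[uh y]_(x in w0 `&` T @^-1` [set y]) f x)%E].

Definition Hmat (R : realType) (d : nat) (w0 : set 'rV[R]_d)
    (c : 'rV[R]_d -> 'rV[R]_d -> R) (phi : 'rV[R]_d -> R)
    (T : 'rV[R]_d -> 'rV[R]_d) (uh : 'rV[R]_d -> probability (borel R d) R)
    (y : 'rV[R]_d) : 'M[R]_d :=
  invmx (\matrix_(i < d, j < d)
    \int[uh y]_(x in w0 `&` T @^-1` [set y])
      invmx (hess (c x) y - hess phi y) i j).

Definition half_energies (R : realType) (d : nat) (w1 : set 'rV[R]_d)
    (u : {measure set (borel R d) -> \bar R}) (H : 'rV[R]_d -> 'M[R]_d)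
    (h : ('rV[R]_d -> R) -> R) : set (\bar R) :=
  [set ((2^-1)%:E * \int[u]_(y in w1) ((rho y *m H y *m (rho y)^T) ord0 ord0)%:E)%E
  | rho in [set rho | L2 w1 u rho /\ dual_eq w1 h (bracket0 w1 u rho)]].

(* Main.v *)
Require Import Defs.
From HB Require Import structures.
From mathcomp Require Import all_boot all_order all_algebra.
From mathcomp Require Import all_classical all_reals all_analysis measurable_realfun.
From mathcomp Require Import ring lra.

Set Implicit Arguments.
Unset Strict Implicit.
Unset Printing Implicit Defensive.

Import Order.TTheory GRing.Theory Num.Theory.
Import numFieldNormedType.Exports.

Local Open Scope classical_set_scope.
Local Open Scope ring_scope.

(** Let g x y = c x y - phib y - (c x (T x) - phib (T x)) be the slack of the dual
    constraint at the potential phib. The marginals of a coupling of u0 and m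
    determine the integral of c - g, so that the transport cost of m, minus that of
    ub, minus the integral of phib against m - ub, is the infimum of the integrals
    of g over the couplings of u0 and m: the second-order difference quotients only
    see g. By the growth condition, g is at least gamma / 2 |y - T x|^2. Hence nearly
    optimal couplings of u0 and ub concentrate on the graph of T, T pushes u0 forward
    to ub, T x lies in the support of ub and therefore in the interior of w1, and
    there g x has a vanishing gradient and the Hessian
    A x = hess (c x) (T x) - hess phib (T x), a symmetric matrix with A x >= gamma
    that depends continuously on x (gap_expansion, gap_hess_posdef).

    For f in C^1 let E f be half the integral over u0 of
    (grad f)(T x) (A x)^-1 (grad f)(T x)^T, and let s Phi be the supremum of
    Phi f - E f over f, the Legendre transform of E at Phi. Half the second
    subderivative and the infimum over rho are both equal to s Phi.

    The second subderivative is at least 2 s Phi: for small t, Young's inequality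
    and the expansion of g give
    t (f y - f (T x)) <= g x y + t^2 / 2 (grad f)(T x) (A x)^-1 (grad f)(T x)^T,
    up to an error small with respect to t^2 + |y - T x|^2 (gap_young). Integrated
    over any coupling of u0 and ub + t h, this bounds half the difference quotient
    from below by h f - E f, in the limit; and h_k f tends to Phi f
    (near_second_quotient).

    It is at most 2 s Phi, along every sequence t_k: let f_n be a maximizing sequence
    of Phi - E and v_n x = (grad f_n)(T x) (A x)^-1. The image of u0 under T + t v_n
    is a competitor whose cost in terms of g is t^2 E f_n to leading order, and the
    corresponding direction is close to the functional B f_n of the bilinear form B
    of E, which is close to Phi because near-maximizers satisfy the Euler-Lagrange
    equation approximately (near_euler_lagrange). With n tending to infinity slowly
    as t_k tends to 0 this is a recovery sequence, since E f_n tends to s Phi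
    (recovery_sequence). If s Phi is infinite, the constant sequence Phi is one.
    Hence the quotients converge along a suitable sequence for every t_k, which is
    twice epi-differentiability (recovery_cvg, second_subderivativeE).

    The infimum over rho: disintegrating u0 along T turns E f into half the integral
    over ub of (grad f) N (grad f)^T, where N y, the mean of (A x)^-1 over the fiber of
    T at y, is the inverse of H y (mobility_exists). Writing rho = p N, the energy of
    rho is the quadratic form of N at p, and rho represents Phi if and only if
    Phi f is the bilinear form of p and grad f for every f. The form is nonnegative
    at p - grad f, so that every admissible rho has energy at least s Phi
    (le_flux_energy). Conversely, if s Phi is finite, the gradients of a maximizing
    sequence of Phi - E are Cauchy in L^2 (ub), by strict concavity, and their limit p
    gives an admissible rho of energy s Phi (flux_exists). As an admissible rho has
    finite energy, s Phi is finite whenever there is one, and the infimum is then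
    attained (inf_half_energies). *)

(** * Uniformity on compact sets *)

(** A point of K controls the pairs of points within its radius; compactness makes
    half the radius uniform over K. *)
Lemma compact_uniform (R : realType) (V : normedModType R) (K : set V)
    (P : V -> V -> Prop) :
  compact K ->
  (forall p, K p -> exists2 r, 0 < r &
     forall p' q, `|p - p'| < r -> `|p - q| < r -> P p' q) ->
  exists2 r, 0 < r & forall p q, K p -> `|p - q| < r -> P p q.
Proof.
move=> /compact_near_coveringP cK locP.
have := cK R (0 : R)^'+ (fun r p => forall q, `|p - q| < r -> P p q) _.
case.
  move=> p /locP[r r0 Pr].
  exists (ball p (r / 2), [set s : R | s < r / 2]) => /=.
    split; first by apply: nbhsx_ballx; rewrite divr_gt0.
    by apply: nbhs_right_lt; rewrite divr_gt0.
  move=> [p' s]/= [pp' sr] q p'q; apply: Pr.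
    by move: pp'; rewrite -ball_normE /=; lra.
  have := ler_distD p' p q; move: pp'; rewrite -ball_normE /=; lra.
move=> r /= r0 Pr; exists (r / 2); first by rewrite divr_gt0.
move=> p q Kp pq; apply: (Pr (r / 2)) => //=.
- by rewrite sub0r normrN gtr0_norm; lra.
- by rewrite divr_gt0.
Qed.

Lemma within_continuousP (R : realType) (V W : normedModType R) (K : set V)
    (f : V -> W) :
  {within K, continuous f} <->
  forall p, K p -> forall e, 0 < e ->
    exists2 r, 0 < r & forall q, K q -> `|p - q| < r -> `|f p - f q| < e.
Proof.
rewrite subspace_continuousP; split.
  move=> fc p Kp e e0; have /cvgrPdist_lt/(_ _ e0) := fc _ Kp.
  move/nbhs_ballP=> [r /= r0 pr]; exists r => // q Kq pq.
  by apply: pr => //; rewrite -ball_normE.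
move=> fc p Kp; apply/cvgrPdist_lt => e e0.
have [r r0 pr] := fc p Kp e e0.
apply/nbhs_ballP; exists r => // q; rewrite -ball_normE /= => pq Kq.
exact: pr.
Qed.

Lemma eq_within_continuous (R : realType) (V W : normedModType R) (K : set V)
    (f g : V -> W) : (forall x, K x -> f x = g x) ->
  {within K, continuous f} -> {within K, continuous g}.
Proof.
move=> fg /within_continuousP cf; apply/within_continuousP => p Kp e e0.
have [r r0 pr] := cf p Kp e e0; exists r => // q Kq pq.
by rewrite -!fg//; exact: pr.
Qed.

Lemma within_uniformly_continuous (R : realType) (V W : normedModType R)
    (K : set V) (f : V -> W) :
  compact K -> {within K, continuous f} -> forall e, 0 < e ->
  exists2 r, 0 < r &
    forall p q, K p -> K q -> `|p - q| < r -> `|f p - f q| < e.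
Proof.
move=> cK /within_continuousP fc e e0.
have [|r r0 Pr] :=
    @compact_uniform _ _ _ (fun p q => K p -> K q -> `|f p - f q| < e) cK.
  move=> p Kp; have [|r r0 pr] := fc p Kp (e / 2); first by rewrite divr_gt0.
  exists r => // p' q pp' pq Kp' Kq.
  have := ler_distD (f p) (f p') (f q); have := pr _ Kp' pp'.
  have := pr _ Kq pq; rewrite (distrC (f p') (f p)); lra.
by exists r => // p q Kp Kq pq; exact: Pr.
Qed.

Lemma within_continuous_bounded (R : realType) (V W : normedModType R)
    (K : set V) (f : V -> W) :
  compact K -> {within K, continuous f} ->
  exists M, forall p, K p -> `|f p| <= M.
Proof.
move=> cK fc; have cfK := continuous_compact fc cK.
have [M [_ Mf]] := compact_bounded cfK.
exists (M + 1) => p Kp; apply: (Mf (M + 1)); first by rewrite ltrDl.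
by exists p.
Qed.

Lemma within_continuous_compose (R : realType) (V W Z : normedModType R) (K : set V) (L : set W)
    (f : V -> W) (g : W -> Z) : {within K, continuous f} ->
  {within L, continuous g} -> (forall x, K x -> L (f x)) ->
  {within K, continuous (g \o f)}.
Proof.
move=> /within_continuousP cf /within_continuousP cg KL.
apply/within_continuousP => x Kx e e0.
have [r r0 gr] := cg _ (KL _ Kx) e e0; have [s s0 fs] := cf _ Kx r r0.
by exists s => // y Ky xy; apply: gr; [exact: KL|exact: fs].
Qed.

Lemma within_continuous_coord (R : realType) (V : normedModType R) (K : set V) d
    (f : V -> 'rV[R]_d) i : {within K, continuous f} ->
  {within K, continuous (fun x => f x ord0 i)}.
Proof.
move=> cf; apply: (@within_continuous_compose _ _ _ _ K setT f
  (fun x : 'rV[R]_d => x ord0 i) cf) => //.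
by apply: continuous_subspaceT; exact: coord_continuous.
Qed.

Section within_algebra.
Context (R : realType) (V W : normedModType R) (K : set V).

Lemma within_continuousD (f g : V -> W) : {within K, continuous f} ->
  {within K, continuous g} -> {within K, continuous (fun x => f x + g x)}.
Proof. by move=> cf cg x; apply: cvgD; [exact: cf|exact: cg]. Qed.

Lemma within_continuousN (f : V -> W) : {within K, continuous f} ->
  {within K, continuous (fun x => - f x)}.
Proof. by move=> cf x; apply: cvgN; exact: cf. Qed.

Lemma within_continuousZ (a : V -> R) (f : V -> W) : {within K, continuous a} ->
  {within K, continuous f} -> {within K, continuous (fun x => a x *: f x)}.
Proof. by move=> ca cf x; apply: cvgZ; [exact: ca|exact: cf]. Qed.

Lemma within_continuous_cst (a : W) : {within K, continuous (fun=> a)}.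
Proof. by apply: continuous_subspaceT => x; exact: cvg_cst. Qed.

Lemma within_continuous_norm (f : V -> W) : {within K, continuous f} ->
  {within K, continuous (fun x => `|f x|)}.
Proof. by move=> cf x; apply: cvg_norm; exact: cf. Qed.

Lemma within_continuous_id : {within K, continuous (@id V)}.
Proof. by apply: continuous_subspaceT => x; exact: cvg_id. Qed.

End within_algebra.

Lemma within_continuousM (R : realType) (V : normedModType R) (K : set V)
    (f g : V -> R) : {within K, continuous f} ->
  {within K, continuous g} -> {within K, continuous (fun x => f x * g x)}.
Proof. exact: within_continuousZ. Qed.

Lemma within_continuous_sum (R : realType) (V : normedModType R) (K : set V)
    (I : Type) (s : seq I) (F : I -> V -> R) :
  (forall i, {within K, continuous (F i)}) ->
  {within K, continuous (fun x => \sum_(i <- s) F i x)}.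
Proof.
move=> cF; elim: s => [|i s ih].
  rewrite (_ : (fun _ => _) = fun=> 0); first exact: within_continuous_cst.
  by apply/funext => x; rewrite big_nil.
rewrite (_ : (fun _ => _) = fun x => F i x + \sum_(i <- s) F i x).
  exact: within_continuousD.
by apply/funext => x; rewrite big_cons.
Qed.

(** * The Euclidean norm *)

Section euclid.
Context (R : realType) (d : nat).
Implicit Types (x y z : 'rV[R]_d).

Lemma dotC x y : dot x y = dot y x.
Proof. by apply: eq_bigr => i _; rewrite mulrC. Qed.

Lemma dotDl x y z : dot (x + y) z = dot x z + dot y z.
Proof. by rewrite -big_split; apply: eq_bigr => i _; rewrite mxE mulrDl. Qed.

Lemma dotZl a x y : dot (a *: x) y = a * dot x y.
Proof. by rewrite mulr_sumr; apply: eq_bigr => i _; rewrite mxE mulrA. Qed.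

Lemma dotDr x y z : dot x (y + z) = dot x y + dot x z.
Proof. by rewrite !(dotC x) dotDl. Qed.

Lemma dotZr a x y : dot x (a *: y) = a * dot x y.
Proof. by rewrite !(dotC x) dotZl. Qed.

Lemma dotNl x y : dot (- x) y = - dot x y.
Proof. by rewrite -scaleN1r dotZl mulN1r. Qed.

Lemma dotNr x y : dot x (- y) = - dot x y.
Proof. by rewrite !(dotC x) dotNl. Qed.

Lemma dot_ge0 x : 0 <= dot x x.
Proof. by apply: sumr_ge0 => i _; rewrite -expr2 sqr_ge0. Qed.

Lemma enorm_ge0 x : 0 <= enorm x.
Proof. exact: sqrtr_ge0. Qed.

Lemma sqr_enorm x : enorm x ^+ 2 = dot x x.
Proof.
rewrite sqr_sqrtr; first by apply: eq_bigr => i _; rewrite expr2.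
by apply: sumr_ge0 => i _; exact: sqr_ge0.
Qed.

Lemma enormZ a x : enorm (a *: x) = `|a| * enorm x.
Proof.
apply/eqP; rewrite -(@eqrXn2 _ 2)// ?mulr_ge0 ?enorm_ge0//.
by rewrite exprMn !sqr_enorm dotZl dotZr real_normK ?num_real// mulrA expr2.
Qed.

Lemma enorm0 : enorm (0 : 'rV[R]_d) = 0.
Proof. by rewrite -(scale0r 0) enormZ normr0 mul0r. Qed.

Lemma enormN x : enorm (- x) = enorm x.
Proof. by rewrite -scaleN1r enormZ normrN1 mul1r. Qed.

Lemma coord_le_norm x i : `|x ord0 i| <= `|x|.
Proof.
rewrite [X in _ <= X]mx_normrE.
by apply: (@le_trans _ _ `|x (ord0, i).1 (ord0, i).2|) => //; apply: le_bigmax.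
Qed.

Lemma norm_le_coord x M : 0 <= M -> (forall i, `|x ord0 i| <= M) -> `|x| <= M.
Proof.
move=> M0 xM; rewrite [X in X <= _]mx_normrE.
by apply: bigmax_le => //= -[i j] _ /=; rewrite (ord1 i).
Qed.

Lemma norm_le_enorm x : `|x| <= enorm x.
Proof.
apply: norm_le_coord => [|i]; first exact: enorm_ge0.
rewrite -ler_sqr ?nnegrE ?enorm_ge0// sqr_enorm real_normK ?num_real//.
rewrite /dot (bigD1 i)//= -expr2 lerDl.
by apply: sumr_ge0 => j _; rewrite -expr2 sqr_ge0.
Qed.

Lemma enorm_le_norm x : enorm x <= d%:R * `|x|.
Proof.
rewrite -ler_sqr ?nnegrE ?enorm_ge0 ?mulr_ge0// sqr_enorm.
apply: (@le_trans _ _ (\sum_(i < d) `|x| ^+ 2)).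
  apply: ler_sum => i _; rewrite -expr2 -real_normK ?num_real//.
  by rewrite ler_sqr ?nnegrE// coord_le_norm.
rewrite sumr_const card_ord exprMn -[X in X <= _]mulr_natl.
rewrite ler_wpM2r ?sqr_ge0//; case: d => [|n]; first by rewrite expr0n.
by rewrite -natrX ler_nat expnS leq_pmulr// expn_gt0.
Qed.

Lemma cauchy_schwarz x y : `|dot x y| <= enorm x * enorm y.
Proof.
have [/eqP x0|x0] := boolP (enorm x == 0).
  have -> : x = 0.
    by apply/eqP; rewrite -normr_le0 (le_trans (norm_le_enorm _))// x0.
  by rewrite enorm0 mul0r -(scale0r 0) dotZl mul0r normr0.
have [/eqP y0|y0] := boolP (enorm y == 0).
  have -> : y = 0.
    by apply/eqP; rewrite -normr_le0 (le_trans (norm_le_enorm _))// y0.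
  by rewrite enorm0 mulr0 dotC -(scale0r 0) dotZl mul0r normr0.
have xy : 0 < enorm x * enorm y by rewrite mulr_gt0// lt0r ?x0 ?y0 enorm_ge0.
have h1 := dot_ge0 (enorm y *: x - enorm x *: y).
have h2 := dot_ge0 (enorm y *: x + enorm x *: y).
move: h1 h2; rewrite !(dotDl,dotDr,dotNl,dotNr,dotZl,dotZr) (dotC y x) -!sqr_enorm.
move=> h1 h2; rewrite ler_norml.
by apply/andP; split; rewrite -(ler_pM2l xy); lra.
Qed.

End euclid.

(** * Borel measurability *)

Section borel.
Context (R : realType) (d : nat).

Lemma open_borel (U : set 'rV[R]_d) : open U -> measurable (U : set (borel R d)).
Proof. by move=> oU; apply: sub_sigma_algebra. Qed.

Lemma closed_borel (U : set 'rV[R]_d) :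
  closed U -> measurable (U : set (borel R d)).
Proof.
move=> cU; rewrite -(setCK U); apply: measurableC; apply: open_borel.
exact: closed_openC.
Qed.

Lemma compact_borel (U : set 'rV[R]_d) :
  compact U -> measurable (U : set (borel R d)).
Proof.
by move=> cU; apply: closed_borel; apply: compact_closed.
Qed.

(** The balls with rational centers and radii 1 / n form a countable base. *)
Let qball (i : 'rV[rat]_d * nat) : set 'rV[R]_d :=
  ball (map_mx ratr i.1 : 'rV[R]_d) i.2.+1%:R^-1.

Let qball_near (x : 'rV[R]_d) (r : R) : 0 < r ->
  exists i, qball i x /\ qball i `<=` ball x r.
Proof.
move=> r0; pose n := Num.truncn (2 / r).
have [e enE] : {e : R | e = n.+1%:R^-1} by exists n.+1%:R^-1.
have nr : e < r / 2.
  rewrite enE -[ltRHS]invrK ltf_pV2 ?posrE ?invr_gt0 ?divr_gt0// invf_div.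
  exact: truncnS_gt.
have n0 : 0 < e by rewrite enE invr_gt0.
have /choice[q qx] : forall i : 'I_d, exists q : rat,
    `|ratr q - x ord0 i| <= e / 2.
  move=> i.
  have [|q] := @rat_in_itvoo R (x ord0 i - e / 2)
    (x ord0 i + e / 2); first by lra.
  rewrite in_itv /= => /andP[q1 q2]; exists q; rewrite ler_norml.
  by apply/andP; split; lra.
have xq : `|map_mx ratr (\row_i q i) - x| <= e / 2.
  by apply: norm_le_coord => [|i]; [lra|rewrite !mxE; exact: qx].
exists (\row_i q i, n); split; rewrite /qball/= -enE -!ball_normE /=.
  by apply: le_lt_trans xq _; lra.
move=> y /= qy.
have := ler_distD (map_mx ratr (\row_i q i)) x y.
rewrite (distrC x (map_mx _ _)); lra.
Qed.

Let open_bigcup_qball (U : set 'rV[R]_d) : open U ->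
  U = \bigcup_(i in [set i | qball i `<=` U]) qball i.
Proof.
move=> oU; apply/seteqP; split => [x Ux|x [i iU /iU//]].
have /nbhs_ballP[r /= r0 rU] : nbhs x U by exact: open_nbhs_nbhs.
have [i [ix ir]] := qball_near x r0.
by exists i => //= y /ir /rU.
Qed.

Let open_bigcup_qball2 (U : set ('rV[R]_d * 'rV[R]_d)) : open U ->
  U = \bigcup_(i in [set i | qball i.1 `*` qball i.2 `<=` U])
        (qball i.1 `*` qball i.2).
Proof.
move=> oU; apply/seteqP; split => [[x y] Ux|x [i iU /iU//]].
have /nbhs_ballP[r /= r0 rU] : nbhs (x, y) U by exact: open_nbhs_nbhs.
have [i [ix ir]] := qball_near x r0; have [j [jx jr]] := qball_near y r0.
by exists (i, j) => //= -[u v] [/= /ir u1 /jr v1]; apply: rU.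
Qed.

Lemma bigcup_in_measurable (I : countType) d' (T : measurableType d')
    (P : set I) (F : I -> set T) :
  (forall i, measurable (F i)) -> measurable (\bigcup_(i in P) F i).
Proof.
move=> mF; rewrite bigcup_mkcond; apply: countable_bigcupT_measurable.
  exact: countableP.
by move=> i; case: ifP.
Qed.

(** An open set of the product is a countable union of products of basic balls,
    so that the Borel sets of the product are the product of the Borel sets. *)
Lemma open_borel2 (U : set ('rV[R]_d * 'rV[R]_d)) : open U ->
  measurable (U : set (borel R d * borel R d)).
Proof.
move=> /open_bigcup_qball2 ->.
apply: (@bigcup_in_measurable
  (('rV[rat]_d * nat) * ('rV[rat]_d * nat))%type _ (borel R d * borel R d)%type).
by move=> i; apply: measurableX; apply: open_borel; exact: ball_open.
Qed.

Lemma closed_borel2 (U : set ('rV[R]_d * 'rV[R]_d)) : closed U ->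
  measurable (U : set (borel R d * borel R d)).
Proof.
move=> cU; rewrite -(setCK U); apply: measurableC; apply: open_borel2.
exact: closed_openC.
Qed.

Lemma continuous_borel (D : set 'rV[R]_d) (f : 'rV[R]_d -> R) :
  measurable (D : set (borel R d)) -> {within D, continuous f} ->
  measurable_fun (D : set (borel R d)) (f : borel R d -> R).
Proof.
move=> mD /continuousP cf; apply: (measurability _ (RGenOpens.measurableE R)).
move=> _ [_ [a [b ->] <-]].
have /open_subspaceP [V oV VD] := cf _ (@interval_open _ (BRight a) (BLeft b) isT isT).
by rewrite setIC -VD; apply: measurableI => //; exact: open_borel.
Qed.

Lemma continuous_borel2 (D : set ('rV[R]_d * 'rV[R]_d))
    (f : 'rV[R]_d * 'rV[R]_d -> R) :
  measurable (D : set (borel R d * borel R d)) -> {within D, continuous f} ->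
  measurable_fun (D : set (borel R d * borel R d)) (f : borel R d * borel R d -> R).
Proof.
move=> mD /continuousP cf; apply: (measurability _ (RGenOpens.measurableE R)).
move=> _ [_ [a [b ->] <-]].
have /open_subspaceP [V oV VD] := cf _ (@interval_open _ (BRight a) (BLeft b) isT isT).
by rewrite setIC -VD; apply: measurableI => //; exact: open_borel2.
Qed.

Lemma coord_borel i : measurable_fun setT (fun x : borel R d => x ord0 i).
Proof.
apply: continuous_borel => //; apply: continuous_subspaceT.
exact: coord_continuous.
Qed.

Lemma borel_coord d' (T : measurableType d') (D : set T) (f : T -> 'rV[R]_d) :
  (forall i, measurable_fun D (fun x => f x ord0 i)) ->
  measurable_fun D (f : T -> borel R d).
Proof.
move=> mf mD; apply: (@measurability _ _ T (borel R d) D f (@open 'rV[R]_d)) => //.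
move=> _ [U oU <-].
rewrite (open_bigcup_qball oU) preimage_bigcup setI_bigcupr.
apply: (@bigcup_in_measurable ('rV[rat]_d * nat)%type).
move=> [q n]; rewrite /qball/=.
have -> : ball (map_mx ratr q : 'rV[R]_d) n.+1%:R^-1 =
    \bigcap_(i : 'I_d) [set x | (ball (ratr (q ord0 i) : R) n.+1%:R^-1 (x ord0 i))].
  apply/seteqP; split => [x [n0 xq] i _|x xq].
    by have := xq ord0 i; rewrite !mxE.
  split=> [|i j]; first by rewrite /= invr_gt0.
  by rewrite (ord1 i) !mxE; exact: xq.
rewrite preimage_bigcap.
have [d0|d0] := pselect (inhabited 'I_d); last first.
  have -> : [set: 'I_d] = set0.
    by apply/seteqP; split => // i _; case: d0.
  by rewrite bigcap_set0 setIT.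
rewrite setIC -bigcapIl; last by case: d0 => i; exists i.
apply: fin_bigcap_measurable => //.
move=> i _; rewrite setIC.
have := mf i mD (ball (ratr (q ord0 i) : R) n.+1%:R^-1) (measurable_ball _ _).
by [].
Qed.

End borel.

(** * Bounded measurable functions on sets of finite measure *)

(** On sets of finite measure these functions are integrable and, unlike the
    integrable functions, they are closed under products. *)
Definition bounded_mfun d (T : measurableType d) (R : realType) (D : set T)
    (f : T -> R) :=
  measurable_fun D f /\ exists M, forall x, D x -> `|f x| <= M.

Section bmf.
Context d (T : measurableType d) (R : realType) (D : set T).
Implicit Types f g : T -> R.
Notation bmf := (@bounded_mfun _ T R D).

Lemma bmf_cst a : bmf (fun=> a).
Proof. by split; [exact: measurable_cst|exists `|a|]. Qed.

Lemma bmfD f g : bmf f -> bmf g -> bmf (fun x => f x + g x).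
Proof.
move=> [mf [M fM]] [mg [N gN]]; split; first exact: measurable_funD.
exists (M + N) => x Dx; rewrite (le_trans (ler_normD _ _))//.
by rewrite lerD ?fM ?gN.
Qed.

Lemma bmfM f g : bmf f -> bmf g -> bmf (fun x => f x * g x).
Proof.
move=> [mf [M fM]] [mg [N gN]]; split; first exact: measurable_funM.
by exists (M * N) => x Dx; rewrite normrM ler_pM ?fM ?gN.
Qed.

Lemma bmfZ a f : bmf f -> bmf (fun x => a * f x).
Proof. exact/bmfM/bmf_cst. Qed.

Lemma bmfN f : bmf f -> bmf (fun x => - f x).
Proof.
move=> [mf [M fM]]; split; first exact: measurable_funN.
by exists M => x Dx; rewrite normrN fM.
Qed.

Lemma bmfB f g : bmf f -> bmf g -> bmf (fun x => f x - g x).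
Proof. by move=> bf bg; apply: bmfD => //; exact: bmfN. Qed.

Lemma bmf_sum (I : Type) (s : seq I) (F : I -> T -> R) :
  (forall i, bmf (F i)) -> bmf (fun x => \sum_(i <- s) F i x).
Proof.
move=> bF; elim: s => [|i s ih].
  by under [X in bounded_mfun _ X]eq_fun do rewrite big_nil; exact: bmf_cst.
by under [X in bounded_mfun _ X]eq_fun do rewrite big_cons; exact: bmfD.
Qed.

Lemma eq_bmf f g : {in D, f =1 g} -> bmf f -> bmf g.
Proof.
move=> fg [mf [M fM]]; split; first exact: eq_measurable_fun mf.
by exists M => x Dx; rewrite -fg ?inE// fM.
Qed.

Context (mu : {measure set T -> \bar R}) (mD : measurable D)
  (muD : (mu D < +oo)%E).

Lemma bmf_integrable f : bmf f -> mu.-integrable D (EFin \o f).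
Proof.
move=> [mf [M fM]]; apply: measurable_bounded_integrable => //.
exists M; split; first exact: num_real.
move=> x Mx y Dy; apply: (le_trans (fM y Dy)); exact: ltW.
Qed.

Lemma Rint_fin f : bmf f ->
  (\int[mu]_(x in D) (f x)%:E)%E = (\int[mu]_(x in D) f x)%:E.
Proof.
by move=> bf; rewrite /Rintegral fineK//; apply: integrable_fin_num => //;
  exact: bmf_integrable.
Qed.

Lemma RintD f g : bmf f -> bmf g -> \int[mu]_(x in D) (f x + g x) =
  \int[mu]_(x in D) f x + \int[mu]_(x in D) g x.
Proof. by move=> bf bg; rewrite RintegralD//; exact: bmf_integrable. Qed.

Lemma RintB f g : bmf f -> bmf g -> \int[mu]_(x in D) (f x - g x) =
  \int[mu]_(x in D) f x - \int[mu]_(x in D) g x.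
Proof. by move=> bf bg; rewrite RintegralB//; exact: bmf_integrable. Qed.

Lemma RintZ a f : bmf f -> \int[mu]_(x in D) (a * f x) =
  a * \int[mu]_(x in D) f x.
Proof. by move=> bf; rewrite RintegralZl//; exact: bmf_integrable. Qed.

Lemma le_Rint f g : bmf f -> bmf g -> (forall x, D x -> f x <= g x) ->
  \int[mu]_(x in D) f x <= \int[mu]_(x in D) g x.
Proof. by move=> bf bg fg; apply: le_Rintegral => //; exact: bmf_integrable. Qed.

Lemma Rint_cst a : \int[mu]_(x in D) a = a * fine (mu D).
Proof. exact: Rintegral_cst. Qed.

Lemma Rint_sum (I : Type) (s : seq I) (F : I -> T -> R) :
  (forall i, bmf (F i)) -> \int[mu]_(x in D) (\sum_(i <- s) F i x) =
  \sum_(i <- s) \int[mu]_(x in D) F i x.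
Proof.
move=> bF; elim: s => [|i s ih].
  rewrite big_nil; under eq_Rintegral do rewrite big_nil.
  by rewrite Rint_cst mul0r.
rewrite big_cons -ih; under eq_Rintegral do rewrite big_cons.
by rewrite RintD//; exact: bmf_sum.
Qed.

Lemma Rint_norm_le f M : bmf f -> (forall x, D x -> `|f x| <= M) ->
  `|\int[mu]_(x in D) f x| <= M * fine (mu D).
Proof.
move=> bf fM; rewrite ler_norml -mulNr -!Rint_cst.
by apply/andP; split; apply: le_Rint => //; try exact: bmf_cst;
  move=> x /fM; rewrite ler_norml => /andP[].
Qed.

End bmf.

(** If a charge is nonnegative, its negative part vanishes for every Hahn
    decomposition. *)
Lemma jordan_integral_measure d (T : measurableType d) (R : realType)
    (nu : {charge set T -> \bar R}) (mu : {measure set T -> \bar R})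
    (D : set T) (f : T -> R) (P N : set T)
    (nuPN : hahn_decomposition nu P N) : measurable D ->
  (forall A, measurable A -> nu A = mu A) ->
  Rintegral (jordan_pos nuPN) D f - Rintegral (jordan_neg nuPN) D f =
  \int[mu]_(x in D) f x.
Proof.
move=> mD numu.
have [[mP posP] [mN negN] _ _] := nuPN.
have neg0 A : measurable A -> jordan_neg nuPN A = 0%E.
  move=> mA; rewrite jordan_negE cjordan_negE /crestr0 mem_set// /crestr/=.
  have mAN : measurable (A `&` N) by exact: measurableI.
  have : (nu (A `&` N) <= 0)%E by apply: negN => //; exact: subIsetr.
  rewrite numu// => h; apply/eqP; rewrite eqe_oppLR oppe0 eq_le h/=.
  exact: measure_ge0.
have pos A : measurable A -> jordan_pos nuPN A = mu A.
  move=> mA; rewrite -numu// (jordan_decomp nuPN)// /cadd/= /cscale/= neg0//.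
  by rewrite mule0 adde0.
rewrite /Rintegral.
rewrite (eq_measure_integral mu); last by move=> A mA _; exact: pos.
rewrite [X in _ - fine X](eq_measure_integral mzero).
  by rewrite integral_measure_zero subr0.
by move=> A mA _; exact: neg0.
Qed.

Lemma charge_integral_measure d (T : measurableType d) (R : realType)
    (nu : {charge set T -> \bar R}) (mu : {measure set T -> \bar R})
    (D : set T) (f : T -> R) : measurable D ->
  (forall A, measurable A -> nu A = mu A) ->
  charge_integral nu D f = \int[mu]_(x in D) f x.
Proof. by move=> mD numu; exact: jordan_integral_measure. Qed.

Definition push_measure d1 d2 (T1 : measurableType d1) (T2 : measurableType d2)
    (R : realType) (m : {measure set T1 -> \bar R}) (f : T1 -> T2)
    (mf : measurable_fun setT f) : {measure set T2 -> \bar R} :=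
  measure_function_pushforward__canonical__measure_function_Measure m mf.

Definition push_charge d1 d2 (T1 : measurableType d1) (T2 : measurableType d2)
    (R : realType) (m : {charge set T1 -> \bar R}) (f : T1 -> T2)
    (mf : measurable_fun setT f) : {charge set T2 -> \bar R} :=
  measure_function_pushforward__canonical__charge_Charge m mf.

(** * Taylor expansions, uniformly on compact sets *)

Lemma dist_le_via (R : realFieldType) (x y z e : R) :
  `|x - y| < e / 2 -> `|x - z| < e / 2 -> `|y - z| <= e.
Proof. by have := ler_distD x y z; rewrite (distrC y x); lra. Qed.

Lemma dist_lt_eq (R : realFieldType) (x y x' y' e : R) :
  x = x' -> y = y' -> `|x' - y'| < e -> `|x - y| < e.
Proof. by move=> -> ->. Qed.

Lemma dist_le_limits (R : realFieldType) (x y x' y' D D' k e : R) :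
  k != 0 -> D = x' * k -> D' = y' * k -> D = D' ->
  `|x - x'| < e / 2 -> `|y - y'| < e / 2 -> `|x - y| <= e.
Proof.
move=> k0 -> -> /(mulIf k0) ->; rewrite (distrC x) (distrC y).
exact: dist_le_via.
Qed.

Lemma mvt_from0 (R : realType) (f df : R -> R) (a : R) : 0 <= a ->
  (forall s : R, 0 <= s <= a -> is_derive s 1 f (df s)) ->
  exists2 s, 0 <= s <= a & f a - f 0 = df s * a.
Proof.
move=> a0 dl.
have d1 s : s \in `]0, a[ -> is_derive s 1 f (df s).
  by move=> sa; have := subset_itv_oo_cc sa; rewrite in_itv; exact: dl.
have [|c] := MVT_segment a0 d1.
  apply: derivable_within_continuous => s; rewrite in_itv => /dl.
  by case.
by rewrite in_itv subr0; exists c.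
Qed.

Section lines.
Context (R : realType) (V : normedModType R).
Implicit Types (F : V -> R) (p v : V).

Lemma is_derive_line F p v (s : R) : derivable F (p + s *: v) v ->
  is_derive s 1 (fun s => F (p + s *: v)) ('D_v F (p + s *: v)).
Proof.
move=> dF; rewrite /derive.
have E : (fun h : R => h^-1 *:
    (((fun s => F (p + s *: v)) \o shift s) (h *: 1) - F (p + s *: v))) =
    (fun h : R => h^-1 *: ((F \o shift (p + s *: v)) (h *: v) - F (p + s *: v))).
  apply/funext => h /=; congr (_ *: (F _ - _)).
  by rewrite [h *: 1]mulr1 scalerDl addrCA addrA addrAC.
by split; rewrite /derivable/derive E.
Qed.

Lemma mvt_line F p v (a : R) : 0 <= a ->
  (forall s : R, 0 <= s <= a -> derivable F (p + s *: v) v) ->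
  exists2 s, 0 <= s <= a & F (p + a *: v) - F p = 'D_v F (p + s *: v) * a.
Proof.
move=> a0 dF.
have [|c ca] := @mvt_from0 R (fun s => F (p + s *: v))
    (fun s => 'D_v F (p + s *: v)) a a0.
  by move=> s sa; apply: is_derive_line; exact: dF.
by rewrite scale0r addr0; exists c.
Qed.

(** The mean value theorem bounds the remainder of the first-order expansion of
    th1, which is the derivative of the remainder k of th. *)
Lemma taylor2 (th th1 th2 : R -> R) (m e : R) :
  (forall s : R, 0 <= s <= 1 -> is_derive s 1 th (th1 s)) ->
  (forall s : R, 0 <= s <= 1 -> is_derive s 1 th1 (th2 s)) ->
  (forall s : R, 0 <= s <= 1 -> `|th2 s - m| <= e) ->
  `|th 1 - th 0 - th1 0 - m / 2| <= e.
Proof.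
move=> d0 d1 b2.
have th1b (s : R) : 0 <= s <= 1 -> `|th1 s - th1 0 - m * s| <= e.
  move=> s01; have s0 : 0 <= s by case/andP: s01.
  have in01 u : 0 <= u <= s -> 0 <= u <= 1.
    by move=> /andP[u0 us]; rewrite u0 (le_trans us)//; case/andP: s01.
  have [|c cs ->] := @mvt_from0 R th1 th2 s s0.
    by move=> u /in01; exact: d1.
  rewrite -mulrBl normrM (ger0_norm s0).
  have /b2 := in01 _ cs; case/andP: s01 => _ s1 b.
  by apply: le_trans b; rewrite ler_piMr.
pose k : R -> R := th - (th1 0 \*: (@id R)) - ((m / 2) \*: ((@id R : R -> R) ^+ 2)).
have kE s : k s = th s - th1 0 * s - m / 2 * s ^+ 2 by [].
have dk (s : R) : 0 <= s <= 1 -> is_derive s 1 k (th1 s - th1 0 - m * s).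
  move=> s01; have := d0 s s01 => ds.
  apply: is_derive_eq.
  rewrite /= expr1 /GRing.scale/= /id; by field.
have [c /th1b + E] := @mvt_from0 R k (fun s => th1 s - th1 0 - m * s) 1 ler01 dk.
have -> : th 1 - th 0 - th1 0 - m / 2 = k 1 - k 0.
  by rewrite !kE expr0n expr1n /=; ring.
by rewrite E mulr1.
Qed.

End lines.

Section c2.
Context (R : realType) (V : normedModType R) (d : nat) (e : 'I_d -> V).
Implicit Types (F : V -> R) (p : V) (z : 'rV[R]_d).

(** The vectors e i span the directions of differentiation: all of R^d, or the
    second variable in R^d x R^d. *)
Definition lincomb z : V := \sum_i z ord0 i *: e i.

Lemma derive_lincomb F p z : differentiable F p ->
  'D_(lincomb z) F p = \sum_i z ord0 i * 'D_(e i) F p.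
Proof.
move=> dF; rewrite deriveE// /lincomb linear_sum.
by apply: eq_bigr => i _; rewrite linearZ deriveE.
Qed.

Lemma norm_lincomb z : `|lincomb z| <= (\sum_i `|e i|) * `|z|.
Proof.
rewrite mulr_suml; apply: (le_trans (ler_norm_sum _ _ _)).
by apply: ler_sum => i _; rewrite normrZ mulrC ler_wpM2l// coord_le_norm.
Qed.

Definition hess_along F p : 'M[R]_d :=
  \matrix_(i, j) 'D_(e j) ('D_(e i) F) p.

Lemma hess_alongE F p i j : hess_along F p i j = 'D_(e j) ('D_(e i) F) p.
Proof. by rewrite mxE. Qed.

Definition qform (A : 'M[R]_d) z : R := \sum_i \sum_j z ord0 i * z ord0 j * A i j.

Lemma taylor2_hess F (U : set V) p z (M : 'M[R]_d) eps :
  cont_diff2_open U F ->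
  (forall s : R, 0 <= s <= 1 -> U (p + s *: lincomb z)) ->
  (forall s i j, 0 <= s <= 1 ->
     `|hess_along F (p + s *: lincomb z) i j - M i j| <= eps) ->
  `|F (p + lincomb z) - F p - \sum_i z ord0 i * 'D_(e i) F p
    - qform M z / 2| <= d%:R ^+ 2 * eps * `|z| ^+ 2.
Proof.
move=> [dF ddF] inU hM.
pose v := lincomb z.
pose th s := F (p + s *: v).
pose th1 s := \sum_i z ord0 i * 'D_(e i) F (p + s *: v).
pose th2 s := qform (hess_along F (p + s *: v)) z.
have := @taylor2 R th th1 th2 (qform M z) (d%:R ^+ 2 * eps * `|z| ^+ 2).
rewrite /th /th1 /th2 !scale1r !scale0r !addr0 -/v; apply.
- move=> s /inU Us; rewrite -derive_lincomb; last exact: dF.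
  by apply: is_derive_line; apply: diff_derivable; exact: dF.
- move=> s /inU Us.
  have -> : qform (hess_along F (p + s *: v)) z =
      \sum_i z ord0 i *: 'D_v ('D_(e i) F) (p + s *: v).
    apply: eq_bigr => i _; have [dDF _] := ddF (e i).
    rewrite derive_lincomb; last exact: dDF.
    by rewrite /GRing.scale/= mulr_sumr; apply: eq_bigr => j _;
      rewrite mxE mulrA.
  have -> : (fun s => \sum_i z ord0 i * 'D_(e i) F (p + s *: v)) =
      \sum_i (z ord0 i \*: (fun s => 'D_(e i) F (p + s *: v))).
    by apply/funext => u; rewrite fct_sumE.
  apply: is_derive_sum => i; apply: is_deriveZ.
  apply: is_derive_line; apply: diff_derivable.
  by have [dDF _] := ddF (e i); exact: dDF.
- move=> s s01; rewrite /qform -sumrB.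
  apply: (@le_trans _ _ (\sum_(i < d) \sum_(j < d) eps * `|z| ^+ 2)).
    apply: (le_trans (ler_norm_sum _ _ _)); apply: ler_sum => i _.
    rewrite -sumrB; apply: (le_trans (ler_norm_sum _ _ _)); apply: ler_sum => j _.
    rewrite -mulrBr normrM normrM mulrC ler_pM ?mulr_ge0//; first exact: hM.
    by rewrite expr2 ler_pM// coord_le_norm.
  by rewrite !sumr_const !card_ord -mulrnA -[X in X <= _]mulr_natl natrM expr2 mulrA.
Qed.

(** The Hessian is uniformly continuous near the compact set K. *)
Lemma taylor2_compact F (U K : set V) eps :
  cont_diff2_open U F -> open U -> compact K -> K `<=` U -> 0 < eps ->
  exists2 r, 0 < r & forall p z, K p -> `|z| < r ->
   `|F (p + lincomb z) - F p - \sum_i z ord0 i * 'D_(e i) F p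
      - qform (hess_along F p) z / 2| <= eps * `|z| ^+ 2.
Proof.
move=> c2F oU cK KU eps0.
pose eta := eps / (d%:R ^+ 2 + 1).
have d0 : 0 < d%:R ^+ 2 + 1 :> R by rewrite ltr_wpDl// exprn_ge0.
have eta0 : 0 < eta by rewrite divr_gt0.
have [|r r0 Pr] := @compact_uniform _ _ K (fun p q => U q /\
    forall i j, `|hess_along F q i j - hess_along F p i j| <= eta) cK.
  move=> p Kp.
  have : \forall q \near p, U q /\
      forall i j, `|hess_along F p i j - hess_along F q i j| < eta / 2.
    apply: filterI; first by apply: open_nbhs_nbhs; split => //; exact: KU.
    apply: filter_forall => i; apply: filter_forall => j.
    have [_ /(_ (e i))[_ /(_ (e j) p (KU _ Kp)) cH]] := c2F.
    have e2 : 0 < eta / 2 by rewrite divr_gt0.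
    have hc : \forall q \near p, `|'D_(e j) ('D_(e i) F) p -
        'D_(e j) ('D_(e i) F) q| < eta / 2.
      by move/cvgrPdist_lt : cH => /(_ _ e2).
    apply: filterS hc => q hq.
    exact: (dist_lt_eq (hess_alongE F p i j) (hess_alongE F q i j) hq).
  move=> /nbhs_ballP[r /= r0 Pr]; exists r => // p' q pp' pq.
  have [_ h1] : _ := Pr p' ltac:(by rewrite -ball_normE).
  have [Uq h2] : _ := Pr q ltac:(by rewrite -ball_normE).
  split=> // i j.
  exact: (dist_le_via (h2 i j) (h1 i j)).
pose S := \sum_i `|e i| + 1.
have S0 : 0 < S by rewrite ltr_wpDl// sumr_ge0.
exists (r / S) => [|p z Kp zr]; first by rewrite divr_gt0.
have Ps s : 0 <= s <= 1 -> `|p - (p + s *: lincomb z)| < r.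
  move=> /andP[s0 s1]; rewrite opprD addrA subrr sub0r normrN normrZ.
  rewrite ger0_norm//; apply: (@le_lt_trans _ _ (S * `|z|)); last first.
    by rewrite mulrC -ltr_pdivlMr.
  rewrite (@le_trans _ _ (`|lincomb z|))// ?ler_piMl//.
  by rewrite (le_trans (norm_lincomb z))// ler_wpM2r// lerDl.
apply: (@le_trans _ _ (d%:R ^+ 2 * eta * `|z| ^+ 2)).
  apply: (taylor2_hess c2F) => [s /Ps/(Pr _ _ Kp)[]//|s i j /Ps/(Pr _ _ Kp)[_]].
  exact.
rewrite ler_wpM2r ?exprn_ge0// /eta mulrA ler_pdivrMr// mulrC ler_pM2l//.
by rewrite lerDl.
Qed.

(** Schwarz' theorem: both mixed derivatives are limits of the second
   differences of F over the parallelograms spanned by s a and s b. *)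
Lemma schwarz F (U : set V) p (a b : V) :
  cont_diff2_open U F -> open U -> U p ->
  'D_b ('D_a F) p = 'D_a ('D_b F) p.
Proof.
move=> [dF ddF] oU Up.
apply/eqP; rewrite -subr_eq0 -normr_le0; apply/ler_addgt0Pl => eps eps0.
rewrite addr0.
have [_ /(_ b p Up) /cvgrPdist_lt cab] := ddF a.
have [_ /(_ a p Up) /cvgrPdist_lt cba] := ddF b.
have e2 : 0 < eps / 2 by rewrite divr_gt0.
have nU : nbhs p U by apply: open_nbhs_nbhs.
have : \forall q \near p, [/\ U q, `|'D_b ('D_a F) p - 'D_b ('D_a F) q| < eps / 2
    & `|'D_a ('D_b F) p - 'D_a ('D_b F) q| < eps / 2].
  apply: filterS3 nU (cab _ e2) (cba _ e2) => q Uq h1 h2.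
  exact: And3 Uq h1 h2.
move=> /nbhs_ballP[r /= r0 Pr].
pose s := r / (`|a| + `|b| + 1).
have n0 : 0 < `|a| + `|b| + 1 by rewrite ltr_wpDl// addr_ge0.
have s0 : 0 < s by rewrite divr_gt0.
have near_p u v : 0 <= u <= s -> 0 <= v <= s -> ball p r (p + u *: a + v *: b).
  move=> /andP[u0 us] /andP[v0 vs]; rewrite -ball_normE /=.
  rewrite -addrA opprD addrA subrr sub0r normrN.
  apply: (le_lt_trans (ler_normD _ _)); rewrite !normrZ !ger0_norm//.
  apply: (@le_lt_trans _ _ (s * (`|a| + `|b|))).
    by rewrite mulrDr lerD// ler_wpM2r.
  by rewrite /s mulrAC ltr_pdivrMr// ltr_pM2l// ltrDl.
have mixed (x y : V) : (forall u v, 0 <= u <= s -> 0 <= v <= s ->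
    ball p r (p + u *: x + v *: y)) ->
    exists u v, [/\ 0 <= u <= s, 0 <= v <= s &
     F (p + s *: x + s *: y) - F (p + s *: x) - F (p + s *: y) + F p =
     'D_y ('D_x F) (p + u *: x + v *: y) * s ^+ 2].
  move=> nb.
  have z01 : 0 <= (0 : R) <= s by rewrite lexx ltW.
  have s01 : 0 <= s <= s by rewrite lexx ltW.
  pose G q := F (q + s *: y) - F q.
  have dG u : 0 <= u <= s -> is_derive (p + u *: x) x G
      ('D_x F (p + u *: x + s *: y) - 'D_x F (p + u *: x)).
    move=> us; apply: is_deriveB; last first.
      apply: derivableP; apply: diff_derivable; apply: dF.
      by have [] := Pr _ (nb _ _ us z01); rewrite scale0r addr0.
    have dd : derivable F (p + u *: x + s *: y) x.
      by apply: diff_derivable; apply: dF; have [] := Pr _ (nb _ _ us s01).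
    have E : (fun h : R => h^-1 *:
        (((fun q => F (q + s *: y)) \o shift (p + u *: x)) (h *: x) -
           F (p + u *: x + s *: y))) = (fun h : R => h^-1 *:
        ((F \o shift (p + u *: x + s *: y)) (h *: x) - F (p + u *: x + s *: y))).
      by apply/funext => h /=; rewrite !addrA.
    by split; rewrite /derivable/derive E.
  have [|u us] := @mvt_line _ _ G p x s (ltW s0).
    by move=> u /dG [].
  have [_ ->] := dG u us => E.
  have [|v vs E2] := @mvt_line _ _ ('D_x F) (p + u *: x) y s (ltW s0).
    move=> v vs; apply: diff_derivable; have [dD _] := ddF x; apply: dD.
    by have [] := Pr _ (nb _ _ us vs).
  exists u, v; split => //; move: E; rewrite E2 /G => E.
  rewrite expr2 mulrA -E; ring.
have [u [v [us vs E1]]] := mixed a b near_p.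
have [u' [v' [us' vs' E2]]] := mixed b a
  (fun u v us vs => eq_ind _ _ (near_p v u vs us) _ (addrAC _ _ _)).
have [_ h1 _] := Pr _ (near_p _ _ us vs).
have near_p' : ball p r (p + u' *: b + v' *: a).
  by rewrite addrAC; exact: near_p.
have [_ _ h2] := Pr _ near_p'.
apply: (dist_le_limits _ E1 E2 _ h1 h2); first by rewrite expf_neq0// gt_eqF.
by rewrite (addrAC p (s *: b)); ring.
Qed.

Lemma hess_along_sym F (U : set V) p :
  cont_diff2_open U F -> open U -> U p -> (hess_along F p)^T = hess_along F p.
Proof.
move=> c2 oU Up; apply/matrixP => i j; rewrite mxE !hess_alongE.
exact: (schwarz (e j) (e i) c2 oU Up).
Qed.

End c2.

(** * First-order expansions of C^1 functions *)

Section c1.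
Context (R : realType) (d : nat) (w : set 'rV[R]_d).
Implicit Types (f : 'rV[R]_d -> R) (x y z : 'rV[R]_d).

Lemma lincomb_delta z : lincomb (fun i => delta_mx ord0 i) z = z.
Proof. by rewrite [RHS]row_sum_delta. Qed.

Lemma derive_grad f x z : differentiable f x -> 'D_z f x = dot (grad f x) z.
Proof.
move=> df; rewrite -[in LHS](lincomb_delta z) derive_lincomb//.
by apply: eq_bigr => i _; rewrite mxE mulrC.
Qed.

(** Every point of w is a limit of interior points, so that the limit defining
    gradc is unique. *)
Lemma interior_closure_point x : closure w° = w -> w x ->
  ProperFilter (within w° (nbhs x)).
Proof.
move=> cw wx; apply: within_nbhs_proper.
by rewrite cw.
Qed.

Lemma gradcE f (G : 'rV[R]_d -> 'rV[R]_d) x : closure w° = w ->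
  {within w, continuous G} -> (forall x, w° x -> G x = grad f x) -> w x ->
  gradc w f x = G x.
Proof.
move=> cw cG Gf wx; have PF := interior_closure_point cw wx.
apply: cvg_lim => //; apply/cvgrPdist_lt => e e0.
have /within_continuousP/(_ x wx e e0)[r r0 xr] := cG.
apply/nbhs_ballP; exists r => // y; rewrite -ball_normE /= => xy wy.
by rewrite -Gf//; apply: xr => //; exact: interior_subset.
Qed.

Lemma continuous_gradc f : closure w° = w -> C1 w f ->
  {within w, continuous (gradc w f)}.
Proof.
move=> cw [_ _ [G cG Gf]]; apply/within_continuousP => p wp e e0.
have /within_continuousP/(_ p wp e e0)[r r0 pr] := cG.
by exists r => // q wq pq; rewrite !(gradcE cw cG Gf)//; exact: pr.
Qed.

Lemma gradc_interior f x : closure w° = w -> C1 w f -> w° x ->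
  gradc w f x = grad f x.
Proof.
move=> cw [_ _ [G cG Gf]] wx; rewrite (gradcE cw cG Gf) ?Gf//.
exact: interior_subset.
Qed.

Lemma C1_lin (a : R) f g : C1 w f -> C1 w g -> C1 w (fun x => a * f x + g x).
Proof.
move=> [cf df [F cF Ff]] [cg dg [G cG Gg]].
have dag x : w° x -> differentiable (a *: f + g) x.
  by move=> wx; apply: differentiableD; [apply: differentiableZ; exact: df|exact: dg].
split => [|x wx|].
- apply: within_continuousD => //; apply: within_continuousM => //.
  exact: within_continuous_cst.
- exact: dag.
- exists (fun x => a *: F x + G x).
    apply: within_continuousD => //; apply: within_continuousZ => //.
    exact: within_continuous_cst.
  move=> x wx; rewrite Ff// Gg//; apply/rowP => i; rewrite !mxE.
  have := dag x wx; have := df _ wx; have := dg _ wx => dgx dfx dagx.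
  rewrite (_ : (fun _ => _) = a *: f + g)//.
  by rewrite deriveD ?deriveZ//; apply: diff_derivable => //; exact: differentiableZ.
Qed.

Lemma C1_cst (a : R) : C1 w (fun=> a).
Proof.
split => [|x _|]; first exact: within_continuous_cst.
  exact: differentiable_cst.
exists (fun=> 0); first exact: within_continuous_cst.
by move=> x _; apply/rowP => i; rewrite !mxE derive_cst.
Qed.

Lemma gradc_lin (a : R) f g x : closure w° = w -> C1 w f -> C1 w g -> w x ->
  gradc w (fun x => a * f x + g x) x = a *: gradc w f x + gradc w g x.
Proof.
move=> cw C1f C1g wx.
have [_ df [F cF Ff]] := C1f; have [_ dg [G cG Gg]] := C1g.
rewrite (gradcE cw cF Ff)// (gradcE cw cG Gg)//.
have cH : {within w, continuous (fun x => a *: F x + G x)}.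
  apply: within_continuousD => //; apply: within_continuousZ => //.
  exact: within_continuous_cst.
rewrite (gradcE cw cH)// => y wy; rewrite Ff// Gg//; apply/rowP => i.
rewrite !mxE (_ : (fun _ => _) = a *: f + g)//.
by rewrite deriveD ?deriveZ//; apply: diff_derivable => //;
  try apply: differentiableZ; [exact: df|exact: df|exact: dg].
Qed.

(** The mean value theorem on segments, along which the extended gradient
    oscillates little, uniformly near K. *)
Lemma taylor1_compact f (K : set 'rV[R]_d) eps : compact w -> C1 w f ->
  compact K -> K `<=` w° -> 0 < eps ->
  exists2 r, 0 < r & forall p z, K p -> `|z| < r ->
    `|f (p + z) - f p - dot (grad f p) z| <= eps * `|z|.
Proof.
move=> cw [_ df [G cG Gf]] cK Kw eps0.
have d0 : 0 < d%:R ^+ 2 + 1 :> R by rewrite ltr_wpDl// exprn_ge0.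
pose eta := eps / (d%:R ^+ 2 + 1).
have eta0 : 0 < eta by rewrite divr_gt0.
have [|r r0 Pr] := @compact_uniform _ _ K
    (fun p q => w° p -> w° q /\ `|G q - G p| <= eta) cK.
  move=> p Kp; have wp := interior_subset (Kw _ Kp).
  have /within_continuousP/(_ p wp (eta / 2)) := cG.
  rewrite divr_gt0// => /(_ isT)[r1 r10 pr1].
  have : \forall q \near p, w° q.
    by apply: open_nbhs_nbhs; split; [exact: open_interior|exact: Kw].
  move=> /nbhs_ballP[r2 /= r20 pr2].
  exists (Num.min r1 r2); first by rewrite lt_min r10.
  move=> p' q; rewrite !lt_min => /andP[p'1 p'2] /andP[q1 q2] wp'.
  have wq : w° q by apply: pr2; rewrite -ball_normE.
  split => //.
  have := pr1 p' (interior_subset wp') p'1.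
  have := pr1 q (interior_subset wq) q1.
  have := ler_distD (G p) (G q) (G p'); rewrite (distrC (G q) (G p)); lra.
exists r => // p z Kp zr.
have Pz s : 0 <= s <= 1 -> w° (p + s *: z) /\ `|G (p + s *: z) - G p| <= eta.
  move=> /andP[s0 s1]; apply: (Pr p) => //; last exact: Kw.
  rewrite opprD addrA subrr sub0r normrN normrZ ger0_norm//.
  by apply: le_lt_trans zr; rewrite ler_piMl.
have [|s s01] := @mvt_line _ _ f p z 1 ler01.
  by move=> s /Pz[ws _]; apply: diff_derivable; exact: df.
have [ws Gs] := Pz s s01.
rewrite scale1r mulr1 derive_grad; last exact: df.
move=> ->; rewrite -!Gf//; last exact: Kw.
rewrite -dotNl -dotDl; apply: (le_trans (cauchy_schwarz _ _)).
apply: (@le_trans _ _ ((d%:R * eta) * (d%:R * `|z|))).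
  rewrite ler_pM ?enorm_ge0//; last exact: enorm_le_norm.
  by apply: (le_trans (enorm_le_norm _)); rewrite ler_wpM2l.
rewrite mulrACA mulrA ler_wpM2r// /eta -expr2 mulrA ler_pdivrMr//.
by rewrite mulrC ler_pM2l// lerDl.
Qed.

End c1.

(** * Symmetric positive definite matrices *)

Section quadratic.
Context (R : realType) (d : nat).
Implicit Types (A B : 'M[R]_d) (p x y z : 'rV[R]_d).

Lemma dot_mulmx A x y : dot (x *m A) y = \sum_i \sum_j x ord0 j * A j i * y ord0 i.
Proof. by apply: eq_bigr => i _; rewrite mxE mulr_suml. Qed.

Lemma qform_dot A z : qform A z = dot (z *m A) z.
Proof.
rewrite dot_mulmx exchange_big; apply: eq_bigr => i _; apply: eq_bigr => j _.
by rewrite mulrAC.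
Qed.

Lemma dot_mulmxE A x y : dot (x *m A) y = (x *m A *m y^T) ord0 ord0.
Proof. by rewrite [RHS]mxE; apply: eq_bigr => i _; rewrite [y^T _ _]mxE. Qed.

Lemma dot_sym A x y : A^T = A -> dot (x *m A) y = dot (y *m A) x.
Proof.
move=> sA; have E : (x *m A *m y^T)^T = y *m A *m x^T.
  by rewrite trmx_mul trmxK trmx_mul sA mulmxA.
by rewrite !dot_mulmxE -E [RHS]mxE.
Qed.

Definition posdef (g : R) A := A^T = A /\ forall z, g * dot z z <= dot (z *m A) z.

Lemma dot_eq0 z : dot z z = 0 -> z = 0.
Proof.
rewrite -sqr_enorm => /eqP; rewrite expf_eq0 /= => /eqP z0.
by apply/eqP; rewrite -normr_le0 (le_trans (norm_le_enorm _)) ?z0.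
Qed.

Lemma posdef_unit (g : R) A : 0 < g -> posdef g A -> A \in unitmx.
Proof.
move=> g0 [_ pA]; rewrite -row_free_unit; apply/row_freeP.
have kA : kermx A = 0.
  apply/row_matrixP => i; rewrite row0.
  have : row i (kermx A) *m A = 0 by rewrite -row_mul mulmx_ker row0.
  set z := row i _ => zA; apply: dot_eq0; apply/eqP.
  rewrite eq_le dot_ge0 andbT -(ler_pM2l g0) mulr0.
  by apply: (le_trans (pA z)); rewrite zA -(scale0r 0) dotZl mul0r.
by apply/row_freeP; rewrite -kermx_eq0 kA.
Qed.

Section posdef.
Context (g : R) (A : 'M[R]_d) (g0 : 0 < g) (pA : posdef g A).

Let uA : A \in unitmx. Proof. exact: posdef_unit pA. Qed.

Lemma invmx_sym : (invmx A)^T = invmx A.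
Proof. by rewrite trmx_inv (proj1 pA). Qed.

Lemma posdef_ge0 z : 0 <= dot (z *m A) z.
Proof. by apply: le_trans (proj2 pA z); rewrite mulr_ge0 ?dot_ge0// ltW. Qed.

Lemma invmx_ge0 p : 0 <= dot (p *m invmx A) p.
Proof.
rewrite -{2}(mulmxKV uA p) dotC; exact: posdef_ge0.
Qed.

(** The form of A is nonnegative at v - p A^-1. *)
Lemma young_mx p v : dot p v <= dot (v *m A) v / 2 + dot (p *m invmx A) p / 2.
Proof.
have := posdef_ge0 (v - p *m invmx A).
rewrite mulmxBl mulmxKV// !(dotDl,dotDr,dotNl,dotNr).
rewrite (dot_sym v (p *m invmx A) (proj1 pA)) mulmxKV// (dotC p (p *m _)); lra.
Qed.

Lemma enorm_invmx p : enorm (p *m invmx A) <= enorm p / g.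
Proof.
rewrite ler_pdivlMr//.
have := proj2 pA (p *m invmx A); rewrite mulmxKV// -sqr_enorm => h.
have := le_trans h (le_trans (ler_norm _) (cauchy_schwarz _ _)).
have [/eqP -> _|n0] := boolP (enorm (p *m invmx A) == 0).
  by rewrite mul0r enorm_ge0.
by rewrite expr2 mulrA ler_pM2r ?lt0r ?n0 ?enorm_ge0// mulrC.
Qed.

(** For q = p A^-1 the left-hand side is at most g |q|^2, as |p| <= C |q|, and the
    right-hand side is the form of A at q. *)
Lemma dot_invmx_ge p (C : R) : 0 < C -> (forall z, enorm (z *m A) <= C * enorm z) ->
  g / C ^+ 2 * dot p p <= dot (p *m invmx A) p.
Proof.
move=> C0 bA; have := proj2 pA (p *m invmx A); rewrite mulmxKV// (dotC p).
apply: le_trans; rewrite -mulrA ler_pM2l// ler_pdivrMl ?exprn_gt0//.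
rewrite -!sqr_enorm -exprMn ler_sqr ?nnegrE ?mulr_ge0 ?enorm_ge0 ?(ltW C0)//.
by have := bA (p *m invmx A); rewrite mulmxKV.
Qed.

End posdef.

Lemma enorm_mulmx A z (M : R) : (forall i j, `|A i j| <= M) ->
  enorm (z *m A) <= d%:R ^+ 2 * M * enorm z.
Proof.
move=> bA; apply: (le_trans (enorm_le_norm _)).
have [i0|dn0] := pselect (inhabited 'I_d); last first.
  have -> : z *m A = 0 by apply/rowP => i; case: dn0.
  rewrite normr0 mulr0; have -> : d%:R = 0 :> R.
    by case: d dn0 => // n []; split; exact: ord0.
  by rewrite expr0n/= !mul0r.
have M0 : 0 <= M by case: i0 => i; exact: le_trans (bA i i).
rewrite expr2 -!mulrA ler_wpM2l//; apply: norm_le_coord.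
  by rewrite !mulr_ge0 ?enorm_ge0.
move=> i; rewrite mxE; apply: (le_trans (ler_norm_sum _ _ _)).
apply: (@le_trans _ _ (\sum_(j < d) M * enorm z)).
  apply: ler_sum => j _; rewrite normrM mulrC ler_pM//.
  by rewrite (le_trans (coord_le_norm _ _))// norm_le_enorm.
by rewrite sumr_const card_ord -[X in X <= _]mulr_natl.
Qed.

Lemma qform_le A z (M : R) : (forall i j, `|A i j| <= M) ->
  `|dot (z *m A) z| <= d%:R ^+ 2 * M * enorm z ^+ 2.
Proof.
move=> bA; apply: (le_trans (cauchy_schwarz _ _)).
by rewrite [enorm z ^+ 2]expr2 mulrA ler_wpM2r ?enorm_ge0// enorm_mulmx.
Qed.

End quadratic.

(** Determinants and cofactors are polynomials in the entries; hence they stay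
    within every class of functions that is closed under sums and products. *)
Section entrywise.
Context (R : realType) (T : Type) (P : (T -> R) -> Prop).
Context (P_cst : forall a, P (fun=> a))
  (PD : forall f g, P f -> P g -> P (fun x => f x + g x))
  (PM : forall f g, P f -> P g -> P (fun x => f x * g x)).

Let P_sum (I : Type) (s : seq I) (F : I -> T -> R) : (forall i, P (F i)) ->
  P (fun x => \sum_(i <- s) F i x).
Proof.
move=> PF; elim: s => [|i s ih].
  by rewrite (_ : (fun _ => _) = fun=> 0)//; apply/funext => x; rewrite big_nil.
rewrite (_ : (fun _ => _) = fun x => F i x + \sum_(i <- s) F i x); first exact: PD.
by apply/funext => x; rewrite big_cons.
Qed.

Let P_prod (I : Type) (s : seq I) (F : I -> T -> R) : (forall i, P (F i)) ->
  P (fun x => \prod_(i <- s) F i x).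
Proof.
move=> PF; elim: s => [|i s ih].
  by rewrite (_ : (fun _ => _) = fun=> 1)//; apply/funext => x; rewrite big_nil.
rewrite (_ : (fun _ => _) = fun x => F i x * \prod_(i <- s) F i x); first exact: PM.
by apply/funext => x; rewrite big_cons.
Qed.

Lemma entrywise_det n (A : T -> 'M[R]_n) : (forall i j, P (fun x => A x i j)) ->
  P (fun x => \det (A x)).
Proof.
move=> PA; rewrite /determinant; apply: P_sum => s; apply: PM => //.
exact: P_prod.
Qed.

Lemma entrywise_adj n (A : T -> 'M[R]_n) i j : (forall i j, P (fun x => A x i j)) ->
  P (fun x => (\adj (A x)) i j).
Proof.
move=> PA.
rewrite (_ : (fun _ => _) =
    fun x => (-1) ^+ (j + i) * \det (row' j (col' i (A x)))).
  apply: PM => //; apply: entrywise_det => k l.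
  rewrite (_ : (fun _ => _) = fun x => A x (lift j k) (lift i l))//.
  by apply/funext => x; rewrite !mxE.
by apply/funext => x; rewrite mxE.
Qed.

End entrywise.

Lemma invmxE (R : realType) n (A : 'M[R]_n) i j : A \in unitmx ->
  invmx A i j = (\det A)^-1 * (\adj A) i j.
Proof. by move=> uA; rewrite /invmx uA mxE. Qed.

Lemma within_continuous_invmx (R : realType) (V : normedModType R) (K : set V)
    n (A : V -> 'M[R]_n) i j : (forall x, K x -> A x \in unitmx) ->
  (forall i j, {within K, continuous (fun x => A x i j)}) ->
  {within K, continuous (fun x => invmx (A x) i j)}.
Proof.
move=> uA cA.
have cdet : {within K, continuous (fun x => \det (A x))}.
  by apply: (@entrywise_det _ _ (fun f : V -> R => {within K, continuous f})) => //; [exact: within_continuous_cst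
    |exact: within_continuousD|exact: within_continuousM].
have cadj : {within K, continuous (fun x => (\adj (A x)) i j)}.
  by apply: (@entrywise_adj _ _ (fun f : V -> R => {within K, continuous f})) => //; [exact: within_continuous_cst
    |exact: within_continuousD|exact: within_continuousM].
apply: (@eq_within_continuous _ _ _ K
  (fun x => (\det (A x))^-1 * (\adj (A x)) i j)).
  by move=> x Kx; rewrite invmxE//; exact: uA.
apply/subspace_continuousP => x Kx.
move/subspace_continuousP : cdet => /(_ x Kx) cd.
move/subspace_continuousP : cadj => /(_ x Kx) ca.
apply: cvgM => //; apply: cvgV => //.
by have := uA x Kx; rewrite unitmxE unitfE.
Qed.

Lemma measurable_fun_inv d (T : measurableType d) (R : realType) (D : set T)
    (f : T -> R) : measurable_fun D f -> measurable_fun D (fun x => (f x)^-1).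
Proof.
move=> mf; apply: (measurableT_comp _ mf).
have -> : @GRing.inv R = (fun x : R => if x == 0 then 0 else x^-1).
  by apply/funext => x; case: eqP => // ->; rewrite invr0.
have mS : measurable_fun setT (fun x : R => x == 0).
  by apply: measurable_fun_eqr => //; exact: measurable_cst.
apply: measurable_fun_if => //.
rewrite setTI; have -> : (fun x : R => x == 0) @^-1` [set false] = ~` [set 0].
  by apply/seteqP; split => x /=; [move=> + x0; rewrite x0 eqxx|move/eqP/negbTE].
apply: open_continuous_measurable_fun.
  by apply: closed_openC; apply: accessible_closed_set1; exact: hausdorff_accessible.
by move=> x; rewrite inE /= => /eqP x0; exact: inv_continuous.
Qed.

(** On singular matrices invmx is the identity; on the others it is the adjugate
    divided by the determinant. *)
Lemma measurable_fun_invmx d (T : measurableType d) (R : realType) (D : set T)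
    n (A : T -> 'M[R]_n) i j :
  (forall i j, measurable_fun D (fun x => A x i j)) ->
  measurable_fun D (fun x => invmx (A x) i j).
Proof.
move=> mA.
have mdet : measurable_fun D (fun x => \det (A x)).
  by apply: (@entrywise_det _ _ (fun f : T -> R => measurable_fun D f)) => //; [exact: measurable_funD|exact: measurable_funM].
have madj : measurable_fun D (fun x => (\adj (A x)) i j).
  by apply: (@entrywise_adj _ _ (fun f : T -> R => measurable_fun D f)) => //; [exact: measurable_funD|exact: measurable_funM].
rewrite (_ : (fun _ => _) = fun x => if \det (A x) == 0 then A x i j else
    (\det (A x))^-1 * (\adj (A x)) i j); last first.
  apply/funext => x; rewrite /invmx unitmxE unitfE.
  by case: eqP => //= _; rewrite mxE.
have [mD|nmD] := pselect (measurable D); last by move=> /nmD.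
apply: measurable_fun_if => //.
- by apply: measurable_fun_eqr => //; exact: measurable_cst.
- by apply: measurable_funS (mA i j).
- apply: (@measurable_funS _ _ _ _ D) => //; apply: measurable_funM => //.
  exact: measurable_fun_inv.
Qed.

(** * Optimal plans and the optimal map *)

Record regular_transport (R : realType) (d : nat) (w0 w1 : set 'rV[R]_d)
  (c : 'rV[R]_d -> 'rV[R]_d -> R)
  (u0 ub : {finite_measure set (borel R d) -> \bar R})
  (phib : 'rV[R]_d -> R) (Tb : 'rV[R]_d -> 'rV[R]_d) (eps gamma : R) : Prop := {
  rt_w0 : compact w0;
  rt_w1 : compact w1;
  rt_cl : closure w1° = w1;
  rt_cont : {within w0 `*` w1, continuous (fun z => c z.1 z.2)};
  rt_u0 : carried_by w0 u0;
  rt_supp0 : msupp u0 = w0;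
  rt_ub : carried_by w1 ub;
  rt_c2 : cont_diff2_on (w0 `*` w1) (fun z => c z.1 z.2);
  rt_suppb : msupp ub `<=` w1°;
  rt_phib : C1 w1 phib;
  rt_kant : kantorovich_potential w0 w1 c u0 ub phib;
  rt_eps : 0 < eps;
  rt_nbhd : set_add (msupp ub) (closed_eball 0 eps) `<=` w1°;
  rt_phib2 : cont_diff2_on (set_add (msupp ub) (closed_eball 0 eps)) phib;
  rt_Tb : forall x, w0 x -> w1 (Tb x);
  rt_gamma : 0 < gamma;
  rt_growth : forall x y, w0 x -> w1 y ->
     c x (Tb x) - phib (Tb x) + gamma / 2 * enorm (y - Tb x) ^+ 2 <=
     c x y - phib y }.

Lemma prod_norm_diagl (R : realType) (V W : normedModType R) (x y : V) (z : W) :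
  `|(x, z) - (y, z)| = `|x - y|.
Proof. by rewrite prod_normE/= subrr normr0; apply/max_l. Qed.

Lemma measure_carrier d (T : measurableType d) (R : realType)
    (mu : {measure set T -> \bar R}) (D : set T) :
  measurable D -> mu (~` D) = 0%E -> mu setT = mu D.
Proof.
move=> mD muD; have mC : measurable (~` D) by exact: measurableC.
rewrite -(setvU D) measureU ?setICl//.
by rewrite [X in (X + _)%E](_ : _ = 0%E) ?add0e.
Qed.

(** As f is measurable on E only, the change of variables is applied to its
    extension by zero. *)
Lemma Rint_marginal d1 d2 (T1 : measurableType d1) (T2 : measurableType d2)
    (R : realType) (p : {measure set T1 -> \bar R}) (m : {measure set T2 -> \bar R})
    (phi : T1 -> T2) (W : set T1) (E : set T2) (f : T2 -> R) :
  measurable_fun setT phi -> measurable W -> measurable E ->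
  (forall A, measurable A -> pushforward p phi A = m A) -> p (~` W) = 0%E ->
  (forall z, W z -> E (phi z)) -> (m E < +oo)%E -> bounded_mfun E f ->
  bounded_mfun W (f \o phi) /\
  \int[p]_(z in W) f (phi z) = \int[m]_(y in E) f y.
Proof.
move=> mphi mW mE pm pW WE mE_fin bf.
have mE' : measurable (phi @^-1` E) by rewrite -[X in measurable X]setTI; exact: mphi.
have mfE : measurable_fun setT (f \_ E).
  by apply/(measurable_restrictT f mE); case: bf.
have bfT : bounded_mfun setT (f \_ E).
  split => //; have [_ [M fM]] := bf; exists `|M| => y _; rewrite /patch.
  by case: ifP => [/set_mem /fM|]; rewrite ?normr0// => /le_trans; apply; exact: ler_norm.
have b1 : bounded_mfun (phi @^-1` E) ((f \_ E) \o phi).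
  have [mf [M fM]] := bfT; split.
    by apply: (measurable_funS _ (@subsetT _ _)) => //; exact: measurableT_comp.
  by exists M => z _; exact: fM.
have fin1 : (p (phi @^-1` E) < +oo)%E by rewrite -[p _]/(pushforward p phi E) pm.
have bW : bounded_mfun W (f \o phi).
  apply: (@eq_bmf _ _ _ _ ((f \_ E) \o phi)).
    by move=> z /set_mem Wz /=; rewrite patchE mem_set//; exact: WE.
  have [mf [M fM]] := b1; split; last by exists M => z Wz; apply/fM/WE.
  by apply: (measurable_funS mE' _ mf) => z Wz; exact: WE.
split => //.
transitivity (\int[p]_(z in W) ((f \_ E) (phi z))).
  apply: eq_Rintegral => z /set_mem Wz; rewrite patchE mem_set//; exact: WE.
rewrite /Rintegral.
transitivity (fine (\int[pushforward p phi]_(y in E) ((f \_ E) y)%:E)).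
  rewrite integral_pushforward//; last first.
  - exact: bmf_integrable b1.
  - exact/measurable_EFinP.
  congr fine; rewrite (@negligible_integral _ _ _ p (phi @^-1` E)
    (phi @^-1` E `\` W))//; last 3 first.
  - exact: measurableD.
  - exact: bmf_integrable b1.
  - apply/eqP; rewrite eq_le measure_ge0 andbT -pW; apply: le_measure;
    rewrite ?inE; [exact: measurableD|exact: measurableC|exact: subDsetr].
  by congr (integral _ _ _); rewrite setDD; apply/seteqP; split => [z Wz|z []//];
    split => //; exact: WE.
congr fine; transitivity (\int[m]_(y in E) ((f \_ E) y)%:E)%E.
  by apply: eq_measure_integral => A mA _; exact: pm.
by apply: eq_integral => y Ey; rewrite patchE Ey.
Qed.

Section setting.
Context (R : realType) (d : nat) (w0 w1 : set 'rV[R]_d)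
  (c : 'rV[R]_d -> 'rV[R]_d -> R)
  (u0 ub : {finite_measure set (borel R d) -> \bar R})
  (phib : 'rV[R]_d -> R) (Tb : 'rV[R]_d -> 'rV[R]_d) (eps gamma : R).
Context (S : regular_transport w0 w1 c u0 ub phib Tb eps gamma).

Lemma mw0 : measurable (w0 : set (borel R d)).
Proof. exact: (compact_borel (rt_w0 S)). Qed.

Lemma mw1 : measurable (w1 : set (borel R d)).
Proof. exact: (compact_borel (rt_w1 S)). Qed.

Lemma compact_w01 : compact (w0 `*` w1).
Proof. exact: compact_setX (rt_w0 S) (rt_w1 S). Qed.

Lemma mw01 : measurable (w0 `*` w1 : set (borel R d * borel R d)).
Proof. by apply: measurableX; [exact: mw0|exact: mw1]. Qed.

Lemma fin_u0 : (u0 w0 < +oo)%E.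
Proof. by rewrite -ge0_fin_numE// fin_num_measure//; exact: mw0. Qed.

Lemma fin_ub : (ub w1 < +oo)%E.
Proof. by rewrite -ge0_fin_numE// fin_num_measure//; exact: mw1. Qed.

Lemma bmf_w0 (f : 'rV[R]_d -> R) : {within w0, continuous f} ->
  bounded_mfun (w0 : set (borel R d)) f.
Proof.
move=> cf; split; first exact: continuous_borel mw0 cf.
exact: within_continuous_bounded (rt_w0 S) cf.
Qed.

Lemma bmf_w1 (f : 'rV[R]_d -> R) : {within w1, continuous f} ->
  bounded_mfun (w1 : set (borel R d)) f.
Proof.
move=> cf; split; first exact: continuous_borel mw1 cf.
exact: within_continuous_bounded (rt_w1 S) cf.
Qed.

Lemma bmf_w01 (f : 'rV[R]_d * 'rV[R]_d -> R) : {within w0 `*` w1, continuous f} ->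
  bounded_mfun (w0 `*` w1 : set (borel R d * borel R d)) f.
Proof.
move=> cf; split; first exact: continuous_borel2 mw01 cf.
exact: within_continuous_bounded compact_w01 cf.
Qed.

(** Exchanging the targets of two nearby points x and x' costs at most twice
    the oscillation of c, while by the growth condition it costs at least
    gamma |T x - T x'|^2. *)
Lemma continuous_Tb : {within w0, continuous Tb}.
Proof.
apply/within_continuousP => x w0x e e0.
have e1 : 0 < gamma * e ^+ 2 / 4.
  by rewrite divr_gt0// mulr_gt0 ?exprn_gt0// (rt_gamma S).
have [r r0 unif] := within_uniformly_continuous compact_w01 (rt_cont S) e1.
exists r => // x' w0x' xx'; apply: (le_lt_trans (norm_le_enorm _)).
rewrite -ltr_sqr ?nnegrE ?enorm_ge0 ?(ltW e0)//.
have w1x := rt_Tb S w0x; have w1x' := rt_Tb S w0x'.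
have h1 := rt_growth S w0x w1x'; have h2 := rt_growth S w0x' w1x.
have h3 : `|c x (Tb x) - c x' (Tb x)| < gamma * e ^+ 2 / 4.
  by apply: (unif (x, Tb x) (x', Tb x)) => //; rewrite prod_norm_diagl.
have h4 : `|c x (Tb x') - c x' (Tb x')| < gamma * e ^+ 2 / 4.
  by apply: (unif (x, Tb x') (x', Tb x')) => //; rewrite prod_norm_diagl.
rewrite -(ltr_pM2l (rt_gamma S)).
move: h1; rewrite -(opprB (Tb x)) enormN => h1.
move: h3 h4; rewrite !ltr_norml => /andP[h3 h3'] /andP[h4 h4'].
have : 0 < gamma * e ^+ 2 by rewrite mulr_gt0 ?exprn_gt0// (rt_gamma S).
lra.
Qed.

(** The c-transform of phib on w0, see c_transformE. *)
Definition phic (x : 'rV[R]_d) : R := c x (Tb x) - phib (Tb x).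

(** The slack of the dual constraint phib y + phic x <= c x y. *)
Definition gap (x y : 'rV[R]_d) : R := c x y - phib y - phic x.

Lemma gap_ge x y : w0 x -> w1 y -> gamma / 2 * enorm (y - Tb x) ^+ 2 <= gap x y.
Proof. by move=> /(rt_growth S) /[apply]; rewrite /gap /phic; lra. Qed.

Lemma c_transformE x : w0 x -> c_transform w1 c phib x = phic x.
Proof.
move=> w0x; rewrite /c_transform /phic; apply/eqP; rewrite eq_le; apply/andP; split.
  apply: ge_inf; last by exists (Tb x) => //; exact: rt_Tb S _ w0x.
  exists (phic x) => _ [y w1y <-]; have := gap_ge w0x w1y; rewrite /gap.
  have : 0 <= gamma / 2 * enorm (y - Tb x) ^+ 2.
    by rewrite mulr_ge0 ?exprn_ge0 ?enorm_ge0// divr_ge0// ltW// (rt_gamma S).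
  by lra.
apply: lb_le_inf; first by eexists; exists (Tb x) => //; exact: rt_Tb S _ w0x.
move=> _ [y w1y <-]; have := gap_ge w0x w1y; rewrite /gap /phic.
have : 0 <= gamma / 2 * enorm (y - Tb x) ^+ 2.
  by rewrite mulr_ge0 ?exprn_ge0 ?enorm_ge0// divr_ge0// ltW// (rt_gamma S).
by lra.
Qed.

Lemma continuous_pair_Tb : {within w0, continuous (fun x => (x, Tb x))}.
Proof.
apply/within_continuousP => x w0x e e0.
have /within_continuousP/(_ x w0x e e0)[r r0 xr] := continuous_Tb.
exists (Num.min r e); first by rewrite lt_min r0.
move=> y w0y; rewrite lt_min => /andP[xy1 xy2].
by rewrite prod_normE/= gt_max xy2 xr.
Qed.

Lemma continuous_comp_Tb (W : normedModType R) (g : 'rV[R]_d -> W) :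
  {within w1, continuous g} -> {within w0, continuous (g \o Tb)}.
Proof.
move=> cg; apply: (within_continuous_compose continuous_Tb cg); exact: rt_Tb S.
Qed.

Lemma continuous_phic : {within w0, continuous phic}.
Proof.
apply: within_continuousD.
  apply: (within_continuous_compose continuous_pair_Tb (rt_cont S)) => x w0x.
  by split => //=; exact: rt_Tb S _ w0x.
by apply: within_continuousN; apply: continuous_comp_Tb; case: (rt_phib S).
Qed.

Lemma within_fst : {within w0 `*` w1, continuous (@fst 'rV[R]_d 'rV[R]_d)}.
Proof. by apply: continuous_subspaceT => z; exact: cvg_fst. Qed.

Lemma within_snd : {within w0 `*` w1, continuous (@snd 'rV[R]_d 'rV[R]_d)}.
Proof. by apply: continuous_subspaceT => z; exact: cvg_snd. Qed.

Lemma continuous_fst_w0 (W : normedModType R) (f : 'rV[R]_d -> W) :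
  {within w0, continuous f} -> {within w0 `*` w1, continuous (fun z => f z.1)}.
Proof. by move=> cf; apply: (within_continuous_compose within_fst cf) => z []. Qed.

Lemma continuous_snd_w1 (W : normedModType R) (f : 'rV[R]_d -> W) :
  {within w1, continuous f} -> {within w0 `*` w1, continuous (fun z => f z.2)}.
Proof. by move=> cf; apply: (within_continuous_compose within_snd cf) => z []. Qed.

Lemma continuous_gap : {within w0 `*` w1, continuous (fun z => gap z.1 z.2)}.
Proof.
apply: within_continuousD.
  apply: within_continuousD; first exact: rt_cont S.
  apply: within_continuousN; apply: continuous_snd_w1; by case: (rt_phib S).
by apply: within_continuousN; apply: continuous_fst_w0; exact: continuous_phic.
Qed.

Lemma continuous_sqr_dist :
  {within w0 `*` w1, continuous (fun z => enorm (z.2 - Tb z.1) ^+ 2)}.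
Proof.
have cz : {within w0 `*` w1, continuous (fun z => z.2 - Tb z.1)}.
  apply: within_continuousD; first exact: within_snd.
  by apply: within_continuousN; apply: continuous_fst_w0; exact: continuous_Tb.
apply: (@eq_within_continuous _ _ _ _ (fun z =>
    \sum_i (z.2 - Tb z.1) ord0 i * (z.2 - Tb z.1) ord0 i)).
  by move=> z _; rewrite sqr_enorm.
by apply: within_continuous_sum => i; apply: within_continuousM;
  exact: (within_continuous_coord cz).
Qed.

Section plan.
Context (m : set (borel R d) -> \bar R)
  (p : {measure set (borel R d * borel R d) -> \bar R})
  (pc : coupling w0 w1 u0 m p).

Lemma plan_mass : p (w0 `*` w1) = u0 w0.
Proof.
have [pW p1 _] := pc.
have pT : p setT = u0 setT by rewrite -p1.
rewrite -(measure_carrier mw01 pW) pT; apply: measure_carrier; first exact: mw0.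
by apply: (rt_u0 S) => //; apply: measurableC; exact: mw0.
Qed.

Lemma plan_fin : (p (w0 `*` w1) < +oo)%E.
Proof. by rewrite plan_mass; exact: fin_u0. Qed.

Lemma plan_fst f : bounded_mfun (w0 : set (borel R d)) f ->
  bounded_mfun (w0 `*` w1 : set (borel R d * borel R d)) (fun z => f z.1) /\
  \int[p]_(z in w0 `*` w1) f z.1 = \int[u0]_(x in w0) f x.
Proof.
move=> bf; have [pW p1 _] := pc.
apply: (@Rint_marginal _ _ (borel R d * borel R d)%type (borel R d) R p u0 fst
  (w0 `*` w1) w0 f) => //.
- exact: mw01.
- exact: mw0.
- by move=> z [].
- exact: fin_u0.
Qed.

End plan.

Lemma plan_snd (m : {measure set (borel R d) -> \bar R})
    (p : {measure set (borel R d * borel R d) -> \bar R}) f :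
  coupling w0 w1 u0 m p -> bounded_mfun (w1 : set (borel R d)) f ->
  bounded_mfun (w0 `*` w1 : set (borel R d * borel R d)) (fun z => f z.2) /\
  \int[p]_(z in w0 `*` w1) f z.2 = \int[m]_(y in w1) f y.
Proof.
move=> pc bf; have [pW p1 p2] := pc.
apply: (@Rint_marginal _ _ (borel R d * borel R d)%type (borel R d) R p m snd
  (w0 `*` w1) w1 f) => //.
- exact: mw01.
- exact: mw1.
- by move=> z [].
- rewrite -p2; last exact: mw1.
  apply: le_lt_trans (plan_fin pc); rewrite -(measure_carrier mw01 pW).
  rewrite /pushforward; apply: le_measure; rewrite ?inE//.
  by rewrite -[X in measurable X]setTI; apply: measurable_snd => //; exact: mw1.
Qed.

End setting.

Section optimal_map.
Context (R : realType) (d : nat) (w0 w1 : set 'rV[R]_d)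
  (c : 'rV[R]_d -> 'rV[R]_d -> R)
  (u0 ub : {finite_measure set (borel R d) -> \bar R})
  (phib : 'rV[R]_d -> R) (Tb : 'rV[R]_d -> 'rV[R]_d) (eps gamma : R).
Context (S : regular_transport w0 w1 c u0 ub phib Tb eps gamma).
Local Notation gap := (gap c phib Tb).
Local Notation phic := (phic c phib Tb).
Local Notation W := (w0 `*` w1 : set (borel R d * borel R d)).

Definition mass : R := fine (u0 w0).

Lemma mass_ge0 : 0 <= mass.
Proof. exact: fine_ge0. Qed.

Lemma bmf_gap : bounded_mfun W (fun z => gap z.1 z.2).
Proof. exact: (bmf_w01 S (continuous_gap S)). Qed.

Lemma bmf_cost : bounded_mfun W (fun z => c z.1 z.2).
Proof. exact: (bmf_w01 S (rt_cont S)). Qed.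

Lemma bmf_sqr_dist : bounded_mfun W (fun z => enorm (z.2 - Tb z.1) ^+ 2).
Proof. exact: (bmf_w01 S (continuous_sqr_dist S)). Qed.

Lemma continuous_phib : {within w1, continuous phib}.
Proof. by case: (rt_phib S). Qed.

(** The marginals determine the integrals of phib and phic, so that the plans
    compete through the integral of the gap only. *)
Lemma plan_cost (m p : {measure set _ -> \bar R}) : coupling w0 w1 u0 m p ->
  (\int[p]_(z in W) (c z.1 z.2)%:E)%E =
  (\int[p]_(z in W) gap z.1 z.2 + (\int[m]_(y in w1) phib y +
     \int[u0]_(x in w0) phic x))%:E.
Proof.
move=> pc; have fp := plan_fin S pc; have mW := mw01 S.
have [bf <-] := plan_snd S pc (bmf_w1 S continuous_phib).
have [bg <-] := plan_fst S pc (bmf_w0 S (continuous_phic S)).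
rewrite -RintD// -RintD//; first 1 last.
- exact: bmf_gap.
- exact: bmfD.
rewrite Rint_fin//; last exact: bmf_cost.
by congr EFin; apply: eq_Rintegral => z _; rewrite /gap; ring.
Qed.

Lemma plan_sqr_dist (m p : {measure set _ -> \bar R}) : coupling w0 w1 u0 m p ->
  gamma / 2 * \int[p]_(z in W) (enorm (z.2 - Tb z.1) ^+ 2) <=
  \int[p]_(z in W) gap z.1 z.2.
Proof.
move=> pc; have fp := plan_fin S pc; have mW := mw01 S.
rewrite -RintZ//; last exact: bmf_sqr_dist.
apply: le_Rint => //; first exact/bmfZ/bmf_sqr_dist.
  exact: bmf_gap.
by move=> z [? ?]; exact: (gap_ge S).
Qed.

Lemma transport_cost_ub : transport_cost w0 w1 c u0 ub =
  (\int[ub]_(y in w1) phib y + \int[u0]_(x in w0) phic x)%:E.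
Proof.
have [_ <-] := rt_kant S; congr (_ + _)%:E.
by apply: eq_Rintegral => x /set_mem; exact: (c_transformE S).
Qed.

(** Since phib attains the dual optimum, the gap has integrals close to zero. *)
Lemma near_optimal_plan (e : R) : 0 < e ->
  exists2 p, coupling w0 w1 u0 ub p & \int[p]_(z in W) gap z.1 z.2 < e.
Proof.
move=> e0; have := transport_cost_ub; rewrite /transport_cost => E.
have fE : ereal_inf [set (\int[p]_(z in w0 `*` w1) (c z.1 z.2)%:E)%E
    | p in coupling w0 w1 u0 ub] \is a fin_num by rewrite E.
have [_ [p pc <-]] := lb_ereal_inf_adherent e0 fE.
by rewrite E (plan_cost pc) -EFinD lte_fin addrC ltrD2l => ?; exists p.
Qed.

(** Uniform continuity for close points; for the others the quadratic term
    exceeds twice the bound of f. *)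
Lemma dist_bound (f : 'rV[R]_d -> R) (e : R) : {within w1, continuous f} -> 0 < e ->
  exists2 C, 0 <= C &
    forall y z, w1 y -> w1 z -> `|f y - f z| <= e + C * enorm (y - z) ^+ 2.
Proof.
move=> cf e0.
have [r r0 unif] := within_uniformly_continuous (rt_w1 S) cf e0.
have [M fM] := within_continuous_bounded (rt_w1 S) cf.
have C0 : 0 <= 2 * `|M| / r ^+ 2 by rewrite divr_ge0 ?sqr_ge0// mulr_ge0.
exists (2 * `|M| / r ^+ 2) => // y z w1y w1z.
have [yz|yz] := ltP `|y - z| r.
  by rewrite (le_trans (ltW (unif _ _ w1y w1z yz)))// lerDl mulr_ge0// sqr_ge0.
rewrite (@le_trans _ _ (2 * `|M|))//.
  rewrite (le_trans (ler_normB _ _))// mulr_natl mulr2n lerD//.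
    by rewrite (le_trans (fM _ w1y))// ler_norm.
  by rewrite (le_trans (fM _ w1z))// ler_norm.
apply: (@le_trans _ _ (2 * `|M| / r ^+ 2 * enorm (y - z) ^+ 2)); last first.
  by rewrite lerDr ltW.
rewrite -mulrA ler_peMr ?mulr_ge0// mulrC ler_pdivlMr ?exprn_gt0// mul1r.
by rewrite ler_sqr ?nnegrE ?enorm_ge0 ?(ltW r0)// (le_trans yz)// norm_le_enorm.
Qed.

(** Nearly optimal plans concentrate on the graph of T, so that T pushes u0
    forward to ub. *)
Lemma image_integral (f : 'rV[R]_d -> R) : {within w1, continuous f} ->
  \int[ub]_(y in w1) f y = \int[u0]_(x in w0) f (Tb x).
Proof.
move=> cf; apply/eqP; rewrite -subr_eq0 -normr_le0; apply/ler_addgt0Pl => e e0.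
rewrite addr0.
have m0 := mass_ge0.
have e1 : 0 < e / 2 / (mass + 1).
  by rewrite !divr_gt0// ltr_wpDl.
have [C C0 fC] := dist_bound cf e1.
have g0 := rt_gamma S.
have e2 : 0 < e / 2 * (gamma / 2) / (C + 1).
  by rewrite divr_gt0 ?ltr_wpDl// mulr_gt0// divr_gt0.
have [p pc gp] := near_optimal_plan e2.
have fp := plan_fin S pc; have mW := mw01 S.
have [b1 <-] := plan_snd S pc (bmf_w1 S cf).
have [b2 <-] := plan_fst S pc (bmf_w0 S (continuous_comp_Tb S cf)).
rewrite -RintB// (le_trans (le_normr_Rintegral _ _))//.
  by apply: bmf_integrable => //; exact: bmfB.
have bn : bounded_mfun W (fun z => `|f z.2 - f (Tb z.1)|).
  have [mf [M fM]] := bmfB b1 b2; split; first exact: measurableT_comp.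
  by exists M => z Wz; rewrite normr_id; exact: fM.
have bq := bmf_sqr_dist.
apply: (@le_trans _ _ (\int[p]_(z in W)
    (e / 2 / (mass + 1) + C * enorm (z.2 - Tb z.1) ^+ 2))).
  apply: le_Rint => //; first by apply: bmfD; [exact: bmf_cst|exact: bmfZ].
  by move=> [x y] [w0x w1y]; apply: fC => //; exact: rt_Tb S _ w0x.
rewrite RintD//; [|exact: bmf_cst|exact: bmfZ].
rewrite Rint_cst// RintZ// (plan_mass S pc) -/mass.
have h := plan_sqr_dist pc.
set I := Rintegral _ _ _ in h *; set G := Rintegral _ _ _ in h gp.
have h2 : C * I <= e / 2.
  have : gamma / 2 * I * (C + 1) <= e / 2 * (gamma / 2).
    rewrite -ler_pdivlMr ?ltr_wpDl//; exact: le_trans h (ltW gp).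
  have I0 : 0 <= I by apply: Rintegral_ge0 => z _; rewrite exprn_ge0// enorm_ge0.
  have -> : gamma / 2 * I * (C + 1) = (C * I + I) * (gamma / 2) by ring.
  by rewrite ler_pM2r ?divr_gt0//; apply: le_trans; rewrite lerDl.
have h1 : e / 2 / (mass + 1) * mass <= e / 2.
  rewrite -mulrA ler_piMr ?divr_ge0 ?(ltW e0)// mulrC ler_pdivrMr ?ltr_wpDl//.
  by rewrite mul1r lerDl.
by rewrite (le_trans (lerD h1 h2))// -splitr.
Qed.

(** A bump function at T x has a positive integral with respect to the image of
    u0 under T, because x is in the support of u0. *)
Lemma Tb_supp x : w0 x -> msupp ub (Tb x).
Proof.
move=> w0x U oU UTx.
have /nbhs_ballP[r /= r0 rU] : nbhs (Tb x) U by exact: open_nbhs_nbhs.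
pose t (y : 'rV[R]_d) := 1 - `|y - Tb x| / r.
pose f y := (t y + `|t y|) / 2.
have cf : {within w1, continuous f}.
  have ct : {within w1, continuous t}.
    apply: within_continuousD; first exact: within_continuous_cst.
    apply: within_continuousN; apply: within_continuousM.
      apply: within_continuous_norm; apply: within_continuousD.
        exact: within_continuous_id.
      exact: within_continuous_cst.
    exact: within_continuous_cst.
  apply: within_continuousM; last exact: within_continuous_cst.
  by apply: within_continuousD => //; exact: within_continuous_norm.
have f0 y : 0 <= f y.
  by rewrite /f; have := ler_norm (- t y); rewrite normrN; lra.
have ft y : t y <= f y by rewrite /f; have := ler_norm (t y); lra.
have fU y : ~ U y -> f y = 0.
  move=> nUy; suff : t y <= 0 by move=> /ler0_norm h; rewrite /f h subrr mul0r.
  rewrite subr_le0 ler_pdivlMr// mul1r leNgt.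
  by apply/negP => yr; apply: nUy; apply: rU; rewrite -ball_normE /= distrC.
have [s s0 Ts] : exists2 s, 0 < s & forall x', w0 x' -> `|x - x'| < s ->
    1 / 2 <= f (Tb x').
  have r2 : 0 < r / 2 by rewrite divr_gt0.
  have /within_continuousP/(_ x w0x _ r2)[s s0 xs] := continuous_Tb S.
  exists s => // x' w0x' /(xs _ w0x'); rewrite distrC => h.
  apply: le_trans (ft _); rewrite /t.
  have : `|Tb x' - Tb x| / r < 1 / 2 by rewrite ltr_pdivrMr// mul1r mulrC.
  by lra.
have := rt_supp0 S; move=> /seteqP[_ /(_ x w0x)] => sx.
have u0x : (0 < u0 (ball x s))%E.
  by apply: sx; [exact: ball_open|exact: ballxx].
have mB : measurable (ball x s : set (borel R d)).
  by apply: open_borel; exact: ball_open.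
have mU : measurable (U : set (borel R d)) by exact: open_borel.
have m0 := mw0 S; have m1 := mw1 S.
rewrite lt0e measure_ge0 andbT; apply/eqP => ubU.
have I0 : \int[ub]_(y in w1) f y = 0.
  rewrite /Rintegral (ge0_negligible_integral mU)//; last 2 first.
  - by apply/measurable_EFinP; exact: (proj1 (bmf_w1 S cf)).
  - by move=> y _; rewrite lee_fin.
  rewrite (eq_integral (cst 0%E)) ?integral0// => y.
  by rewrite inE => -[_ /fU ->].
have := image_integral cf; rewrite I0 => /esym I1.
have bfT := bmf_w0 S (continuous_comp_Tb S cf).
have mBw : measurable (w0 `&` ball x s : set (borel R d)) by exact: measurableI.
have : ((1 / 2)%:E * u0 (w0 `&` ball x s) <= 0)%E.
  rewrite -(integral_cst u0 mBw).
  apply: (@le_trans _ _ (\int[u0]_(x in w0 `&` ball x s) (f (Tb x))%:E)%E).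
    apply: ge0_le_integral => //.
    - by move=> y _; rewrite lee_fin divr_ge0.
    - by apply/measurable_EFinP; apply: measurable_funS (proj1 bfT) => // y [].
    by move=> y [w0y]; rewrite -ball_normE /= lee_fin => /Ts; exact.
  have <- : (\int[u0]_(x in w0) (f (Tb x))%:E)%E = 0%E.
    rewrite (Rint_fin m0 (fin_u0 S) bfT); congr EFin; exact: I1.
  apply: ge0_subset_integral => //; first by apply/measurable_EFinP; exact: (proj1 bfT).
  by move=> y _; rewrite lee_fin.
rewrite pmule_rle0 ?lte_fin ?divr_gt0// => h.
suff : (u0 (ball x s) <= 0)%E by rewrite leNgt u0x.
have c0 : u0 (ball x s `\` w0) = 0%E.
  by apply: (rt_u0 S); [exact: measurableD|move=> y []].
have -> : u0 (ball x s) = (u0 (ball x s `\` w0) + u0 (ball x s `&` w0))%E.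
  exact: measureDI.
by rewrite c0 add0e setIC.
Qed.

End optimal_map.

(** * Expansion of the cost gap along the graph of the optimal map *)

Lemma hessE (R : realType) (d : nat) (f : 'rV[R]_d -> R) x i j :
  hess f x i j = 'D_(delta_mx ord0 j) ('D_(delta_mx ord0 i) f) x.
Proof. by rewrite mxE. Qed.

Lemma derive_slice (R : realType) (V W : normedModType R) (F : V * W -> R)
    (x : V) (y v : W) : 'D_v (fun y => F (x, y)) y = 'D_(0, v) F (x, y).
Proof.
have E : (fun h : R => h^-1 *: (((fun y => F (x, y)) \o shift y) (h *: v) - F (x, y))) =
    (fun h : R => h^-1 *: ((F \o shift (x, y)) (h *: (0, v)) - F (x, y))).
  apply/funext => h /=; congr (_ *: (F _ - _)).
  by rewrite -[RHS]/(h *: 0 + x, h *: v + y) scaler0 add0r.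
by rewrite /derive E.
Qed.

Lemma lincomb_pair (R : realType) (d : nat) (z : 'rV[R]_d) :
  lincomb (fun i => ((0, delta_mx ord0 i) : 'rV[R]_d * 'rV[R]_d)) z = (0, z).
Proof.
rewrite -[in RHS](lincomb_delta z) /lincomb.
elim/big_rec2 : _ => // i y1 y2 _ ->.
by rewrite -[LHS]/(_ *: 0 + 0, _ *: _ + _) scaler0 addr0.
Qed.

Lemma expansionB (R : realType) (d : nat) (a a0 b b0 e t : R) (z : 'rV[R]_d)
    (k l : 'I_d -> R) (A B : 'M[R]_d) :
  `|a - a0 - \sum_i z ord0 i * k i - qform A z / 2| <= e / 2 * t ->
  `|b - b0 - \sum_i z ord0 i * l i - qform B z / 2| <= e / 2 * t ->
  `|a - b - (a0 - b0) - \sum_i z ord0 i * (k i - l i) -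
    dot (z *m (A - B)) z / 2| <= e * t.
Proof.
move=> h1 h2; rewrite mulmxBr dotDl dotNl -!qform_dot.
under eq_bigr do rewrite mulrBr.
rewrite sumrB; set x := \sum_i _ in h1 *; set y := \sum_i _ in h2 *.
have -> : a - b - (a0 - b0) - (x - y) - (qform A z - qform B z) / 2 =
  (a - a0 - x - qform A z / 2) - (b - b0 - y - qform B z / 2) by field.
rewrite (le_trans (ler_normB _ _))// (le_trans (lerD h1 h2))//.
by rewrite -mulrDl -splitr.
Qed.

Section expansion.
Context (R : realType) (d : nat) (w0 w1 : set 'rV[R]_d)
  (c : 'rV[R]_d -> 'rV[R]_d -> R)
  (u0 ub : {finite_measure set (borel R d) -> \bar R})
  (phib : 'rV[R]_d -> R) (Tb : 'rV[R]_d -> 'rV[R]_d) (eps gamma : R).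
Context (S : regular_transport w0 w1 c u0 ub phib Tb eps gamma).
Local Notation gap := (gap c phib Tb).
Local Notation e1 := (fun i => delta_mx ord0 i : 'rV[R]_d).
Local Notation e2 := (fun i => (0, delta_mx ord0 i) : 'rV[R]_d * 'rV[R]_d).

Definition gap_hess (x : 'rV[R]_d) : 'M[R]_d := hess (c x) (Tb x) - hess phib (Tb x).

Lemma Tb_interior x : w0 x -> w1° (Tb x).
Proof. by move=> /(Tb_supp S); exact: (rt_suppb S). Qed.

Lemma compact_Tb_image : compact (Tb @` w0).
Proof. exact: (continuous_compact (continuous_Tb S) (rt_w0 S)). Qed.

Lemma compact_graph : compact ((fun x => (x, Tb x)) @` w0).
Proof. exact: (continuous_compact (continuous_pair_Tb S) (rt_w0 S)). Qed.

Lemma near_Tb : exists2 r, 0 < r & forall x z, w0 x -> `|z| < r ->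
  set_add (msupp ub) (closed_eball 0 eps) (Tb x + z).
Proof.
exists (eps / (d%:R + 1)); first by rewrite divr_gt0 ?(rt_eps S)// ltr_wpDl.
move=> x z w0x zr; exists (Tb x); first exact: (Tb_supp S w0x).
exists z => //; rewrite /closed_eball/= subr0 (le_trans (enorm_le_norm _))//.
have d0 : 0 < d%:R + 1 :> R by rewrite ltr_wpDl.
move: zr; rewrite ltr_pdivlMr// => zr; apply: le_trans (ltW zr).
by rewrite mulrC ler_wpM2l// lerDl.
Qed.

(** Near an interior point y of w1 the functions c x and G (x, -) agree. *)
Lemma hess_slice (U : set ('rV[R]_d * 'rV[R]_d)) (G : 'rV[R]_d * 'rV[R]_d -> R) x y :
  {in w0 `*` w1, (fun z => c z.1 z.2) =1 G} -> w0 x -> w1° y ->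
  hess (c x) y = hess_along e2 G (x, y).
Proof.
move=> cG w0x w1y.
have D1 i y' : w1° y' -> 'D_(e1 i) (c x) y' = 'D_(e2 i) G (x, y').
  move=> w1y'; rewrite -derive_slice; apply: near_eq_derive.
  have : nbhs y' w1° by apply: open_nbhs_nbhs; split => //; exact: open_interior.
  apply: filterS => y2 w1y2.
  by rewrite -(cG (x, y2))// inE; split => //=; exact: interior_subset.
apply/matrixP => i j; apply: (etrans (hessE (c x) y i j)).
apply: (etrans _ (esym (hess_alongE e2 G (x, y) i j))).
apply: (etrans _ (derive_slice ('D_(e2 i) G) x y (e1 j))).
apply: near_eq_derive.
have : nbhs y w1° by apply: open_nbhs_nbhs; split => //; exact: open_interior.
by apply: filterS => y2; exact: D1.
Qed.

Lemma hess_phib (P : 'rV[R]_d -> R) x :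
  {in set_add (msupp ub) (closed_eball 0 eps), phib =1 P} -> w0 x ->
  hess phib (Tb x) = hess_along e1 P (Tb x).
Proof.
move=> pP w0x; have [r r0 nT] := near_Tb.
have near_phib y : `|y - Tb x| < r -> \forall y' \near y, phib y' = P y'.
  move=> yr; apply/nbhs_ballP; exists (r - `|y - Tb x|) => /=; first by rewrite subr_gt0.
  move=> y'; rewrite -ball_normE /= => yy'.
  apply: pP; rewrite inE -[y'](subrKC (Tb x)); apply: nT => //.
  have := ler_distD y y' (Tb x); rewrite (distrC y' y); lra.
apply/matrixP => i j; apply: (etrans (hessE phib (Tb x) i j)).
apply: (etrans _ (esym (hess_alongE e1 P (Tb x) i j))).
apply: near_eq_derive.
apply/nbhs_ballP; exists r => // y; rewrite -ball_normE /= distrC => yr.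
by apply: near_eq_derive; exact: near_phib.
Qed.

(** The extensions of c and phib have second-order expansions which are uniform
    over the graph and over the image of T. *)
Lemma gap_expansion1 (U : set ('rV[R]_d * 'rV[R]_d)) (G : 'rV[R]_d * 'rV[R]_d -> R)
    (V : set 'rV[R]_d) (P : 'rV[R]_d -> R) e :
  open U -> w0 `*` w1 `<=` U -> cont_diff2_open U G ->
  {in w0 `*` w1, (fun z => c z.1 z.2) =1 G} ->
  open V -> set_add (msupp ub) (closed_eball 0 eps) `<=` V -> cont_diff2_open V P ->
  {in set_add (msupp ub) (closed_eball 0 eps), phib =1 P} -> 0 < e ->
  exists2 r, 0 < r & forall x z, w0 x -> `|z| < r ->
    w1 (Tb x + z) /\
    `|gap x (Tb x + z) -
      \sum_i z ord0 i * ('D_(e2 i) G (x, Tb x) - 'D_(e1 i) P (Tb x)) -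
      dot (z *m gap_hess x) z / 2| <= e * `|z| ^+ 2.
Proof.
move=> oU wU c2G cG oV mV c2P pP e0.
have eh : 0 < e / 2 by rewrite divr_gt0.
have [r3 r30 nT] := near_Tb.
have [|r1 r10 TG] := @taylor2_compact _ _ _ e2 _ _ _ _ c2G oU compact_graph _ eh.
  move=> _ [x w0x <-]; apply: wU; split => //=; exact: (rt_Tb S w0x).
have [|r2 r20 TP] := @taylor2_compact _ _ _ e1 _ _ _ _ c2P oV compact_Tb_image _ eh.
  move=> _ [x w0x <-]; apply: mV; have := nT x 0 w0x; rewrite addr0; apply.
  by rewrite normr0.
exists (Num.min r1 (Num.min r2 r3)); first by rewrite !lt_min r10 r20.
move=> x z w0x; rewrite !lt_min => /and3P[zr1 zr2 zr3].
have w1x := rt_Tb S w0x.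
have inn := nT x z w0x zr3.
have w1z : w1 (Tb x + z) by apply: interior_subset; exact: (rt_nbhd S inn).
split => //.
have h1 : `|G (x, Tb x + z) - G (x, Tb x) - \sum_i z ord0 i * 'D_(e2 i) G (x, Tb x)
    - qform (hess_along e2 G (x, Tb x)) z / 2| <= e / 2 * `|z| ^+ 2.
  have := TG (x, Tb x) z (ex_intro2 _ _ _ w0x erefl) zr1.
  rewrite lincomb_pair.
  have -> : ((x, Tb x) + (0, z) : 'rV[R]_d * 'rV[R]_d) = (x, Tb x + z).
    by rewrite -[LHS]/(x + 0, Tb x + z) addr0.
  by [].
have h2 : `|P (Tb x + z) - P (Tb x) - \sum_i z ord0 i * 'D_(e1 i) P (Tb x)
    - qform (hess_along e1 P (Tb x)) z / 2| <= e / 2 * `|z| ^+ 2.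
  have := TP (Tb x) z (ex_intro2 _ _ _ w0x erefl) zr2.
  by rewrite lincomb_delta.
have Gz : G (x, Tb x + z) = c x (Tb x + z) by rewrite -cG// inE.
have G0 : G (x, Tb x) = c x (Tb x) by rewrite -cG// inE.
have Pz : P (Tb x + z) = phib (Tb x + z) by rewrite -pP// inE.
have P0 : P (Tb x) = phib (Tb x).
  rewrite -pP// inE; have := nT x 0 w0x; rewrite addr0; apply.
  by rewrite normr0.
rewrite Gz G0 in h1; rewrite Pz P0 in h2.
rewrite /gap_hess (hess_slice U cG w0x (Tb_interior w0x)) (hess_phib pP w0x).
exact: (expansionB h1 h2).
Qed.

(** The gap is nonnegative and vanishes at the interior point T x, so that its
    linear part is zero there: it is bounded below by a quadratic error in the
    direction opposite to it. *)
Lemma linear_part_eq0 (f : 'rV[R]_d -> R) (l : 'rV[R]_d) (C r : R) : 0 < r -> 0 <= C ->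
  (forall z, `|z| < r -> 0 <= f z) ->
  (forall z, `|z| < r -> `|f z - dot l z| <= C * `|z| ^+ 2) -> l = 0.
Proof.
move=> r0 C0 f0 fl; apply: dot_eq0; apply/eqP; rewrite eq_le dot_ge0 andbT.
apply/ler_addgt0Pl => e ep; rewrite addr0.
pose N := `|l| + 1; have N0 : 0 < N by rewrite ltr_wpDl.
pose s := Num.min (r / N) (e / ((C + 1) * N ^+ 2)).
have C1 : 0 < C + 1 by rewrite ltr_wpDl.
have s0 : 0 < s by rewrite lt_min !divr_gt0// mulr_gt0// exprn_gt0.
have lN : `|l| < N by rewrite ltrDl.
have sl : `|- (s *: l)| < r.
  rewrite normrN normrZ gtr0_norm//; apply: (@lt_le_trans _ _ (s * N)).
    by rewrite ltr_pM2l.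
  by rewrite -ler_pdivlMr// ge_min lexx.
have := fl _ sl; have := f0 _ sl.
rewrite ler_norml dotNr dotZr => fp /andP[_ h].
have h2 : s * dot l l <= C * `|- (s *: l)| ^+ 2 by lra.
have h3 : s * dot l l <= s * e.
  apply: (le_trans h2); rewrite normrN normrZ (gtr0_norm s0) exprMn.
  have hs : s * ((C + 1) * N ^+ 2) <= e.
    by rewrite -ler_pdivlMr ?mulr_gt0 ?exprn_gt0// ge_min lexx orbT.
  apply: (@le_trans _ _ (s * (s * ((C + 1) * N ^+ 2)))); last by rewrite ler_pM2l.
  have -> : s * (s * ((C + 1) * N ^+ 2)) = (C + 1) * (s ^+ 2 * N ^+ 2) by ring.
  apply: ler_pM => //; first by apply: mulr_ge0; exact: sqr_ge0.
    by rewrite lerDl.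
  apply: ler_wpM2l; first exact: sqr_ge0.
  by rewrite ler_sqr ?nnegrE// ltW.
by move: h3; rewrite ler_pM2l.
Qed.

Lemma gap_ge0 x y : w0 x -> w1 y -> 0 <= gap x y.
Proof.
move=> w0x w1y; apply: le_trans (gap_ge S w0x w1y).
by rewrite mulr_ge0 ?sqr_ge0// divr_ge0// ltW// (rt_gamma S).
Qed.

Lemma entries_bounded (M : 'M[R]_d) : exists2 C, 0 <= C & forall i j, `|M i j| <= C.
Proof.
exists (\sum_i \sum_j `|M i j|); first by rewrite sumr_ge0// => i _; rewrite sumr_ge0.
move=> i j; rewrite (bigD1 i)//= (bigD1 j)//= -addrA lerDl.
by rewrite addr_ge0 ?sumr_ge0// => k _; rewrite sumr_ge0.
Qed.

Lemma gap_expansion e : 0 < e -> exists2 r, 0 < r & forall x z, w0 x -> `|z| < r ->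
  w1 (Tb x + z) /\
  `|gap x (Tb x + z) - dot (z *m gap_hess x) z / 2| <= e * `|z| ^+ 2.
Proof.
have [U [G [oU wU c2G cG]]] := rt_c2 S.
have [V [P [oV mV c2P pP]]] := rt_phib2 S.
move=> e0; have [r r0 ex] := gap_expansion1 oU wU c2G cG oV mV c2P pP e0.
exists r => // x z w0x zr; have [w1z hz] := ex x z w0x zr; split => //.
pose l : 'rV[R]_d := \row_i ('D_(e2 i) G (x, Tb x) - 'D_(e1 i) P (Tb x)).
have lE (z' : 'rV[R]_d) : \sum_i z' ord0 i * ('D_(e2 i) G (x, Tb x) - 'D_(e1 i) P (Tb x)) =
    dot l z' by apply: eq_bigr => i _; rewrite mxE mulrC.
suff l0 : l = 0.
  by move: hz; rewrite lE l0 -(scale0r (0 : 'rV[R]_d)) dotZl mul0r subr0.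
have [C C0 MC] := entries_bounded (gap_hess x).
pose D := e + d%:R ^+ 2 * C * d%:R ^+ 2.
have D0 : 0 <= D by rewrite addr_ge0 ?(ltW e0)// !mulr_ge0// sqr_ge0.
apply: (@linear_part_eq0 (fun z => gap x (Tb x + z)) l D r) => //.
  by move=> z' /(ex x _ w0x)[w1z' _]; exact: gap_ge0.
move=> z' /(ex x _ w0x)[_]; rewrite lE => h.
have hq := qform_le z' MC.
set q := dot (z' *m _) z' in h hq.
have hn : enorm z' ^+ 2 <= d%:R ^+ 2 * `|z'| ^+ 2.
  by rewrite -exprMn ler_sqr ?nnegrE ?enorm_ge0 ?mulr_ge0// enorm_le_norm.
have hq2 : `|q| <= d%:R ^+ 2 * C * d%:R ^+ 2 * `|z'| ^+ 2.
  apply: (le_trans hq); rewrite -[leRHS]mulrA ler_wpM2l//.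
  by rewrite mulr_ge0// sqr_ge0.
have -> : gap x (Tb x + z') - dot l z' =
  (gap x (Tb x + z') - dot l z' - q / 2) + q / 2 by rewrite subrK.
rewrite (le_trans (ler_normD _ _))// /D mulrDl lerD//.
apply: le_trans hq2; rewrite normrM ler_piMr//.
by rewrite ger0_norm ?invr_ge0// invf_le1// ler1n.
Qed.

(** The expansion at T x + s z and the growth condition are compared as s tends
    to 0; symmetry is Schwarz' theorem. *)
Lemma gap_hess_posdef x : w0 x -> posdef gamma (gap_hess x).
Proof.
move=> w0x; split.
  have [U [G [oU wU c2G cG]]] := rt_c2 S.
  have [V [P [oV mV c2P pP]]] := rt_phib2 S.
  rewrite /gap_hess (hess_slice U cG w0x (Tb_interior w0x)) (hess_phib pP w0x).
  rewrite linearB/=; congr (_ - _).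
    by apply: (hess_along_sym _ c2G oU); apply: wU; split => //=; exact: (rt_Tb S w0x).
  apply: (hess_along_sym _ c2P oV); apply: mV.
  have [r r0 nT] := near_Tb; have := nT x 0 w0x; rewrite addr0; apply.
  by rewrite normr0.
move=> z; apply/ler_addgt0Pl => e ep.
have N0 : 0 < `|z| ^+ 2 + 1 by rewrite ltr_wpDl// sqr_ge0.
pose e' := e / 2 / (`|z| ^+ 2 + 1).
have e'0 : 0 < e' by rewrite !divr_gt0.
have [r r0 ex] := gap_expansion e'0.
pose s := r / (`|z| + 1).
have s0 : 0 < s by rewrite divr_gt0// ltr_wpDl.
have sz : `|s *: z| < r.
  rewrite normrZ gtr0_norm// /s mulrAC ltr_pdivrMr ?ltr_wpDl//.
  by rewrite ltr_pM2l// ltrDl.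
have [w1z] := ex x _ w0x sz.
have := gap_ge S w0x w1z; rewrite addrAC subrr add0r sqr_enorm.
rewrite normrZ (gtr0_norm s0) exprMn -scalemxAl !(dotZl,dotZr).
set g := gap _ _; set q := dot (z *m _) z; set n := dot z z.
rewrite ler_norml => h1 /andP[_ h2].
have h3 : e' * `|z| ^+ 2 <= e / 2.
  rewrite /e' mulrAC ler_pdivrMr// ler_pM2l ?divr_gt0// lerDl//.
have s2 : 0 < s ^+ 2 by rewrite exprn_gt0.
have h4 : s ^+ 2 * (gamma * n) <= s ^+ 2 * (q + 2 * (e' * `|z| ^+ 2)) by lra.
by move: h4; rewrite ler_pM2l//; lra.
Qed.

Lemma continuous_gap_hess i j : {within w0, continuous (fun x => gap_hess x i j)}.
Proof.
have [U [G [oU wU c2G cG]]] := rt_c2 S.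
have [V [P [oV mV c2P pP]]] := rt_phib2 S.
apply: (@eq_within_continuous _ _ _ w0 (fun x =>
    'D_(e2 j) ('D_(e2 i) G) (x, Tb x) - 'D_(e1 j) ('D_(e1 i) P) (Tb x))).
  move=> x w0x; rewrite /gap_hess (hess_slice U cG w0x (Tb_interior w0x)).
  by rewrite (hess_phib pP w0x) !mxE.
have cGU : {within U, continuous ('D_(e2 j) ('D_(e2 i) G))}.
  apply: continuous_in_subspaceT => p /set_mem Up.
  by have [_ /(_ (e2 i))[_ /(_ (e2 j) p Up)]] := c2G.
have cPV : {within V, continuous ('D_(e1 j) ('D_(e1 i) P))}.
  apply: continuous_in_subspaceT => p /set_mem Vp.
  by have [_ /(_ (e1 i))[_ /(_ (e1 j) p Vp)]] := c2P.
apply: within_continuousD.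
  apply: (within_continuous_compose (continuous_pair_Tb S) cGU) => x w0x.
  by apply: wU; split => //=; exact: (rt_Tb S w0x).
apply: within_continuousN.
apply: (within_continuous_compose (continuous_Tb S) cPV) => x w0x; apply: mV.
have [r r0 nT] := near_Tb; have := nT x 0 w0x; rewrite addr0; apply.
by rewrite normr0.
Qed.

Lemma gap_hess_unit x : w0 x -> gap_hess x \in unitmx.
Proof. by move=> /gap_hess_posdef; apply: posdef_unit; exact: (rt_gamma S). Qed.

Lemma continuous_gap_hess_inv i j :
  {within w0, continuous (fun x => invmx (gap_hess x) i j)}.
Proof.
by apply: within_continuous_invmx; [exact: gap_hess_unit|exact: continuous_gap_hess].
Qed.

Lemma gap_hess_bounded : exists2 C, 0 < C & forall x z, w0 x ->
  enorm (z *m gap_hess x) <= C * enorm z.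
Proof.
have /choice[M MM] : forall ij : 'I_d * 'I_d, exists M : R, forall x, w0 x ->
    `|gap_hess x ij.1 ij.2| <= M.
  move=> ij; have := @continuous_gap_hess ij.1 ij.2.
  by move=> /(within_continuous_bounded (rt_w0 S)).
pose N := \sum_ij `|M ij|.
have N0 : 0 <= N by apply: sumr_ge0.
exists (d%:R ^+ 2 * N + 1); first by rewrite ltr_wpDl// mulr_ge0// sqr_ge0.
move=> x z w0x.
have b i j : `|gap_hess x i j| <= N.
  apply: (le_trans (MM (i, j) x w0x)); apply: (le_trans (ler_norm _)).
  by rewrite /N (bigD1 (i, j))//= lerDl sumr_ge0.
by rewrite (le_trans (enorm_mulmx z b))// ler_wpM2r ?enorm_ge0// lerDl.
Qed.

End expansion.

(** * Lower bound for the second-order difference quotients *)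

Lemma le_limn_einf (R : realType) (u : nat -> \bar R) (a : \bar R) :
  (\forall k \near \oo, (a <= u k)%E) -> (a <= limn_einf u)%E.
Proof.
move=> [n _ na]; rewrite limn_einf_lim (cvg_lim _ (@cvg_einfs_sup _ u))//.
apply: (@le_trans _ _ (einfs u n)); last by apply: ereal_sup_ubound; exists n.
by apply: le_ereal_inf_tmp => _ [k /= nk <-]; exact: na.
Qed.

Section lower.
Context (R : realType) (d : nat) (w0 w1 : set 'rV[R]_d)
  (c : 'rV[R]_d -> 'rV[R]_d -> R)
  (u0 ub : {finite_measure set (borel R d) -> \bar R})
  (phib : 'rV[R]_d -> R) (Tb : 'rV[R]_d -> 'rV[R]_d) (eps gamma : R).
Context (S : regular_transport w0 w1 c u0 ub phib Tb eps gamma).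
Local Notation gap := (gap c phib Tb).
Local Notation phic := (phic c phib Tb).
Local Notation A := (gap_hess c phib Tb).
Local Notation mass := (mass w0 u0).
Local Notation W := (w0 `*` w1 : set (borel R d * borel R d)).
Local Notation D := (transport_dual w0 w1 c u0).
Local Notation ub' := (Pi w1 (charge_of_finite_measure ub)).
Local Notation gradf f x := (gradc w1 f (Tb x)).

(** The displacement z of the mass at T x which maximizes
    dot (grad f (T x)) z - dot (z *m A x) z / 2. *)
Definition displacement f x : 'rV[R]_d := gradf f x *m invmx (A x).

Definition energy_form f g : R :=
  \int[u0]_(x in w0) dot (displacement f x) (gradf g x).

(** The integral of these maxima. *)
Definition energy f : R := energy_form f f / 2.

Lemma continuous_gradf f i : C1 w1 f ->
  {within w0, continuous (fun x => gradf f x ord0 i)}.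
Proof.
move=> C1f.
apply: within_continuous_coord.
exact: (continuous_comp_Tb S (continuous_gradc (rt_cl S) C1f)).
Qed.

Lemma continuous_displacement f i : C1 w1 f ->
  {within w0, continuous (fun x => displacement f x ord0 i)}.
Proof.
move=> C1f; apply: (@eq_within_continuous _ _ _ _
    (fun x => \sum_j gradf f x ord0 j * invmx (A x) j i)).
  by move=> x _; rewrite [RHS]mxE.
apply: within_continuous_sum => j; apply: within_continuousM.
  exact: continuous_gradf.
exact: (continuous_gap_hess_inv S).
Qed.

Lemma continuous_dot_displacement f g : C1 w1 f -> C1 w1 g ->
  {within w0, continuous (fun x => dot (displacement f x) (gradf g x))}.
Proof.
move=> C1f C1g; apply: within_continuous_sum => i; apply: within_continuousM.
  exact: continuous_displacement.
exact: continuous_gradf.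
Qed.

Lemma bmf_energy f g : C1 w1 f -> C1 w1 g -> bounded_mfun (w0 : set (borel R d))
  (fun x => dot (displacement f x) (gradf g x)).
Proof. by move=> C1f C1g; apply: (bmf_w0 S); exact: continuous_dot_displacement. Qed.

Lemma energy_formC f g : energy_form f g = energy_form g f.
Proof.
apply: eq_Rintegral => x /set_mem w0x; apply: dot_sym.
exact: (invmx_sym (gap_hess_posdef S w0x)).
Qed.

Lemma energy_form_linl a f g h : C1 w1 f -> C1 w1 g -> C1 w1 h ->
  energy_form (fun x => a * f x + g x) h = a * energy_form f h + energy_form g h.
Proof.
move=> C1f C1g C1h.
have fm := fin_u0 (u0 := u0) S; have mw := mw0 S.
rewrite /energy_form -RintZ//; last exact: bmf_energy.
rewrite -RintD//; [|exact/bmfZ/bmf_energy|exact: bmf_energy].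
apply: eq_Rintegral => x /set_mem w0x; rewrite /displacement.
rewrite (gradc_lin _ (rt_cl S))//; last exact: (rt_Tb S w0x).
by rewrite mulmxDl dotDl -scalemxAl dotZl.
Qed.

Lemma energy_ge0 f : 0 <= energy f.
Proof.
rewrite divr_ge0//; apply: Rintegral_ge0 => x w0x.
exact: (invmx_ge0 (rt_gamma S) (gap_hess_posdef S w0x)).
Qed.

(** Young's inequality for the quadratic form of the Hessian of the gap, where
    the expansions at T x are valid; further away the quadratic growth of the
    gap beats t (f y - f (T x)). *)
Lemma gap_young f e : C1 w1 f -> 0 < e -> exists2 t0, 0 < t0 &
  forall t x y, 0 < t < t0 -> w0 x -> w1 y ->
    t * (f y - f (Tb x)) - t ^+ 2 / 2 * dot (displacement f x) (gradf f x) -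
      e * (t ^+ 2 + enorm (y - Tb x) ^+ 2) <= gap x y.
Proof.
move=> C1f e0.
have e20 : 0 < e / 2 by rewrite divr_gt0.
have [r1 r10 exg] := gap_expansion S e20.
have Kw : Tb @` w0 `<=` w1° by move=> _ [x w0x <-]; exact: (Tb_interior S w0x).
have [r2 r20 exf] := taylor1_compact (rt_w1 S) C1f (compact_Tb_image S) Kw e0.
have [C1fc _ _] := C1f.
have [M fM] := within_continuous_bounded (rt_w1 S) C1fc.
pose r := Num.min r1 r2.
have r0 : 0 < r by rewrite lt_min r10.
have g0 := rt_gamma S.
have M1 : 0 < 4 * `|M| + 4 by rewrite ltr_wpDl// mulr_ge0.
(* For t < t0 the oscillation 2 t |M| is below the growth gamma / 2 r^2. *)
exists (gamma * r ^+ 2 / (4 * `|M| + 4)).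
  by rewrite divr_gt0// mulr_gt0// exprn_gt0.
move=> t x y /andP[tp t0] w0x w1y.
have w1x := rt_Tb S w0x.
have q0 : 0 <= dot (displacement f x) (gradf f x).
  exact: (invmx_ge0 g0 (gap_hess_posdef S w0x)).
pose z := y - Tb x.
have yE : y = Tb x + z by rewrite /z addrC subrK.
have n0 := enorm_ge0 z.
have tq0 : 0 <= t ^+ 2 / 2 * dot (displacement f x) (gradf f x).
  by rewrite mulr_ge0// divr_ge0// sqr_ge0.
have te0 : 0 <= e * (t ^+ 2 + enorm z ^+ 2).
  by rewrite mulr_ge0 ?(ltW e0)// addr_ge0// sqr_ge0.
rewrite -/z; have [zr|zr] := ltP `|z| r; last first.
  have h1 : t * (f y - f (Tb x)) <= gamma / 2 * r ^+ 2.
    apply: (@le_trans _ _ (t * (2 * `|M|))).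
      rewrite ler_pM2l// (le_trans (ler_norm _))// (le_trans (ler_normB _ _))//.
      by rewrite mulr_natl mulr2n lerD// (le_trans _ (ler_norm M))// fM.
    move: t0; rewrite ltr_pdivlMr// => t0.
    have : 0 <= t * `|M| by rewrite mulr_ge0// ltW.
    lra.
  have h2 := gap_ge S w0x w1y; rewrite -/z in h2.
  have h3 : gamma / 2 * r ^+ 2 <= gamma / 2 * enorm z ^+ 2.
    rewrite ler_pM2l ?divr_gt0// ler_sqr ?nnegrE ?(ltW r0)//.
    by rewrite (le_trans zr)// norm_le_enorm.
  lra.
move: zr; rewrite lt_min => /andP[zr1 zr2].
have [_ hg] := exg x z w0x zr1.
have hf := exf _ z (ex_intro2 _ _ x w0x erefl) zr2.
rewrite -yE in hg hf.
rewrite -(gradc_interior (rt_cl S) C1f (Tb_interior S w0x)) in hf.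
have hy := young_mx g0 (gap_hess_posdef S w0x) (t *: gradf f x) z.
rewrite -scalemxAl !(dotZl, dotZr) -/(displacement f x) in hy.
have nz : `|z| <= enorm z := norm_le_enorm z.
have nz2 : `|z| ^+ 2 <= enorm z ^+ 2 by rewrite ler_sqr ?nnegrE.
move: hg hf; rewrite !ler_norml => /andP[hg _] /andP[_ hf].
have h1 : t * (f y - f (Tb x) - dot (gradf f x) z) <= t * (e * enorm z).
  by rewrite ler_pM2l// (le_trans hf)// ler_pM2l.
have h2 : t * (e * enorm z) <= e * (t ^+ 2 + enorm z ^+ 2) / 2.
  rewrite mulrCA -mulrA ler_pM2l//.
  have := sqr_ge0 (t - enorm z); rewrite sqrrB; lra.
have h3 : e / 2 * `|z| ^+ 2 <= e / 2 * enorm z ^+ 2 by rewrite ler_pM2l.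
have h4 : 0 <= e * t ^+ 2 by rewrite mulr_ge0 ?sqr_ge0// ltW.
have h5 : t * (t * dot (displacement f x) (gradf f x)) / 2 =
  t ^+ 2 / 2 * dot (displacement f x) (gradf f x) by ring.
lra.
Qed.

Section charge.
Context (m : {charge set (borel R d) -> \bar R})
  (p : {measure set (borel R d * borel R d) -> \bar R})
  (pc : coupling w0 w1 u0 m p).

Let mS : measurable_fun setT (@snd (borel R d) (borel R d)).
Proof. exact: measurable_snd. Qed.

(** A charge that is the second marginal of a plan is a measure. *)
Let m' : {measure set (borel R d) -> \bar R} := push_measure p mS.

Let m'E A : measurable A -> m A = m' A.
Proof. by move=> mA; have [_ _ <-] := pc. Qed.

Let pc' : coupling w0 w1 u0 m' p.
Proof. by have [p0 p1 p2] := pc. Qed.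

Lemma Pi_plan (f : 'rV[R]_d -> R) : {within w1, continuous f} ->
  bounded_mfun W (fun z => f z.2) /\ Pi w1 m f = \int[p]_(z in W) f z.2.
Proof.
move=> cf; have [bf ->] := plan_snd S pc' (bmf_w1 S cf); split => //.
exact: (charge_integral_measure _ (mw1 S) m'E).
Qed.

Lemma charge_cost :
  (\int[p]_(z in W) (c z.1 z.2)%:E)%E =
  (\int[p]_(z in W) gap z.1 z.2 + (Pi w1 m phib + \int[u0]_(x in w0) phic x))%:E.
Proof.
have [_ ->] := Pi_plan (continuous_phib S).
have [_ ->] := plan_snd S pc' (bmf_w1 S (continuous_phib S)).
exact: (plan_cost S pc').
Qed.

Lemma charge_sqr_dist :
  gamma / 2 * \int[p]_(z in W) (enorm (z.2 - Tb z.1) ^+ 2) <=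
  \int[p]_(z in W) gap z.1 z.2.
Proof. exact: (plan_sqr_dist S pc'). Qed.

End charge.

Lemma Pi_ub f : Pi w1 (charge_of_finite_measure ub) f = \int[ub]_(y in w1) f y.
Proof. exact: (charge_integral_measure _ (mw1 S)). Qed.

(** The pointwise inequality is integrated over a plan. The growth condition
    absorbs the errors e |y - T x|^2 into the integral of the gap. *)
Lemma plan_energy (m : {charge set (borel R d) -> \bar R})
    (p : {measure set (borel R d * borel R d) -> \bar R}) f e t :
  C1 w1 f -> coupling w0 w1 u0 m p ->
  (forall x y, w0 x -> w1 y ->
    t * (f y - f (Tb x)) - t ^+ 2 / 2 * dot (displacement f x) (gradf f x) -
      e * (t ^+ 2 + enorm (y - Tb x) ^+ 2) <= gap x y) -> 0 < e ->
  t * (Pi w1 m f - ub' f) - t ^+ 2 * (energy f + e * mass) <=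
  (1 + 2 * e / gamma) * \int[p]_(z in W) gap z.1 z.2.
Proof.
move=> C1f pc hy e0; have [cf _ _] := C1f.
have fp := plan_fin S pc; have mW := mw01 S.
have [bf ->] := Pi_plan pc cf.
rewrite Pi_ub (image_integral S cf).
have [bT eT] := plan_fst S pc (bmf_w0 S (continuous_comp_Tb S cf)).
have {}eT : \int[p]_(z in W) f (Tb z.1) = \int[u0]_(x in w0) f (Tb x) := eT.
rewrite -eT /energy /energy_form.
have [bq <-] := plan_fst S pc (bmf_energy C1f C1f).
have bd := bmf_sqr_dist S; have bg := bmf_gap S.
have h := charge_sqr_dist pc.
set I := Rintegral p _ _ in h; set G := Rintegral p _ _ in h *.
have : t * (\int[p]_(z in W) f z.2 - \int[p]_(z in W) f (Tb z.1)) -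
   t ^+ 2 / 2 * (\int[p]_(z in W) dot (displacement f z.1) (gradf f z.1)) -
   e * (t ^+ 2 * mass + I) <= G.
  have -> : t ^+ 2 * mass = \int[p]_(z in W) (t ^+ 2).
    by rewrite Rint_cst// (plan_mass S pc).
  rewrite /I -RintB// -RintZ//; last exact: bmfB.
  rewrite -[X in _ - X - _]RintZ// -RintD//; last exact: bmf_cst.
  rewrite -[X in _ - _ - X]RintZ//; last by apply: bmfD => //; exact: bmf_cst.
  rewrite -RintB//; [|exact/bmfZ/bmfB|exact: bmfZ].
  rewrite -RintB//; first last.
  - by apply: bmfZ; apply: bmfD => //; exact: bmf_cst.
  - by apply: bmfB; [exact/bmfZ/bmfB|exact: bmfZ].
  apply: le_Rint => //.
    apply: bmfB; first by apply: bmfB; [exact/bmfZ/bmfB|exact: bmfZ].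
    by apply: bmfZ; apply: bmfD => //; exact: bmf_cst.
  by move=> [x y] [w0x w1y]; exact: hy.
have g0 := rt_gamma S.
have h2 : e * I <= 2 * e / gamma * G.
  have -> : e * I = 2 * e / gamma * (gamma / 2 * I) by field; rewrite gt_eqF.
  by rewrite ler_pM2l// divr_gt0// mulr_gt0.
lra.
Qed.

Lemma transport_dual_ub : D ub' = (ub' phib + \int[u0]_(x in w0) phic x)%:E.
Proof.
apply/eqP; rewrite eq_le; apply/andP; split.
  apply: ereal_inf_lbound; exists (charge_of_finite_measure ub).
    by split => // A mA; exact: (rt_ub S).
  by rewrite Pi_ub -(transport_cost_ub S).
apply: le_ereal_inf_tmp => _ [m [_ eqm] <-]; apply: le_ereal_inf_tmp => _ [p pc <-].
rewrite (charge_cost pc) lee_fin (eqm _ (rt_phib S)) lerDr.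
by apply: Rintegral_ge0 => z [w0z w1z]; exact: (gap_ge0 S).
Qed.

Lemma second_quotient_ge t h (X : R) : 0 < t ->
  (forall (m : {charge set (borel R d) -> \bar R})
     (p : {measure set (borel R d * borel R d) -> \bar R}),
     dual_eq w1 (fun f => ub' f + t * h f) (Pi w1 m) -> coupling w0 w1 u0 m p ->
     X * (t ^+ 2 / 2) <= \int[p]_(z in W) gap z.1 z.2) ->
  (X%:E <= second_quotient D ub' phib t h)%E.
Proof.
move=> t0 hX; rewrite /second_quotient transport_dual_ub.
have t2 : 0 < t ^+ 2 / 2 by rewrite divr_gt0// exprn_gt0.
have : ((ub' phib + \int[u0]_(x in w0) phic x + t * h phib + X * (t ^+ 2 / 2))%:E
    <= D (fun f => ub' f + t * h f)%R)%E.
  apply: le_ereal_inf_tmp => _ [m [_ eqm] <-]; apply: le_ereal_inf_tmp => _ [p pc <-].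
  rewrite (charge_cost pc) lee_fin -(eqm _ (rt_phib S)).
  by have := hX m p eqm pc; lra.
case: (D _) => [r| |]; rewrite ?lee_fin ?leeNy_eq//.
  move=> hr; rewrite ler_pdivlMr//; lra.
by move=> _; rewrite gt0_mulye ?leey// lte_fin invr_gt0.
Qed.

Lemma second_quotient_le t h (m : {charge set (borel R d) -> \bar R})
    (p : {measure set (borel R d * borel R d) -> \bar R}) : 0 < t ->
  carried_by w1 m -> dual_eq w1 (fun f => ub' f + t * h f) (Pi w1 m) ->
  coupling w0 w1 u0 m p ->
  (second_quotient D ub' phib t h <=
   (\int[p]_(z in W) gap z.1 z.2 / (t ^+ 2 / 2))%:E)%E.
Proof.
move=> t0 cm eqm pc; rewrite /second_quotient transport_dual_ub.
have t2 : 0 < t ^+ 2 / 2 by rewrite divr_gt0// exprn_gt0.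
have : (D (fun f => ub' f + t * h f)%R <= (\int[p]_(z in W) gap z.1 z.2 +
    (ub' phib + t * h phib + \int[u0]_(x in w0) phic x))%:E)%E.
  apply: (@le_trans _ _ (transport_cost w0 w1 c u0 m)).
    by apply: ereal_inf_lbound; exists m.
  rewrite (eqm _ (rt_phib S)) -(charge_cost pc).
  by apply: ereal_inf_lbound; exists p.
case: (D _) => [r| |]; rewrite ?lee_fin ?leye_eq//.
  by move=> hr; rewrite ler_pM2r ?invr_gt0//; lra.
by move=> _; rewrite gt0_mulNye ?leNye// lte_fin invr_gt0.
Qed.

(** Each f in C^1 bounds the difference quotients from below; the convergence of
    h_k enters through its values at f and phib alone. *)
Lemma near_second_quotient (t : nat -> R) hk Phi f a :
  null_seq t -> dual_seq w1 hk Phi -> C1 w1 f -> a < 2 * (Phi f - energy f) ->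
  \forall k \near \oo, (a%:E <= second_quotient D ub' phib (t k) (hk k))%E.
Proof.
move=> [tp t0] [_ hPhi] C1f.
set b := 2 * (Phi f - energy f).
move=> ab; have m0 := mass_ge0 w0 u0; have g0 := rt_gamma S.
(* The number e makes the errors e mass and e |a| / gamma together smaller than
   (b - a) / 4. *)
pose k0 := 2 * mass + 2 * `|a| / gamma + 1.
have k00 : 0 < k0.
  rewrite ltr_wpDl// addr_ge0 ?mulr_ge0//.
  by rewrite invr_ge0 ltW.
pose e := (b - a) / 2 / k0.
have ba : 0 < b - a by rewrite subr_gt0.
have e0 : 0 < e by rewrite !divr_gt0.
have ek : e * k0 = (b - a) / 2 by rewrite divfK// gt_eqF.
have [t1 t10 hy] := gap_young C1f e0.
have E1 : \forall k \near \oo, `|0 - t k| < t1 by move/cvgrPdist_lt : t0; exact.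
have E2 : \forall k \near \oo, `|Phi f - hk k f| < (b - a) / 4.
  by move/cvgrPdist_lt : (hPhi f C1f) => /(_ ((b - a) / 4)); apply; rewrite divr_gt0.
apply: filterS2 E1 E2 => k.
rewrite sub0r normrN gtr0_norm// => tk hkf.
apply: second_quotient_ge => // m p eqm pc.
have := plan_energy C1f pc (fun x y => hy (t k) x y _) e0.
rewrite tp tk => /(_ isT); rewrite -(eqm _ C1f) addrAC subrr add0r.
set G := Rintegral _ _ _ => hG.
have c1 : 0 < 1 + 2 * e / gamma by rewrite ltr_wpDr// divr_ge0 ?(ltW g0)// mulr_ge0// ltW.
rewrite -(ler_pM2l c1); apply: le_trans hG.
have -> : (1 + 2 * e / gamma) * (a * (t k ^+ 2 / 2)) =
   t k ^+ 2 * ((1 + 2 * e / gamma) * (a / 2)) by ring.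
have -> : t k * (t k * hk k f) - t k ^+ 2 * (energy f + e * mass) =
   t k ^+ 2 * (hk k f - energy f - e * mass) by ring.
rewrite ler_pM2l ?exprn_gt0//.
have h1 : e * (a / gamma) <= e * (`|a| / gamma).
  by rewrite ler_pM2l// ler_pM2r ?invr_gt0// ler_norm.
have h2 : (1 + 2 * e / gamma) * (a / 2) = a / 2 + e * (a / gamma).
  by field; rewrite gt_eqF.
move: ek; rewrite /k0 !mulrDr mulr1 => ek.
move: hkf; rewrite ltr_norml => /andP[_ h3].
have h4 : e * (2 * mass) = 2 * (e * mass) by ring.
have h5 : e * (2 * `|a| / gamma) = 2 * (e * (`|a| / gamma)).
  by field; rewrite gt_eqF.
rewrite h2; move: h3; rewrite /b in ek ba ab *; lra.
Qed.

End lower.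

(** * Recovery sequences *)

(** The index n k tends to infinity, as slowly as P demands. *)
Lemma diagonal_choice (P : nat -> nat -> Prop) :
  (forall k, P k 0%N) -> (forall n, \forall k \near \oo, P k n) ->
  exists n : nat -> nat, (forall k, P k (n k)) /\ (forall N, \forall k \near \oo, (N <= n k)%N).
Proof.
move=> P0 PN.
pose Q k n := (n <= k)%N && `[< P k n >].
have exQ k : exists n, Q k n by exists 0%N; rewrite /Q /=; apply/asboolP.
have ubQ k n : Q k n -> (n <= k)%N by case/andP.
exists (fun k => ex_maxn (exQ k) (ubQ k)); split => [k|N].
  by case: ex_maxnP => n /andP[_ /asboolP].
have kN : \forall k \near \oo, (N <= k)%N by exists N.
apply: filterS2 kN (PN N) => k Nk PkN.
by case: ex_maxnP => n _; apply; rewrite /Q Nk; apply/asboolP.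
Qed.

Lemma quadratic_expand (R : realFieldType) (a hh gh fh gg fg gf ff : R) :
  hh = a * gh + fh -> gh = a * gg + fg -> fh = a * gf + ff -> gf = fg ->
  hh / 2 = ff / 2 + a * fg + a ^+ 2 * (gg / 2).
Proof. by move=> -> -> -> ->; field. Qed.

Lemma ascent_step (R : realFieldType) (a s eta ph eh pg pf ef b eg : R) :
  ph - eh <= s -> ph = a * pg + pf -> eh = ef + a * b + a ^+ 2 * eg ->
  s - eta ^+ 2 <= pf - ef -> a * (pg - b) <= eta ^+ 2 + a ^+ 2 * eg.
Proof. by move=> h e1 e2; rewrite e1 e2 in h; lra. Qed.

Section recovery.
Context (R : realType) (d : nat) (w0 w1 : set 'rV[R]_d)
  (c : 'rV[R]_d -> 'rV[R]_d -> R)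
  (u0 ub : {finite_measure set (borel R d) -> \bar R})
  (phib : 'rV[R]_d -> R) (Tb : 'rV[R]_d -> 'rV[R]_d) (eps gamma : R).
Context (S : regular_transport w0 w1 c u0 ub phib Tb eps gamma).
Local Notation A := (gap_hess c phib Tb).
Local Notation mass := (mass w0 u0).
Local Notation W := (w0 `*` w1 : set (borel R d * borel R d)).
Local Notation gradf f x := (gradc w1 f (Tb x)).
Local Notation v := (displacement w1 c phib Tb).
Local Notation B := (energy_form w0 w1 c u0 phib Tb).
Local Notation E := (energy w0 w1 c u0 phib Tb).

Lemma C1_norm_ge f x : C1 w1 f -> w1 x -> `|f x| <= C1_norm w1 f.
Proof.
move=> [cf _ _] w1x; rewrite /C1_norm le_max; apply/orP; left.
have [M fM] := within_continuous_bounded (rt_w1 S) cf.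
apply: ub_le_sup; last by exists x.
by exists M => _ [y w1y <-]; exact: fM.
Qed.

Lemma Pi_C1_dual (m : {charge set (borel R d) -> \bar R})
    (p : {measure set (borel R d * borel R d) -> \bar R}) :
  coupling w0 w1 u0 m p -> C1_dual w1 (Pi w1 m).
Proof.
move=> pc; have fp := plan_fin S pc; have mW := mw01 S.
split=> [a f g C1f C1g|].
  have [[cf _ _] [cg _ _] [ch _ _]] := And3 C1f C1g (C1_lin a C1f C1g).
  have [bf ->] := Pi_plan S pc cf; have [bg ->] := Pi_plan S pc cg.
  have [bh ->] := Pi_plan S pc ch.
  by rewrite -RintZ// -RintD//; exact: bmfZ.
exists mass => f C1f; have [cf _ _] := C1f; have [bf ->] := Pi_plan S pc cf.
rewrite mulrC -[mass](congr1 fine (plan_mass S pc)).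
by apply: Rint_norm_le => // z [_ w1z]; exact: C1_norm_ge.
Qed.

Lemma displacement_bounded f : C1 w1 f ->
  exists2 M, 0 <= M & forall x, w0 x -> `|v f x| <= M.
Proof.
move=> C1f; have cg := continuous_comp_Tb S (continuous_gradc (rt_cl S) C1f).
have [M gM] := within_continuous_bounded (rt_w0 S) cg.
have g0 := rt_gamma S.
exists (d%:R * `|M| / gamma); first by rewrite divr_ge0 ?(ltW g0)// mulr_ge0.
move=> x w0x; apply: (le_trans (norm_le_enorm _)).
apply: (le_trans (enorm_invmx g0 (gap_hess_posdef S w0x) _)).
rewrite ler_pM2r ?invr_gt0// (le_trans (enorm_le_norm _))// ler_wpM2l//.
by rewrite (le_trans (gM x w0x))// ler_norm.
Qed.

(** Moving the mass at T x by t times the displacement. *)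
Lemma push_plan f (t M r : R) : C1 w1 f -> 0 < t ->
  (forall x, w0 x -> `|v f x| <= M) -> t * M < r ->
  (forall x z, w0 x -> `|z| < r -> w1 (Tb x + z)) ->
  exists (m : {charge set (borel R d) -> \bar R})
    (p : {measure set (borel R d * borel R d) -> \bar R}),
  [/\ carried_by w1 m, coupling w0 w1 u0 m p &
  forall F : 'rV[R]_d * 'rV[R]_d -> R, bounded_mfun W F ->
    bounded_mfun (w0 : set (borel R d)) (fun x => F (x, Tb x + t *: v f x)) /\
    \int[p]_(z in W) F z = \int[u0]_(x in w0) F (x, Tb x + t *: v f x)].
Proof.
move=> C1f t0 vM tM w1r.
have w1T x : w0 x -> w1 (Tb x + t *: v f x).
  move=> w0x; apply: w1r => //; apply: le_lt_trans tM.
  by rewrite normrZ gtr0_norm// ler_pM2l// vM.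
pose T1 (x : borel R d) : borel R d := if x \in w0 then Tb x + t *: v f x else 0.
have T1E x : w0 x -> T1 x = Tb x + t *: v f x by move=> w0x; rewrite /T1 mem_set.
have mT1 : measurable_fun setT T1.
  apply: borel_coord => i.
  rewrite (_ : (fun _ => _) = (fun x => Tb x ord0 i + t * v f x ord0 i) \_ w0).
    apply/(measurable_restrictT _ (mw0 S)).
    apply: (proj1 (bmf_w0 S _)); apply: within_continuousD.
      exact: (within_continuous_coord (continuous_Tb S)).
    apply: within_continuousM; first exact: within_continuous_cst.
    exact: (continuous_displacement S).
  by apply/funext => x; rewrite patchE /T1; case: ifP => _; rewrite !mxE.
pose ph x := (x, T1 x).
have mph : measurable_fun setT ph by apply: measurable_fun_pair.
have u00 : u0 (~` w0) = 0%E.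
  by apply: (rt_u0 S) => //; apply: measurableC; exact: (mw0 S).
have mWc : measurable (~` W) by apply: measurableC; exact: (mw01 S).
have mphi C : measurable C -> measurable (ph @^-1` C).
  by move=> mC; rewrite -[X in measurable X]setTI; exact: mph.
exists (push_charge (charge_of_finite_measure u0) mT1), (push_measure u0 mph); split.
- move=> C mC Cw1; apply: (rt_u0 S (A := T1 @^-1` C)).
    by rewrite -[X in measurable X]setTI; exact: mT1.
  by move=> x /Cw1 nw1 /= w0x; apply: nw1; rewrite T1E//; exact: w1T.
- split => //; apply: (rt_u0 S (A := ph @^-1` (~` W))); first exact: mphi.
  by move=> x nW /= w0x; apply: nW; split => //=; rewrite T1E//; exact: w1T.
- move=> F bF.
  have [||||||||bFp <-] := @Rint_marginal _ _ (borel R d) (borel R d * borel R d)%type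
    R u0 (push_measure u0 mph) ph w0 W F => //.
  + exact: (mw0 S).
  + exact: (mw01 S).
  + by move=> x w0x; split => //=; rewrite T1E//; exact: w1T.
  + have : u0 (ph @^-1` W) \is a fin_num.
      by apply: fin_num_measure; apply: mphi; exact: (mw01 S).
    by rewrite ge0_fin_numE.
  split.
    by apply: eq_bmf bFp => x /set_mem w0x /=; rewrite /ph T1E.
  by apply: eq_Rintegral => x /set_mem w0x; rewrite /ph T1E.
Qed.

Lemma dot_displacement f x : w0 x -> C1 w1 f ->
  dot (v f x *m A x) (v f x) = dot (v f x) (gradf f x).
Proof.
by move=> w0x C1f; rewrite /v mulmxKV ?(gap_hess_unit S)// dotC.
Qed.

(** The quadratic form of A at the displacement is at least gamma times its
    squared length, and it integrates to 2 E f. *)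
Lemma sqr_displacement_le f : C1 w1 f ->
  bounded_mfun (w0 : set (borel R d)) (fun x => enorm (v f x) ^+ 2) /\
  \int[u0]_(x in w0) (enorm (v f x) ^+ 2) <= 2 / gamma * E f.
Proof.
move=> C1f; have g0 := rt_gamma S.
have fm := fin_u0 (u0 := u0) S; have mw := mw0 S.
have bn : bounded_mfun (w0 : set (borel R d)) (fun x => enorm (v f x) ^+ 2).
  apply: (@eq_bmf _ (borel R d) R w0 (fun x => \sum_i v f x ord0 i * v f x ord0 i)).
    by move=> x _; rewrite sqr_enorm.
  apply: (bmf_w0 S); apply: within_continuous_sum => i.
  by apply: within_continuousM; exact: (continuous_displacement S).
split => //.
have -> : 2 / gamma * E f = gamma^-1 * B f f by rewrite /energy; field; rewrite gt_eqF.
rewrite ler_pdivlMl// -RintZ//; apply: le_Rint => //; first exact: bmfZ.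
  exact: (bmf_energy S).
move=> x w0x; rewrite -dot_displacement// sqr_enorm.
exact: (proj2 (gap_hess_posdef S w0x)).
Qed.

Section dual.
Context (Phi : ('rV[R]_d -> R) -> R) (dPhi : C1_dual w1 Phi).

(** The Legendre transform of the energy at Phi. *)
Definition dual_energy : \bar R :=
  ereal_sup [set (Phi f - E f)%:E | f in C1 w1].

Lemma C1_dual0 : Phi (fun=> 0) = 0.
Proof.
have := proj1 dPhi 1 (fun=> 0) (fun=> 0) (C1_cst _ _) (C1_cst _ _).
have -> : (fun x : 'rV[R]_d => 1 * 0 + 0 : R) = fun=> 0.
  by apply/funext => x; rewrite mulr0 addr0.
by rewrite mul1r => h; lra.
Qed.

Lemma displacement0 x : w0 x -> v (fun=> 0) x = 0.
Proof.
move=> w0x; rewrite /displacement.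
rewrite (gradc_interior (rt_cl S) (C1_cst _ _) (Tb_interior S w0x)).
have -> : grad (fun=> 0) (Tb x) = 0 by apply/rowP => i; rewrite !mxE derive_cst.
by rewrite mul0mx.
Qed.

Lemma energy0 : E (fun=> 0) = 0.
Proof.
rewrite /energy /energy_form.
rewrite (@eq_Rintegral _ _ _ _ _ (fun=> 0)); first by rewrite Rintegral_cst ?mul0r//; exact: (mw0 S).
move=> x /set_mem w0x; rewrite displacement0//.
by rewrite -(scale0r 0) dotZl mul0r.
Qed.

Lemma dual_energy_ge0 : (0 <= dual_energy)%E.
Proof.
apply: ereal_sup_ubound; exists (fun=> 0); first exact: C1_cst.
by rewrite C1_dual0 energy0 subrr.
Qed.

Lemma energy_addZ a f g : C1 w1 f -> C1 w1 g ->
  E (fun x => a * g x + f x) = E f + a * B f g + a ^+ 2 * E g.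
Proof.
move=> C1f C1g; have C1h := C1_lin a C1g C1f.
set h := fun x => _ in C1h *.
have e1 : B h h = a * B g h + B f h := energy_form_linl S a C1g C1f C1h.
have e2 : B h g = a * B g g + B f g := energy_form_linl S a C1g C1f C1g.
have e3 : B h f = a * B g f + B f f := energy_form_linl S a C1g C1f C1f.
have s1 : B g h = B h g := energy_formC S _ _.
have s2 : B f h = B h f := energy_formC S _ _.
have s3 : B g f = B f g := energy_formC S _ _.
exact: (quadratic_expand e1 (etrans s1 e2) (etrans s2 e3) s3).
Qed.

(** Near-maximizers of Phi - E satisfy the Euler-Lagrange equation
    approximately: otherwise a step in direction g would exceed the supremum. *)
Lemma near_euler_lagrange f g (s eta : R) : 0 < eta -> C1 w1 f -> C1 w1 g ->
  dual_energy = s%:E -> s - eta ^+ 2 <= Phi f - E f ->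
  `|Phi g - B f g| <= eta * (1 + E g).
Proof.
move=> eta0 C1f C1g sE sf.
have step a : a * (Phi g - B f g) <= eta ^+ 2 + a ^+ 2 * E g.
  have C1h := C1_lin a C1g C1f.
  apply: (ascent_step _ (proj1 dPhi a g f C1g C1f) (energy_addZ a C1f C1g) sf).
  rewrite -lee_fin -sE; apply: ereal_sup_ubound.
  by exists (fun x => a * g x + f x).
move: (step eta) (step (- eta)); rewrite sqrrN.
move: (Phi g) (B f g) (E g) => pg b eg h1 h2.
rewrite -(ler_pM2l eta0) -[X in X * `|_|]gtr0_norm// -normrM ler_norml.
have -> : eta * (eta * (1 + eg)) = eta ^+ 2 + eta ^+ 2 * eg by ring.
by apply/andP; split; lra.
Qed.

(** The approximate Euler-Lagrange equation is tested with f itself, where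
    B f f = 2 E f. *)
Lemma near_energy f (s eta : R) : 0 < eta -> eta <= 1 / 2 -> C1 w1 f ->
  dual_energy = s%:E -> s - eta ^+ 2 <= Phi f - E f ->
  E f <= 2 * s + 2 /\ `|E f - s| <= eta * (2 * s + 4).
Proof.
move=> eta0 eta2 C1f sE sf.
have EL := near_euler_lagrange eta0 C1f C1f sE sf.
have fs : Phi f - E f <= s.
  by rewrite -lee_fin -sE; apply: ereal_sup_ubound; exists f.
have s0 : 0 <= s by rewrite -lee_fin -sE dual_energy_ge0.
have Ef0 := energy_ge0 S f.
have BE : B f f = 2 * E f by rewrite [E f]/(_ / 2) mulrC divfK.
rewrite BE in EL; move: EL fs Ef0 sf; move: (E f) (Phi f) => e p.
rewrite ler_norml => /andP[EL1 EL2] fs Ef0 sf.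
have h1 : eta * (1 + e) <= 1 / 2 * (1 + e) by rewrite ler_pM2r//; lra.
have hE : e <= 2 * s + 2 by lra.
have h2 : eta * (1 + e) <= eta * (2 * s + 3) by rewrite ler_pM2l//; lra.
have h3 : eta ^+ 2 <= eta * 1 by rewrite expr2 ler_pM2l//; lra.
by split => //; rewrite ler_norml; apply/andP; split; lra.
Qed.

End dual.

End recovery.

Section subderivative.
Context (R : realType) (d : nat) (w0 w1 : set 'rV[R]_d)
  (c : 'rV[R]_d -> 'rV[R]_d -> R)
  (u0 ub : {finite_measure set (borel R d) -> \bar R})
  (phib : 'rV[R]_d -> R) (Tb : 'rV[R]_d -> 'rV[R]_d) (eps gamma : R).
Context (S : regular_transport w0 w1 c u0 ub phib Tb eps gamma).
Local Notation gap := (gap c phib Tb).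
Local Notation mass := (mass w0 u0).
Local Notation ub' := (Pi w1 (charge_of_finite_measure ub)).
Local Notation gradf f x := (gradc w1 f (Tb x)).
Local Notation v := (displacement w1 c phib Tb).
Local Notation B := (energy_form w0 w1 c u0 phib Tb).
Local Notation E := (energy w0 w1 c u0 phib Tb).

(** The quadratic part of the gap at the displacement t v is t^2 / 2 times the
    integrand of the energy form. *)
Lemma gap_displacement_le e : 0 < e -> exists2 r, 0 < r &
  forall f t x, C1 w1 f -> w0 x -> `|t *: v f x| < r ->
    gap x (Tb x + t *: v f x) <=
    t ^+ 2 / 2 * dot (v f x) (gradf f x) + e * t ^+ 2 * enorm (v f x) ^+ 2.
Proof.
move=> e0; have [r r0 ex] := gap_expansion S e0.
exists r => // f t x C1f w0x tr; have [_] := ex x _ w0x tr.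
rewrite -scalemxAl !(dotZl, dotZr) (dot_displacement S w0x C1f).
rewrite ler_norml => /andP[_].
have h : e * `|t *: v f x| ^+ 2 <= e * t ^+ 2 * enorm (v f x) ^+ 2.
  rewrite -mulrA ler_pM2l// normrZ exprMn real_normK ?num_real//.
  apply: ler_wpM2l; first exact: sqr_ge0.
  by rewrite ler_sqr ?nnegrE ?enorm_ge0// norm_le_enorm.
set g := gap _ _; set q := dot _ _; lra.
Qed.

Lemma integral_gap_le e : 0 < e -> exists2 r, 0 < r &
  forall f t M, C1 w1 f -> 0 < t -> (forall x, w0 x -> `|v f x| <= M) -> t * M < r ->
    bounded_mfun (w0 : set (borel R d)) (fun x => gap x (Tb x + t *: v f x)) ->
    \int[u0]_(x in w0) gap x (Tb x + t *: v f x) <=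
    t ^+ 2 * (E f * (1 + 2 * e / gamma)).
Proof.
move=> e0; have [r r0 hg] := gap_displacement_le e0; exists r => //.
move=> f t M C1f t0 vM tM bg.
have fm := fin_u0 (u0 := u0) S; have mw := mw0 S.
have [bv hv] := sqr_displacement_le S C1f.
have be := bmf_energy S C1f C1f.
apply: (@le_trans _ _ (\int[u0]_(x in w0) (t ^+ 2 / 2 * dot (v f x) (gradf f x) +
    e * t ^+ 2 * enorm (v f x) ^+ 2))).
  apply: le_Rint => //; first by apply: bmfD; exact: bmfZ.
  move=> x w0x; apply: hg => //; apply: le_lt_trans tM.
  by rewrite normrZ gtr0_norm// ler_pM2l// vM.
rewrite RintD//; [|exact: bmfZ|exact: bmfZ].
rewrite RintZ// [X in _ + X]RintZ//.
have -> : \int[u0]_(x in w0) dot (v f x) (gradf f x) = 2 * E f.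
  by rewrite [E f]/(_ / 2) mulrC divfK.
move: hv; set I := Rintegral _ _ _; move: (E f) => Ef hv.
have g0 := rt_gamma S.
have h : e * t ^+ 2 * I <= e * t ^+ 2 * (2 / gamma * Ef).
  by rewrite ler_pM2l// mulr_gt0// exprn_gt0.
have -> : t ^+ 2 * (Ef * (1 + 2 * e / gamma)) =
  t ^+ 2 / 2 * (2 * Ef) + e * t ^+ 2 * (2 / gamma * Ef) by field; rewrite gt_eqF.
by rewrite lerD2l.
Qed.

(** The derivative of the integrals of g along the displacements is B f g. *)
Lemma push_test_function g e : C1 w1 g -> 0 < e -> exists2 r, 0 < r &
  forall f t M, C1 w1 f -> 0 < t -> (forall x, w0 x -> `|v f x| <= M) -> t * M < r ->
    bounded_mfun (w0 : set (borel R d)) (fun x => g (Tb x + t *: v f x)) ->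
    `|t^-1 * (\int[u0]_(x in w0) g (Tb x + t *: v f x) -
       \int[u0]_(x in w0) g (Tb x)) - B f g| <= e * (mass + 2 / gamma * E f).
Proof.
move=> C1g e0.
have Kw : Tb @` w0 `<=` w1° by move=> _ [x w0x <-]; exact: (Tb_interior S w0x).
have [r r0 ex] := taylor1_compact (rt_w1 S) C1g (compact_Tb_image S) Kw e0.
exists r => // f t M C1f t0 vM tM bg.
have fm := fin_u0 (u0 := u0) S; have mw := mw0 S.
have [bv hv] := sqr_displacement_le S C1f.
have be := bmf_energy S C1f C1g.
have [cg _ _] := C1g.
have bT : bounded_mfun (w0 : set (borel R d)) (fun x => g (Tb x)).
  exact: (bmf_w0 S (continuous_comp_Tb S cg)).
have tn0 : t != 0 by rewrite gt_eqF.
rewrite -RintB// -RintZ//; last exact: bmfB.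
rewrite -RintB//; last exact/bmfZ/bmfB.
rewrite (le_trans (le_normr_Rintegral _ _))//.
  by apply: bmf_integrable => //; apply: bmfB => //; apply: bmfZ; exact: bmfB.
apply: (@le_trans _ _ (\int[u0]_(x in w0) (e * (1 + enorm (v f x) ^+ 2)))).
  apply: le_Rint => //.
  - have [mf [N fN]] : bounded_mfun (w0 : set (borel R d)) (fun x =>
        t^-1 * (g (Tb x + t *: v f x) - g (Tb x)) - dot (v f x) (gradf g x)).
      by apply: bmfB => //; apply: bmfZ; exact: bmfB.
    split; first exact: measurableT_comp.
    by exists N => x w0x; rewrite normr_id; exact: fN.
  - by apply: bmfZ; apply: bmfD => //; exact: bmf_cst.
  move=> x w0x.
  have tr : `|t *: v f x| < r.
    by apply: le_lt_trans tM; rewrite normrZ gtr0_norm// ler_pM2l// vM.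
  have := ex _ _ (ex_intro2 _ _ x w0x erefl) tr.
  rewrite -(gradc_interior (rt_cl S) C1g (Tb_interior S w0x)) dotZr (dotC (gradf g x)).
  rewrite normrZ (gtr0_norm t0) => h.
  rewrite -(ler_pM2l t0) -[X in X * `|_|](gtr0_norm t0) -normrM mulrBr mulVKf//.
  apply: (le_trans h); rewrite mulrCA ler_pM2l// ler_pM2l//.
  apply: (le_trans (norm_le_enorm _)).
  by have := sqr_ge0 (enorm (v f x) - 1 / 2); rewrite sqrrB; lra.
rewrite RintZ//; last by apply: bmfD => //; exact: bmf_cst.
rewrite ler_pM2l// RintD//; last exact: bmf_cst.
by rewrite Rint_cst// mul1r lerD2l.
Qed.

Lemma C1_dual_quotient (t : R) (h k : ('rV[R]_d -> R) -> R) : 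
  C1_dual w1 h -> C1_dual w1 k -> C1_dual w1 (fun f => t * (h f - k f)).
Proof.
move=> [lh [M hM]] [lk [N kN]]; split=> [a f g C1f C1g|].
  by rewrite lh// lk//; ring.
exists (`|t| * (M + N)) => f C1f; rewrite normrM -mulrA ler_wpM2l//.
by rewrite mulrDl (le_trans (ler_normB _ _))// lerD ?hM ?kN.
Qed.

Lemma ub_C1_dual : C1_dual w1 ub'.
Proof.
have [p pc _] := near_optimal_plan S (@ltr01 R).
exact: (Pi_C1_dual S (m := charge_of_finite_measure ub) pc).
Qed.

Section dual.
Context (Phi : ('rV[R]_d -> R) -> R) (dPhi : C1_dual w1 Phi).
Local Notation sPhi := (dual_energy w0 w1 c u0 phib Tb Phi).

(** The first function is 0, with displacement 0, which makes it admissible at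
    every scale t; this starts the diagonal choice. *)
Lemma near_maximizers (s : R) : sPhi = s%:E ->
  exists (F : nat -> 'rV[R]_d -> R) (M : nat -> R),
  [/\ forall n, C1 w1 (F n), M 0%N = 0,
      forall n x, w0 x -> `|v (F n) x| <= M n &
      forall n, s - n.+2%:R^-1 ^+ 2 <= Phi (F n.+1) - E (F n.+1)].
Proof.
move=> sE.
have /choice[F0 F0P] : forall n : nat, exists f, C1 w1 f /\
    s - n.+2%:R^-1 ^+ 2 <= Phi f - E f.
  move=> n; have n0 : 0 < n.+2%:R^-1 ^+ 2 :> R by rewrite exprn_gt0// invr_gt0.
  have sf : sPhi \is a fin_num by rewrite sE.
  have [_ [f C1f <-]] := ub_ereal_sup_adherent n0 sf.
  rewrite -/(dual_energy w0 w1 c u0 phib Tb Phi) sE -EFinB lte_fin => h.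
  by exists f; split => //; exact: ltW.
pose F n := if n is n'.+1 then F0 n' else fun=> 0.
have C1F n : C1 w1 (F n).
  by case: n => [|n] /=; [exact: C1_cst|case: (F0P n)].
have /choice[M0 M0P] : forall n, exists M, forall x, w0 x -> `|v (F n) x| <= M.
  by move=> n; have [M _ hM] := displacement_bounded S (C1F n); exists M.
exists F, (fun n => if n is 0%N then 0 else M0 n); split => //.
- case=> [|n] x w0x; last exact: M0P.
  by rewrite (displacement0 S w0x) normr0.
- by move=> n; case: (F0P n).
Qed.

End dual.
End subderivative.

Lemma near_invS_lt (R : realType) (e : R) (n : nat -> nat) : 0 < e ->
  (forall N, \forall k \near \oo, (N <= n k)%N) ->
  \forall k \near \oo, (n k).+1%:R^-1 < e.
Proof.
move=> e0 nN; apply: filterS (nN (Num.truncn e^-1)) => k kN.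
rewrite -[ltRHS]invrK ltf_pV2 ?posrE ?invr_gt0//.
by apply: (lt_le_trans (truncnS_gt _)); rewrite ler_nat.
Qed.

Lemma quarters_le (R : realFieldType) (x y z e : R) :
  x - y <= e / 4 -> z <= e / 4 -> x + z <= y + e / 2.
Proof. lra. Qed.

Section subderivative_formula.
Context (R : realType) (d : nat) (w0 w1 : set 'rV[R]_d)
  (c : 'rV[R]_d -> 'rV[R]_d -> R)
  (u0 ub : {finite_measure set (borel R d) -> \bar R})
  (phib : 'rV[R]_d -> R) (Tb : 'rV[R]_d -> 'rV[R]_d) (eps gamma : R).
Context (S : regular_transport w0 w1 c u0 ub phib Tb eps gamma).
Local Notation mass := (mass w0 u0).
Local Notation W := (w0 `*` w1 : set (borel R d * borel R d)).
Local Notation D := (transport_dual w0 w1 c u0).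
Local Notation ub' := (Pi w1 (charge_of_finite_measure ub)).
Local Notation v := (displacement w1 c phib Tb).
Local Notation B := (energy_form w0 w1 c u0 phib Tb).
Local Notation E := (energy w0 w1 c u0 phib Tb).
Context (Phi : ('rV[R]_d -> R) -> R) (dPhi : C1_dual w1 Phi).
Local Notation sPhi := (dual_energy w0 w1 c u0 phib Tb Phi).
Local Notation quotient t hk := (second_quotient D ub' phib t hk).

(** The masses at T x are moved along the displacement fields of a maximizing
    sequence of the dual problem, so slowly in n that the Taylor expansions at
    the points T x are valid at scale t_k. *)
Lemma recovery_sequence (s : R) (t : nat -> R) : sPhi = s%:E -> null_seq t ->
  exists2 hk, dual_seq w1 hk Phi &
    forall e, 0 < e -> \forall k \near \oo, (quotient (t k) (hk k) <= (2 * s + e)%:E)%E.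
Proof.
move=> sE [tp t0].
have [F [M [C1F M0 vM Fs]]] := near_maximizers S sE.
have [r0 r00 nT] := near_Tb S.
have w1r x z : w0 x -> `|z| < r0 -> w1 (Tb x + z).
  by move=> w0x zr; apply: interior_subset; apply: (rt_nbhd S); exact: nT.
pose P k n := t k * M n < Num.min r0 (n.+1%:R^-1).
have P0 k : P k 0%N by rewrite /P M0 mulr0 lt_min r00 invr_gt0/=.
have PN n : \forall k \near \oo, P k n.
  have m0 : 0 < Num.min r0 (n.+1%:R^-1) / (`|M n| + 1).
    by rewrite divr_gt0 ?ltr_wpDl// lt_min r00 invr_gt0/=.
  move/cvgrPdist_lt : t0 => /(_ _ m0); apply: filterS => k.
  rewrite sub0r normrN gtr0_norm// ltr_pdivlMr ?ltr_wpDl// => h.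
  rewrite /P; apply: le_lt_trans h; rewrite ler_pM2l//.
  by rewrite (le_trans (ler_norm _))// lerDl.
have [n [Pn nN]] := diagonal_choice P0 PN.
have tM k : t k * M (n k) < r0 by have := Pn k; rewrite /P lt_min => /andP[].
have tM0 e : 0 < e -> \forall k \near \oo, t k * M (n k) < e.
  move=> e0; apply: filterS (near_invS_lt e0 nN) => k.
  by apply: lt_trans; have := Pn k; rewrite /P lt_min => /andP[].
have /choice[mp mpP] : forall k, exists mp : {charge set (borel R d) -> \bar R} *
    {measure set (borel R d * borel R d) -> \bar R},
    [/\ carried_by w1 mp.1, coupling w0 w1 u0 mp.1 mp.2 &
    forall G : 'rV[R]_d * 'rV[R]_d -> R, bounded_mfun W G ->
      bounded_mfun (w0 : set (borel R d)) (fun x => G (x, Tb x + t k *: v (F (n k)) x)) /\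
      \int[mp.2]_(z in W) G z = \int[u0]_(x in w0) G (x, Tb x + t k *: v (F (n k)) x)].
  move=> k; have [m [p mpP]] := push_plan S (C1F (n k)) (tp k) (vM (n k)) (tM k) w1r.
  by exists (m, p).
pose hk k := fun g => (t k)^-1 * (Pi w1 (mp k).1 g - ub' g).
have hkE k g : C1 w1 g ->
    bounded_mfun (w0 : set (borel R d)) (fun x => g (Tb x + t k *: v (F (n k)) x)) /\
    hk k g = (t k)^-1 * (\int[u0]_(x in w0) g (Tb x + t k *: v (F (n k)) x) -
      \int[u0]_(x in w0) g (Tb x)).
  move=> [cg _ _]; have [_ pc GP] := mpP k.
  have [bg gE] := Pi_plan S pc cg.
  have [b1 b2] := GP _ bg; split => //.
  by rewrite /hk gE b2 (Pi_ub S) (image_integral S cg).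
have s0 : 0 <= s by rewrite -lee_fin -sE (dual_energy_ge0 S dPhi).
have g0 := rt_gamma S; have m0 := mass_ge0 w0 u0.
have near1 : \forall k \near \oo, (1 <= n k)%N := nN 1%N.
have nearE k : (1 <= n k)%N -> [/\ 0 < (n k).+1%:R^-1 :> R, (n k).+1%:R^-1 <= 1 / 2 :> R
    & s - (n k).+1%:R^-1 ^+ 2 <= Phi (F (n k)) - E (F (n k))].
  case: (n k) => // n' _; split; [by rewrite invr_gt0| |exact: Fs].
  by rewrite div1r lef_pV2 ?posrE// ler_nat.
exists hk.
  split=> [k|g C1g].
    have [_ pc _] := mpP k.
    by apply: C1_dual_quotient; [exact: (Pi_C1_dual S pc)|exact: (ub_C1_dual S)].
  apply/cvgrPdist_le => /= delta delta0.
  pose K := mass + 2 / gamma * (2 * s + 2).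
  have K0 : 0 <= K.
    rewrite addr_ge0// mulr_ge0 ?divr_ge0 ?(ltW g0)//.
    by rewrite addr_ge0// mulr_ge0.
  have e0 : 0 < delta / 2 / (K + 1) by rewrite !divr_gt0// ltr_wpDl.
  have Eg0 := energy_ge0 S g.
  have e1 : 0 < delta / 2 / (1 + E g) by rewrite !divr_gt0// ltr_wpDr.
  have near2 := near_invS_lt e1 nN.
  have [r r0' hr] := push_test_function S C1g e0.
  apply: filterS3 near1 near2 (tM0 _ r0') => k n1 n2 n3.
  have [eta0 eta2 Fk] := nearE k n1.
  have [bg ->] := hkE k g C1g.
  have := hr _ _ _ (C1F (n k)) (tp k) (vM (n k)) n3 bg.
  move=> h1.
  have h2 := near_euler_lagrange S dPhi eta0 (C1F (n k)) C1g sE Fk.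
  have [h3 _] := near_energy S dPhi eta0 eta2 (C1F (n k)) sE Fk.
  move: h1 h2 h3; move: (B (F (n k)) g) (E (F (n k))) => b e h1 h2 h3.
  have h4 : delta / 2 / (K + 1) * (mass + 2 / gamma * e) <= delta / 2.
    apply: (@le_trans _ _ (delta / 2 / (K + 1) * (K + 1))); last first.
      by rewrite divfK// gt_eqF// ltr_wpDl.
    rewrite ler_pM2l// /K -addrA lerD2l.
    apply: (@le_trans _ _ (2 / gamma * (2 * s + 2))); last by rewrite lerDl.
    by rewrite ler_pM2l// divr_gt0.
  have h5 : (n k).+1%:R^-1 * (1 + E g) <= delta / 2.
    by move: n2; rewrite ltr_pdivlMr ?ltr_wpDr// => /ltW.
  rewrite (le_trans (ler_distD b _ _))// (distrC b) (splitr delta) lerD//.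
    exact: le_trans h2 h5.
  exact: le_trans h1 h4.
move=> e e0.
pose L := 2 * s + 4 + (2 * s + 2).
have L0 : 0 < L by rewrite /L; lra.
pose e' := e * gamma / (8 * L).
have e'0 : 0 < e' by rewrite divr_gt0 ?mulr_gt0.
have [r r0' hr] := integral_gap_le S e'0.
have e2 : 0 < e / 4 / L by rewrite !divr_gt0.
apply: filterS3 near1 (near_invS_lt e2 nN) (tM0 _ r0') => k n1 n2 n3.
have [eta0 eta2 Fk] := nearE k n1.
have [cm pc GP] := mpP k.
have [bG GE] := GP _ (bmf_gap S).
have tk0 := tp k.
have eqm : dual_eq w1 (fun f => ub' f + t k * hk k f) (Pi w1 (mp k).1).
  by move=> f _; rewrite /hk mulVKf ?gt_eqF// addrC subrK.
apply: (le_trans (second_quotient_le S tk0 cm eqm pc)).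
have t2 : 0 < t k ^+ 2 / 2 by rewrite divr_gt0// exprn_gt0.
rewrite lee_fin ler_pdivrMr// GE.
apply: (le_trans (hr _ _ _ (C1F (n k)) tk0 (vM (n k)) n3 bG)).
have [h3 h4] := near_energy S dPhi eta0 eta2 (C1F (n k)) sE Fk.
have Ef0 := energy_ge0 S (F (n k)).
move: h3 h4 Ef0; move: (E (F (n k))) => ef h3 h4 Ef0.
have -> : (2 * s + e) * (t k ^+ 2 / 2) = t k ^+ 2 * (s + e / 2) by field.
rewrite ler_pM2l ?exprn_gt0// mulrDr mulr1.
have h5 : (n k).+1%:R^-1 * (2 * s + 4) <= e / 4.
  apply: (@le_trans _ _ ((n k).+1%:R^-1 * L)); last first.
    by move: n2; rewrite ltr_pdivlMr// => /ltW.
  by rewrite ler_pM2l// /L; lra.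
have h6 : ef * (2 * e' / gamma) <= e / 4.
  have -> : ef * (2 * e' / gamma) = ef * (e / 4 / L).
    by rewrite /e'; field; rewrite !gt_eqF.
  apply: (@le_trans _ _ (L * (e / 4 / L))); last by rewrite mulrC divfK// gt_eqF.
  by rewrite ler_pM2r// /L; lra.
have h7 : ef - s <= e / 4 by apply: le_trans h5; apply: le_trans (ler_norm _) h4.
exact: quarters_le h7 h6.
Qed.

(** * The second subderivative *)

Lemma le_second_subderivative_seq (t : nat -> R) hk a : null_seq t ->
  dual_seq w1 hk Phi -> (a%:E < sPhi)%E ->
  \forall k \near \oo, ((2 * a)%:E <= quotient (t k) (hk k))%E.
Proof.
move=> t0 hPhi /ereal_sup_gt[_ [f C1f <-]]; rewrite lte_fin => af.
by apply: (near_second_quotient S t0 hPhi C1f); rewrite ltr_pM2l.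
Qed.

Lemma le_dual_energy_subderivative (t : nat -> R) hk : null_seq t ->
  dual_seq w1 hk Phi ->
  (2%:E * sPhi <= limn_einf (fun k => quotient (t k) (hk k)))%E.
Proof.
move=> t0 hPhi.
have h a : (a%:E < sPhi)%E -> ((2 * a)%:E <= limn_einf (fun k => quotient (t k) (hk k)))%E.
  by move=> asP; apply: le_limn_einf; exact: le_second_subderivative_seq.
have s0 := dual_energy_ge0 S dPhi.
case: sPhi h s0 => [s| |]; rewrite ?leeNy_eq// => h _.
- rewrite -EFinM; case: (limn_einf _) h => [l| |] h.
  + rewrite lee_fin; apply/ler_addgt0Pr => e e0.
    have : ((s - e / 2)%:E < s%:E)%E by rewrite lte_fin; lra.
    by move=> /h; rewrite lee_fin; lra.
  + by rewrite leey.
  + have : ((s - 1)%:E < s%:E)%E by rewrite lte_fin; lra.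
    by move=> /h; rewrite leeNy_eq.
- case: (limn_einf _) h => [l| |] h; last 2 first.
  + by rewrite leey.
  + by have := h 0 (ltry _); rewrite leeNy_eq.
  have h2 := h (l / 2 + 1) (ltry _); rewrite lee_fin in h2.
  by exfalso; lra.
Qed.

(** When the Legendre transform is infinite at Phi, the lower bound makes the
    quotients of the constant sequence Phi diverge. *)
Lemma recovery_cvg (t : nat -> R) : null_seq t ->
  exists2 hk, dual_seq w1 hk Phi & quotient (t k) (hk k) @[k --> \oo] --> (2%:E * sPhi)%E.
Proof.
move=> t0; have s0 := dual_energy_ge0 S dPhi.
case sE : sPhi => [s| |]; last by rewrite sE leeNy_eq in s0.
- have [hk hP hq] := recovery_sequence sE t0; exists hk => //.
  rewrite -EFinM.
  have lo e : 0 < e -> \forall k \near \oo, ((2 * s - e)%:E <= quotient (t k) (hk k))%E.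
    move=> e0; have : ((s - e / 2)%:E < sPhi)%E by rewrite sE lte_fin; lra.
    move=> /(le_second_subderivative_seq t0 hP); apply: filterS => k.
    by rewrite (_ : 2 * (s - e / 2) = 2 * s - e)//; field.
  apply/fine_cvgP; split.
    apply: filterS2 (lo _ ltr01) (hq _ ltr01) => k h1 h2.
    rewrite fin_numE; apply/andP; split; apply/eqP => h; rewrite h in h1 h2.
      by rewrite leeNy_eq in h1.
    by rewrite leye_eq in h2.
  apply/cvgrPdist_le => e e0.
  apply: filterS2 (lo _ e0) (hq _ e0) => k /=.
  case: (quotient _ _) => [q| |]; rewrite ?lee_fin ?leeNy_eq ?leye_eq//= => h1 h2.
  by rewrite ler_norml; apply/andP; split; lra.
- exists (fun=> Phi); first by split => // f _; exact: cvg_cst.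
  rewrite gt0_muley ?lte_fin//; apply/cvgeyPge => a.
  have hP : dual_seq w1 (fun=> Phi) Phi by split => // f _; exact: cvg_cst.
  have : ((a / 2)%:E < sPhi)%E by rewrite sE ltry.
  move=> /(le_second_subderivative_seq t0 hP); apply: filterS => k.
  by rewrite mulrC divfK.
Qed.

Lemma second_subderivativeE :
  second_subderivative w1 D ub' phib Phi = (2%:E * sPhi)%E.
Proof.
apply/eqP; rewrite eq_le; apply/andP; split; last first.
  apply: le_ereal_inf_tmp => _ [t [hk [t0 hP ->]]].
  exact: le_dual_energy_subderivative.
have t0 : null_seq (fun k => k.+1%:R^-1 : R).
  by split => [k|]; [rewrite invr_gt0|exact: cvg_harmonic].
have [hk hP hq] := recovery_cvg t0.
apply: ereal_inf_lbound; exists (fun k => k.+1%:R^-1), hk; split => //.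
by have [-> _] := cvg_limn_einf_sup hq.
Qed.

End subderivative_formula.

(** * Completeness of L^2 *)

Lemma limn_einf_le (R : realType) (u : nat -> \bar R) (a : \bar R) :
  (\forall k \near \oo, (u k <= a)%E) -> (limn_einf u <= a)%E.
Proof.
move=> [n _ na]; rewrite limn_einf_lim (cvg_lim _ (@cvg_einfs_sup _ u))//.
apply: ge_ereal_sup => _ [k _ <-].
apply: (@le_trans _ _ (u (maxn k n))); last by apply: na; rewrite /= leq_maxr.
by apply: ereal_inf_lbound; exists (maxn k n) => //=; rewrite leq_maxl.
Qed.

Lemma geometric_steps_cvg (R : realType) (u : nat -> R) (K : R) :
  (forall k, 2 ^+ k * `|u k.+1 - u k| <= K) -> cvgn u.
Proof.
move=> uK.
have K0 : 0 <= K by apply: le_trans (uK 0%N); rewrite mulr_ge0.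
have g0 n : 0 <= geometric K 2^-1 n :> R by rewrite mulr_ge0// exprn_ge0// invr_ge0.
have ct : cvgn (series (telescope u)).
  apply: normed_cvg; apply: (@series_le_cvg _ _ (geometric K 2^-1)) => // [n|n|].
  - exact: normr_ge0.
  - rewrite /geometric/= /telescope/= exprVn ler_pdivlMr ?exprn_gt0// mulrC.
    exact: uK.
  - by apply: is_cvg_geometric_series; rewrite ger0_norm ?invr_ge0// invf_lt1// ltr1n.
have -> : u = (fun n => u 0%N + series (telescope u) n).
  by apply/funext => n; exact: eq_sum_telescope.
by apply: is_cvgD => //; exact: is_cvg_cst.
Qed.

Section l2.
Context dT (T : measurableType dT) (R : realType) (mu : {measure set T -> \bar R})
  (D : set T) (mD : measurable D) (f : nat -> T -> R).
Context (mf : forall n, measurable_fun D (f n))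
  (cf : forall n m, (n <= m)%N ->
    (\int[mu]_(x in D) ((f n x - f m x) ^+ 2)%:E <= ((8 ^+ n)^-1)%:E)%E).

Let step k x : R := 4 ^+ k * (f k x - f k.+1 x) ^+ 2.

Let step_ge0 k x : 0 <= step k x.
Proof. by rewrite mulr_ge0 ?sqr_ge0// exprn_ge0. Qed.

Let measurable_step k : measurable_fun D (fun x => (step k x)%:E).
Proof.
apply/measurable_EFinP; apply: measurable_funM; first exact: measurable_cst.
by apply: measurable_funX; exact: measurable_funB.
Qed.

Let geo N : \sum_(0 <= k < N) (2 ^+ k)^-1 = 2 - 2 * (2 ^+ N)^-1 :> R.
Proof.
elim: N => [|N ih]; first by rewrite big_geq// expr0 invr1 mulr1 subrr.
rewrite big_nat_recr//= ih exprS; field.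
by rewrite expf_neq0.
Qed.

(** The weights 4^k leave a summable bound 2^-k for the integrals, so that
    almost everywhere the sum is finite and the steps are O(2^-k). *)
Let finite_steps : exists N0, [/\ measurable N0, mu N0 = 0%E &
  forall x, D x -> ~ N0 x -> exists K, forall k, step k x <= K].
Proof.
pose s N x := (\sum_(0 <= k < N) (step k x)%:E)%E.
pose Sx x := limn (s ^~ x).
have ms N : measurable_fun D (s N).
  by apply: emeasurable_sum => k; exact: measurable_step.
have s0 N x : (0 <= s N x)%E by apply: sume_ge0 => k _; rewrite lee_fin.
have nds x : {homo s ^~ x : a b / (a <= b)%N >-> (a <= b)%E}.
  by move=> a b ab; apply: lee_sum_nneg_natr => // k _ _; rewrite lee_fin.
have mS : measurable_fun D Sx.
  rewrite (_ : Sx = fun x => (\sum_(i <oo | i \in xpredT) (step i x)%:E)%E)//.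
  by apply: ge0_emeasurable_sum => // k x _ _; rewrite lee_fin.
have IS : (\int[mu]_(x in D) Sx x <= 2%:E)%E.
  rewrite (monotone_convergence mu mD ms) => [|n x _|x _ a b ab].
  - apply: lime_le.
      apply: ereal_nondecreasing_is_cvgn => a b ab.
      by apply: ge0_le_integral => // x _; exact: nds.
    apply: nearW => N; rewrite ge0_integral_sum//; last first.
      by move=> k x _; rewrite lee_fin.
    apply: (@le_trans _ _ (\sum_(0 <= k < N) ((2 ^+ k)^-1)%:E)%E).
      apply: lee_sum => k _.
      rewrite /step; under eq_integral do rewrite EFinM.
      rewrite ge0_integralZl//; last 2 first.
      + apply/measurable_EFinP/measurable_funX; exact: measurable_funB.
      + by move=> x _; rewrite lee_fin sqr_ge0.
      have h := cf (leqnSn k).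
      apply: (@le_trans _ _ ((4 ^+ k)%:E * ((8 ^+ k)^-1)%:E)%E).
        by apply: lee_wpmul2l => //; rewrite lee_fin exprn_ge0.
      rewrite -EFinM lee_fin -exprVn -exprMn -exprVn.
      by rewrite (_ : 4 * 8^-1 = 2^-1 :> R)//; field.
    rewrite sumEFin lee_fin geo gerBl mulr_ge0// invr_ge0 exprn_ge0//.
  - exact: s0.
  - exact: nds.
have S0 x : D x -> (0 <= Sx x)%E.
  move=> _; apply: lime_ge; last by apply: nearW => N; exact: s0.
  by apply: ereal_nondecreasing_is_cvgn; exact: nds.
have iS : mu.-integrable D Sx.
  apply/integrableP; split => //.
  rewrite (eq_integral Sx) => [|x /set_mem Dx]; last by rewrite gee0_abs ?S0.
  exact: le_lt_trans IS (ltry _).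
have [N0 [mN0 N00 hN0]] := integrable_ae mD iS.
exists N0; split => // x Dx nN0.
have Sfin : Sx x \is a fin_num.
  apply/negPn/negP => h; apply: nN0; apply: hN0 => /= /(_ Dx) h'.
  by rewrite h' in h.
exists (fine (Sx x)) => k.
rewrite -lee_fin fineK//.
apply: (@le_trans _ _ (s k.+1 x)).
  rewrite /s big_nat_recr//= leeDr//; exact: s0.
rewrite /Sx (cvg_lim _ (ereal_nondecreasing_cvgn (nds x)))//.
by apply: ereal_sup_ubound; exists k.+1.
Qed.

(** The sequence converges almost everywhere, and Fatou's lemma bounds the
    distances to the limit. *)
Lemma L2_complete : exists2 g : T -> R, measurable_fun D g & forall n,
  (\int[mu]_(x in D) ((f n x - g x) ^+ 2)%:E <= ((8 ^+ n)^-1)%:E)%E.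
Proof.
have [N0 [mN0 N00 hN0]] := finite_steps.
have mDN : measurable (D `\` N0) by exact: measurableD.
have fcvg x : (D `\` N0) x -> cvgn (f ^~ x).
  move=> [Dx nx]; have [K hK] := hN0 x Dx nx.
  apply: (@geometric_steps_cvg _ _ (K + 1)) => k.
  have := hK k; rewrite /step (_ : 4 = 2 ^+ 2 :> R); last by ring.
  rewrite -exprM mulnC exprM -exprMn distrC.
  rewrite -[(_ * (f k x - _)) ^+ 2]real_normK ?num_real//.
  rewrite normrM (ger0_norm (exprn_ge0 _ _))//; set a := _ * `|_| => ha.
  have := sqr_ge0 (a - 1 / 2); rewrite sqrrB; lra.
pose h n x := f n x * \1_(~` N0) x.
pose g x := limn (h ^~ x).
have hE n x : ~ N0 x -> h n x = f n x.
  by move=> nx; rewrite /h indicE mem_set// mulr1.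
have h0 n x : N0 x -> h n x = 0.
  by move=> nx; rewrite /h indicE memNset ?mulr0//= => /(_ nx).
have hcvg x : D x -> h ^~ x @ \oo --> g x.
  move=> Dx; have [nx|nx] := pselect (N0 x).
    have -> : h ^~ x = fun=> 0 by apply/funext => n; exact: h0.
    have -> : g x = 0.
      rewrite /g (_ : h ^~ x = fun=> 0); first exact: lim_cst.
      by apply/funext => n; exact: h0.
    exact: cvg_cst.
  have hf : h ^~ x = f ^~ x by apply/funext => n; exact: hE.
  by rewrite /g hf; exact: (fcvg x (conj Dx nx)).
have mg : measurable_fun D g.
  apply: (measurable_fun_cvg (h := h)) => [m|x Dx]; last exact: hcvg.
  apply: measurable_funM => //; apply: measurable_indic; exact: measurableC.
exists g => // n.
have msq m : measurable_fun D (fun x => ((f n x - f m x) ^+ 2)%:E).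
  apply/measurable_EFinP/measurable_funX; exact: measurable_funB.
have mgq : measurable_fun D (fun x => ((f n x - g x) ^+ 2)%:E).
  apply/measurable_EFinP/measurable_funX; exact: measurable_funB.
rewrite (ge0_negligible_integral mN0 mD mgq)//; last by move=> x _; rewrite lee_fin sqr_ge0.
have -> : (\int[mu]_(x in D `\` N0) ((f n x - g x) ^+ 2)%:E =
    \int[mu]_(x in D `\` N0) limn_einf (fun m => ((f n x - f m x) ^+ 2)%:E))%E.
  apply: eq_integral => x /set_mem [Dx nx].
  have cx : f ^~ x @ \oo --> g x.
    have := hcvg x Dx; rewrite (_ : h ^~ x = f ^~ x)//.
    by apply/funext => m; exact: hE.
  have : ((f n x - f m x) ^+ 2)%:E @[m --> \oo] --> ((f n x - g x) ^+ 2)%:E.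
    apply: cvg_EFin; first exact: nearW.
    rewrite [X in X @ _](_ : _ = fun m => (f n x - f m x) * (f n x - f m x)); last first.
      by apply/funext => m; rewrite /= expr2.
    by rewrite expr2; apply: cvgM; apply: cvgB => //; exact: cvg_cst.
  by move/cvg_limn_einf_sup => [-> _].
apply: (le_trans (fatou mu mDN _ _)) => [m|m x _|].
- by apply: measurable_funS (msq m) => // x [].
- by rewrite lee_fin sqr_ge0.
apply: limn_einf_le; exists n => // m /= nm.
apply: le_trans (cf nm); apply: ge0_subset_integral => // x _.
by rewrite lee_fin sqr_ge0.
Qed.

End l2.

(** * Disintegration along the optimal map *)

Section probability_family.
Context d1 d2 (X : measurableType d1) (Y : measurableType d2) (R : realType)
  (D : set X) (P : X -> probability Y R).

(** The family P is measurable on D only; the zero measure outside D makes it a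
    kernel on X. *)
Definition restricted_kernel (mD : measurable D)
    (mP : forall B, measurable B -> measurable_fun D (fun x => P x B)) (x : X) :
    {measure set Y -> \bar R} :=
  if x \in D then P x : {measure set Y -> \bar R} else mzero.

Context (mD : measurable D)
  (mP : forall B, measurable B -> measurable_fun D (fun x => P x B)).

Let restricted_kernelE B :
  (fun x => restricted_kernel mD mP x B) = (fun x => P x B) \_ D.
Proof. by apply/funext => x; rewrite patchE /restricted_kernel; case: ifP. Qed.

Let measurable_restricted_kernel B : measurable B ->
  measurable_fun setT (restricted_kernel mD mP ^~ B).
Proof. by move=> mB; rewrite restricted_kernelE; apply/(measurable_restrictT _ mD); exact: mP. Qed.

HB.instance Definition _ := isKernel.Build _ _ X Y R
  (restricted_kernel mD mP) measurable_restricted_kernel.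

Let restricted_kernel_uub : measure_fam_uub (restricted_kernel mD mP).
Proof.
exists 2 => x; rewrite /restricted_kernel; case: ifP => _.
  by rewrite [X in (X < _)%E](@probability_setT _ _ _ (P x)) lte_fin ltr1n.
by rewrite /mzero lte_fin.
Qed.

HB.instance Definition _ := Kernel_isFinite.Build _ _ X Y R
  (restricted_kernel mD mP) restricted_kernel_uub.

Lemma measurable_fun_probability_integral (k : X * Y -> \bar R) :
  (forall z, 0 <= k z)%E -> measurable_fun setT k ->
  measurable_fun D (fun x => \int[P x]_y k (x, y))%E.
Proof.
move=> k0 mk.
have := measurable_fun_integral_finite_kernel k (restricted_kernel mD mP) k0 mk.
move=> /(measurable_funS measurableT (@subsetT _ D)).
apply: eq_measurable_fun => x xD /=.
by rewrite /restricted_kernel xD.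
Qed.

(** A bounded function is the difference of two nonnegative ones. *)
Lemma measurable_fun_section_integral (G : set (X * Y)) (E : set Y) (b : Y -> R) :
  measurable G -> measurable E -> (forall x y, G (x, y) -> E y) ->
  bounded_mfun E b ->
  measurable_fun D (fun x => \int[P x]_(y in [set y | G (x, y)]) b y).
Proof.
move=> mG mE GE bb.
have mGx x : measurable [set y | G (x, y)].
  have -> : [set y | G (x, y)] = xsection G x.
    by apply/seteqP; split => y; rewrite /xsection/= ?inE.
  exact: measurable_xsection.
have nonneg b' : (forall y, E y -> 0 <= b' y) -> bounded_mfun E b' ->
    measurable_fun D (fun x => \int[P x]_(y in [set y | G (x, y)]) b' y).
  move=> b0 [mb _].
  pose k z := ((b' \_ E) z.2 * \1_G z)%:E.
  have k0 z : (0 <= k z)%E.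
    rewrite lee_fin mulr_ge0// patchE; case: ifP => // /set_mem; exact: b0.
  have mk : measurable_fun setT k.
    apply/measurable_EFinP; apply: measurable_funM; last exact: measurable_indic.
    apply: (measurableT_comp (f := b' \_ E)) => //.
    exact/(measurable_restrictT _ mE).
  have := measurableT_comp (@fine_measurable R _ measurableT)
    (measurable_fun_probability_integral k0 mk).
  apply: eq_measurable_fun => x _ /=; congr fine.
  rewrite [RHS]integral_mkcond; apply: eq_integral => y _.
  rewrite /k indicE [RHS]patchE; case: (boolP (y \in _)) => [/set_mem/= Gxy|/negP nG].
    by rewrite (mem_set Gxy) mulr1 patchE mem_set//; exact: GE Gxy.
  by rewrite memNset ?mulr0// => Gxy; apply: nG; rewrite inE.
have [mb [C bC]] := bb.
have fin x : (P x [set y | G (x, y)] < +oo)%E.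
  by rewrite -ge0_fin_numE// fin_num_measure.
apply: (@eq_measurable_fun _ _ _ _ _ (fun x =>
  \int[P x]_(y in [set y | G (x, y)]) (b y + `|C|) -
  \int[P x]_(y in [set y | G (x, y)]) `|C|)).
  move=> x _; have bx : bounded_mfun [set y | G (x, y)] b.
    split; first by apply: measurable_funS mb => // y; exact: GE.
    by exists C => y /GE; exact: bC.
  rewrite RintD ?addrK//.
  - exact: fin.
  - exact: bmf_cst.
apply: measurable_funB; apply: nonneg => //.
- move=> y Ey; have := bC y Ey; rewrite ler_norml => /andP[h _].
  by rewrite -lerBlDr sub0r (le_trans _ h)// lerN2 ler_norm.
- by apply: bmfD => //; exact: bmf_cst.
- exact: bmf_cst.
Qed.

End probability_family.

Lemma measurable_dot_mulmx d (T : measurableType d) (R : realType) (D : set T) n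
    (p q : T -> 'rV[R]_n) (A : T -> 'M[R]_n) :
  (forall i, measurable_fun D (fun y => p y ord0 i)) ->
  (forall i, measurable_fun D (fun y => q y ord0 i)) ->
  (forall i j, measurable_fun D (fun y => A y i j)) ->
  measurable_fun D (fun y => dot (p y *m A y) (q y)).
Proof.
move=> mp mq mA; under eq_fun do rewrite dot_mulmx.
apply: measurable_sum => i; apply: measurable_sum => j.
by apply: measurable_funM => //; exact: measurable_funM.
Qed.

Section mobility.
Context (R : realType) (d : nat) (w0 w1 : set 'rV[R]_d)
  (c : 'rV[R]_d -> 'rV[R]_d -> R)
  (u0 ub : {finite_measure set (borel R d) -> \bar R})
  (phib : 'rV[R]_d -> R) (Tb : 'rV[R]_d -> 'rV[R]_d) (eps gamma : R).
Context (S : regular_transport w0 w1 c u0 ub phib Tb eps gamma).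
Context (uh : 'rV[R]_d -> probability (borel R d) R)
  (uhP : disintegration w0 w1 u0 ub Tb uh).
Local Notation A := (gap_hess c phib Tb).
Local Notation v := (displacement w1 c phib Tb).
Local Notation B := (energy_form w0 w1 c u0 phib Tb).
Local Notation fiber y := (w0 `&` Tb @^-1` [set y] : set (borel R d)).

(** The inverse of the matrix H of the disintegration, see HmatE. *)
Definition fiber_mean (y : 'rV[R]_d) : 'M[R]_d :=
  \matrix_(i < d, j < d) \int[uh y]_(x in fiber y) invmx (A x) i j.

Lemma HmatE y : Hmat w0 c phib Tb uh y = invmx (fiber_mean y).
Proof.
rewrite /Hmat; apply: (congr1 invmx); apply/matrixP => i j.
rewrite [LHS]mxE [RHS]mxE.
by apply: eq_Rintegral => x /set_mem[_ /= <-].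
Qed.

Let G : set (borel R d * borel R d) := [set z | fiber z.1 z.2].

Let mG : measurable G.
Proof.
have -> : G = (fun x => (Tb x, x)) @` w0.
  by apply/seteqP; split => [[y x] [/= w0x <-]|_ [x w0x <-]//]; exists x.
apply: closed_borel2; apply: compact_closed; first exact: norm_hausdorff.
apply: continuous_compact (rt_w0 S).
apply/within_continuousP => x w0x e e0.
have /within_continuousP/(_ x w0x e e0)[r r0 xr] := continuous_Tb S.
exists (Num.min r e); first by rewrite lt_min r0.
move=> y w0y; rewrite lt_min => /andP[xy1 xy2].
by rewrite prod_normE/= gt_max xy2 xr.
Qed.

Let mfiber y : measurable (fiber y).
Proof.
have -> : fiber y = xsection G y.
  by apply/seteqP; split => x; rewrite /xsection/= inE.
exact: measurable_xsection.
Qed.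

Let fin_fiber y : (uh y (fiber y) < +oo)%E.
Proof. by rewrite -ge0_fin_numE// fin_num_measure. Qed.

Let bmf_fiber (b : 'rV[R]_d -> R) y : bounded_mfun (w0 : set (borel R d)) b -> bounded_mfun (fiber y) b.
Proof.
move=> [mb [C bC]]; split; last by exists C => x [/bC].
by apply: measurable_funS mb; [exact: (mw0 S)|move=> x []].
Qed.

Lemma measurable_fiber_integral (b : 'rV[R]_d -> R) : bounded_mfun (w0 : set (borel R d)) b ->
  measurable_fun (w1 : set (borel R d)) (fun y => \int[uh y]_(x in fiber y) b x).
Proof.
have [_ muh _ _] := uhP.
apply: (@measurable_fun_section_integral _ _ (borel R d) (borel R d) R w1 uh
  (mw1 S) muh G w0) => //; first exact: (mw0 S).
by move=> y x [].
Qed.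

Lemma fiber_full_ae : exists X : set (borel R d), [/\ measurable X, ub X = 0%E &
  forall y, w1 y -> ~ X y -> uh y (fiber y) = 1%E].
Proof.
have [uh1 _ [X [mX X0 hX]] _] := uhP.
exists X; split => // y w1y nX.
have h : uh y (w0 `\` Tb @^-1` [set y]) = 0%E.
  by apply: contrapT => h; apply: nX; apply: hX => /= /(_ w1y).
rewrite -(uh1 y w1y) (measureDI (uh y) (mw0 S) (mfiber y)).
have -> : w0 `\` fiber y = w0 `\` Tb @^-1` [set y].
  by rewrite setDIr setDv set0U.
by rewrite [X in _ = (X + _)%E]h add0e setIA setIid.
Qed.

Let bmf_inv i j : bounded_mfun (w0 : set (borel R d)) (fun x => invmx (A x) i j).
Proof. by apply: (bmf_w0 S); exact: (continuous_gap_hess_inv S). Qed.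

(** The mean acts on vectors entrywise, hence forms commute with it. *)
Lemma dot_fiber_mean y p q :
  bounded_mfun (fiber y) (fun x => dot (p *m invmx (A x)) q) /\
  dot (p *m fiber_mean y) q = \int[uh y]_(x in fiber y) dot (p *m invmx (A x)) q.
Proof.
have fm := fin_fiber y; have mf := mfiber y.
have b1 i j : bounded_mfun (fiber y) (fun x => q ord0 i * (p ord0 j * invmx (A x) j i)).
  by do 2 apply: bmfZ; exact: bmf_fiber.
have E x : dot (p *m invmx (A x)) q =
    \sum_i \sum_j q ord0 i * (p ord0 j * invmx (A x) j i).
  by rewrite dot_mulmx; do 2 apply: eq_bigr => ? _; rewrite mulrC.
split.
  apply: (@eq_bmf _ (borel R d) R (fiber y) (fun x =>
    \sum_i \sum_j q ord0 i * (p ord0 j * invmx (A x) j i))) => [x _|]; first by rewrite E.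
  by apply: bmf_sum => i; exact: bmf_sum.
under eq_Rintegral do rewrite E.
rewrite Rint_sum//; last by move=> i; exact: bmf_sum.
rewrite dot_mulmx; apply: eq_bigr => i _; rewrite Rint_sum//; apply: eq_bigr => j _.
rewrite RintZ//; last by apply: bmfZ; exact: bmf_fiber.
by rewrite RintZ ?mxE 1?mulrC//; exact: bmf_fiber.
Qed.

Lemma fiber_mean_posdef : exists2 k, 0 < k &
  forall y, w1 y -> uh y (fiber y) = 1%E -> posdef k (fiber_mean y).
Proof.
have g0 := rt_gamma S.
have [C C0 hC] := gap_hess_bounded S.
exists (gamma / C ^+ 2); first by rewrite divr_gt0// exprn_gt0.
move=> y w1y uy1; split.
  apply/matrixP => i j; rewrite !mxE; apply: eq_Rintegral => x /set_mem[w0x _].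
  by rewrite -[in LHS](invmx_sym (gap_hess_posdef S w0x)) mxE.
have fm := fin_fiber y; have mf := mfiber y.
move=> z; have [bz ->] := dot_fiber_mean y z z.
rewrite -[X in X <= _]mulr1 -[X in _ * X <= _](congr1 fine uy1) -Rint_cst//.
apply: le_Rint => //; first exact: bmf_cst.
move=> x [w0x _]; apply: (dot_invmx_ge g0 (gap_hess_posdef S w0x)) => // z'.
exact: hC.
Qed.

Lemma enorm_fiber_mean y p : w1 y -> uh y (fiber y) = 1%E ->
  enorm (p *m fiber_mean y) <= gamma^-1 * enorm p.
Proof.
have g0 := rt_gamma S.
have fm := fin_fiber y; have mf := mfiber y.
move=> w1y uy1; set q := p *m _.
have [bq] := dot_fiber_mean y p q; rewrite -sqr_enorm => qE.
have : enorm q ^+ 2 <= gamma^-1 * enorm p * enorm q.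
  rewrite qE -[X in _ <= X]mulr1 -[X in _ <= _ * X](congr1 fine uy1) -Rint_cst//.
  apply: le_Rint => //; first exact: bmf_cst.
  move=> x [w0x _]; apply: (le_trans (le_trans (ler_norm _) (cauchy_schwarz _ _))).
  rewrite ler_wpM2r ?enorm_ge0// mulrC.
  exact: (enorm_invmx g0 (gap_hess_posdef S w0x)).
have [/eqP ->|n0] := boolP (enorm q == 0).
  by move=> _; rewrite mulr_ge0 ?enorm_ge0// invr_ge0 ltW.
by rewrite expr2 ler_pM2r// lt0r n0 enorm_ge0.
Qed.

(** The mobility N is the inverse of H almost everywhere, and it turns the energy
    form into an integral with respect to ub. On a null set where the
    disintegration is not concentrated on the fibers it is the identity matrix,
    which makes the bounds valid everywhere. *)
Lemma mobility_exists : exists (N : 'rV[R]_d -> 'M[R]_d) (k K : R),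
  [/\ 0 < k /\ 0 < K,
      forall i j, measurable_fun (w1 : set (borel R d)) (fun y => N y i j),
      forall y, w1 y -> posdef k (N y) /\ forall p, enorm (p *m N y) <= K * enorm p,
      forall f g, C1 w1 f -> C1 w1 g ->
        bounded_mfun (w1 : set (borel R d))
          (fun y => dot (gradc w1 f y *m N y) (gradc w1 g y)) /\
        B f g = \int[ub]_(y in w1) dot (gradc w1 f y *m N y) (gradc w1 g y) &
      forall rho : 'rV[R]_d -> 'rV[R]_d,
        measurable_fun (w1 : set (borel R d)) (rho : borel R d -> borel R d) ->
        measurable_fun (w1 : set (borel R d))
          (fun y => dot (rho y *m invmx (N y)) (rho y)) /\
        (\int[ub]_(y in w1)
           ((rho y *m Hmat w0 c phib Tb uh y *m (rho y)^T) ord0 ord0)%:E =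
         \int[ub]_(y in w1) (dot (rho y *m invmx (N y)) (rho y))%:E)%E].
Proof.
have g0 := rt_gamma S; have mw := mw1 S; have fm := fin_ub S.
have [X [mX X0 hX]] := fiber_full_ae.
have [k k0 pN] := fiber_mean_posdef.
pose N y := if y \in X then 1%:M else fiber_mean y.
have NE y : ~ X y -> N y = fiber_mean y by move=> nX; rewrite /N memNset.
have mfm i j : measurable_fun (w1 : set (borel R d)) (fun y => fiber_mean y i j).
  by under eq_fun do rewrite mxE; exact: measurable_fiber_integral.
have mN i j : measurable_fun (w1 : set (borel R d)) (fun y => N y i j).
  have -> : (fun y => N y i j) = (fun y : borel R d =>
      (1%:M : 'M[R]_d) i j * \1_X y + fiber_mean y i j * \1_(~` X) y).
    apply/funext => y; rewrite /N !indicE in_setC.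
    by case: (y \in X); rewrite !(mulr0, mulr1, addr0, add0r).
  apply: measurable_funD; apply: measurable_funM => //.
  by apply: measurable_indic; exact: measurableC.
have dm0 z : 0 <= dot z z :> R := dot_ge0 z.
have N_posdef y : w1 y -> posdef (Num.min 1 k) (N y).
  move=> w1y; rewrite /N; case: ifP => [_|/negP nX].
    split=> [|z]; first exact: trmx1.
    by rewrite mulmx1 ler_piMl// ge_min lexx.
  have [|sN hN] := pN y w1y; first by apply: hX => // Xy; apply: nX; rewrite inE.
  split => // z; apply: le_trans (hN z); rewrite ler_wpM2r//.
  by rewrite ge_min lexx orbT.
have N_bounded y p : w1 y -> enorm (p *m N y) <= Num.max 1 gamma^-1 * enorm p.
  move=> w1y; rewrite /N; case: ifP => [_|/negP nX].
    by rewrite mulmx1 ler_peMl ?enorm_ge0// le_max lexx.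
  have uy1 : uh y (fiber y) = 1%E by apply: hX => // Xy; apply: nX; rewrite inE.
  apply: (le_trans (enorm_fiber_mean p w1y uy1)); rewrite ler_wpM2r ?enorm_ge0//.
  by rewrite le_max lexx orbT.
exists N, (Num.min 1 k), (Num.max 1 gamma^-1); split.
- by rewrite lt_min k0 ltr01 lt_max ltr01.
- exact: mN.
- by move=> y w1y; split; [exact: N_posdef|move=> p; exact: N_bounded].
- move=> f g C1f C1g.
  have mgr h i : C1 w1 h ->
      measurable_fun (w1 : set (borel R d)) (fun y => gradc w1 h y ord0 i).
    move=> C1h; apply: (proj1 (bmf_w1 S _)).
    exact: (within_continuous_coord (continuous_gradc (rt_cl S) C1h)).
  have bm : bounded_mfun (w1 : set (borel R d))
      (fun y => dot (gradc w1 f y *m N y) (gradc w1 g y)).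
    split.
      by apply: measurable_dot_mulmx => // i; exact: mgr.
    have [F hF] := within_continuous_bounded (rt_w1 S) (continuous_gradc (rt_cl S) C1f).
    have [H hH] := within_continuous_bounded (rt_w1 S) (continuous_gradc (rt_cl S) C1g).
    exists (Num.max 1 gamma^-1 * (d%:R * F) * (d%:R * H)) => y w1y.
    apply: (le_trans (cauchy_schwarz _ _)).
    have e1 : enorm (gradc w1 g y) <= d%:R * H.
      by rewrite (le_trans (enorm_le_norm _))// ler_wpM2l// hH.
    apply: ler_pM; rewrite ?enorm_ge0//.
    apply: (le_trans (N_bounded _ _ w1y)); rewrite ler_wpM2l ?le_max ?ler01//.
    by rewrite (le_trans (enorm_le_norm _))// ler_wpM2l// hF.
  split; first exact: bm.
  set q := fun x => dot (v f x) (gradc w1 g (Tb x)).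
  have bq : bounded_mfun (w0 : set (borel R d)) q := bmf_energy S C1f C1g.
  (* The disintegration formula concerns nonnegative functions. *)
  have [C hC] := proj2 bq.
  have bC y : bounded_mfun (fiber y) (fun=> `|C|) := bmf_cst _ _.
  have bqC : bounded_mfun (w0 : set (borel R d)) (fun x => q x + `|C|).
    by apply: bmfD => //; exact: bmf_cst.
  have qC0 x : w0 x -> 0 <= q x + `|C|.
    move=> /hC; rewrite ler_norml => /andP[h _].
    by rewrite -lerBlDr sub0r (le_trans _ h)// lerN2 ler_norm.
  have [_ _ _ /(_ (fun x => (q x + `|C|)%:E))] := uhP.
  have mqC : measurable_fun (w0 : set (borel R d)) (fun x => (q x + `|C|)%:E).
    by apply/measurable_EFinP; case: bqC.
  move=> /(_ mqC) /(_ (fun x w0x => qC0 x w0x)).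
  rewrite (Rint_fin (mw0 S) (fin_u0 (u0 := u0) S) bqC).
  under [X in _ = X -> _]eq_integral => y _ do
    rewrite (Rint_fin (mfiber y) (fin_fiber y) (bmf_fiber y bqC)).
  have -> : (\int[ub]_(y in w1) (\int[uh y]_(x in fiber y) (q x + `|C|))%:E =
      \int[ub]_(y in w1)
        (dot (gradc w1 f y *m N y) (gradc w1 g y) + `|C|)%:E)%E.
    apply: ae_eq_integral; first exact: mw.
    - apply/measurable_EFinP; exact: measurable_fiber_integral.
    - by apply/measurable_EFinP; apply: measurable_funD => //; case: bm.
    exists X; split => // y /= h; apply: contrapT => nX; apply: h => w1y.
    have uy1 := hX y w1y nX; have fy := fin_fiber y; have my := mfiber y.
    rewrite RintD//; last exact: bmf_fiber.
    congr (_ + _)%:E; last first.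
      by rewrite Rint_cst// [fine _](congr1 fine uy1) mulr1.
    rewrite NE//.
    have [_ ->] := dot_fiber_mean y (gradc w1 f y) (gradc w1 g y).
    by apply: eq_Rintegral => x /set_mem[_ /= <-].
  have bmC : bounded_mfun (w1 : set (borel R d)) (fun y =>
      dot (gradc w1 f y *m N y) (gradc w1 g y) + `|C|).
    by apply: bmfD => //; exact: bmf_cst.
  rewrite (Rint_fin mw fm bmC) => -[].
  rewrite (RintD (mw0 S) (fin_u0 (u0 := u0) S) bq (bmf_cst _ _)).
  rewrite (RintD mw fm bm (bmf_cst _ _)).
  have cst : {within w1, continuous (fun=> `|C|)} by exact: within_continuous_cst.
  by rewrite (image_integral S cst) => /addIr.
- move=> rho mrho.
  have mr i : measurable_fun (w1 : set (borel R d)) (fun y => rho y ord0 i).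
    exact: (measurableT_comp (coord_borel i) mrho).
  have mi : measurable_fun (w1 : set (borel R d))
      (fun y => dot (rho y *m invmx (N y)) (rho y)).
    by apply: measurable_dot_mulmx => // i j; exact: measurable_fun_invmx.
  split => //; apply: ae_eq_integral => //.
  + apply/measurable_EFinP; under eq_fun do rewrite -dot_mulmxE HmatE.
    by apply: measurable_dot_mulmx => // i j; exact: measurable_fun_invmx.
  + exact/measurable_EFinP.
  + exists X; split => // y /= h; apply: contrapT => nX; apply: h => w1y.
    by rewrite -dot_mulmxE HmatE NE.
Qed.

End mobility.

(** * Quadratic forms on square-integrable fields *)

Section fields.
Context dT (T : measurableType dT) (R : realType) (mu : {measure set T -> \bar R})
  (D : set T) (mD : measurable D) (d : nat).
Implicit Types p q r : T -> 'rV[R]_d.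

Definition square_integrable p := (forall i, measurable_fun D (fun y => p y ord0 i)) /\
  mu.-integrable D (EFin \o (fun y => dot (p y) (p y))).

Lemma measurable_dot p q : (forall i, measurable_fun D (fun y => p y ord0 i)) ->
  (forall i, measurable_fun D (fun y => q y ord0 i)) ->
  measurable_fun D (fun y => dot (p y) (q y)).
Proof. by move=> mp mq; apply: measurable_sum => i; exact: measurable_funM. Qed.

Lemma square_integrable_le p (M : R) : (forall i, measurable_fun D (fun y => p y ord0 i)) ->
  (\int[mu]_(y in D) (dot (p y) (p y))%:E <= M%:E)%E ->
  square_integrable p /\ \int[mu]_(y in D) dot (p y) (p y) <= M.
Proof.
move=> mp pM; have mpp := measurable_dot mp mp.
have ip : mu.-integrable D (EFin \o (fun y => dot (p y) (p y))).
  apply/integrableP; split; first exact/measurable_EFinP.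
  rewrite (eq_integral (fun y => (dot (p y) (p y))%:E)).
    exact: le_lt_trans pM (ltry _).
  by move=> y _; rewrite gee0_abs// lee_fin dot_ge0.
by split => //; rewrite -lee_fin fineK//; exact: integrable_fin_num.
Qed.

Lemma square_integrableZD (l : R) p q : square_integrable p -> square_integrable q ->
  square_integrable (fun y => l *: p y + q y).
Proof.
move=> [mp ip] [mq iq].
have mpq i : measurable_fun D (fun y => (l *: p y + q y) ord0 i).
  under eq_fun do rewrite mxE [X in X + _]mxE.
  by apply: measurable_funD => //; exact: measurable_funM.
split=> //; apply: (@le_integrable _ _ _ mu D mD _
  (EFin \o (fun y => 2 * l ^+ 2 * dot (p y) (p y) + 2 * dot (q y) (q y)))).
- by apply/measurable_EFinP; exact: measurable_dot.
- move=> y _; rewrite lee_fin (ger0_norm (dot_ge0 _)) ger0_norm; last first.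
    by rewrite addr_ge0// mulr_ge0 ?dot_ge0// mulr_ge0// sqr_ge0.
  have := dot_ge0 (l *: p y - q y); rewrite !(dotDl, dotDr, dotZl, dotZr, dotNl, dotNr).
  rewrite (dotC (q y) (p y)); nra.
- exact: (integrableD mD (integrableZl mD (2 * l ^+ 2) ip) (integrableZl mD 2 iq)).
Qed.

(** Completeness is applied to each coordinate. *)
Lemma L2_complete_field (f : nat -> T -> 'rV[R]_d) :
  (forall n i, measurable_fun D (fun y => f n y ord0 i)) ->
  (forall n m, (n <= m)%N ->
    (\int[mu]_(y in D) (dot (f n y - f m y) (f n y - f m y))%:E <= ((8 ^+ n)^-1)%:E)%E) ->
  exists2 s : T -> 'rV[R]_d, (forall i, measurable_fun D (fun y => s y ord0 i)) &
    forall n, (\int[mu]_(y in D) (dot (f n y - s y) (f n y - s y))%:E <=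
      (d%:R * (8 ^+ n)^-1)%:E)%E.
Proof.
move=> mf cf.
have mfB n m i : measurable_fun D (fun y => (f n y - f m y) ord0 i).
  by under eq_fun do rewrite !mxE; exact: measurable_funB.
have /choice[s sP] : forall i, exists g : T -> R, measurable_fun D g /\ forall n,
    (\int[mu]_(y in D) ((f n y ord0 i - g y) ^+ 2)%:E <= ((8 ^+ n)^-1)%:E)%E.
  move=> i; have [||g mg hg] := @L2_complete _ T R mu D mD (fun n y => f n y ord0 i).
  - by move=> n; exact: mf.
  - move=> n m nm; apply: le_trans (cf n m nm).
    apply: ge0_le_integral => //.
    + by move=> y _; rewrite lee_fin sqr_ge0.
    + apply/measurable_EFinP/measurable_funX; exact: measurable_funB.
    + by apply/measurable_EFinP; exact: measurable_dot.
    move=> y _; rewrite lee_fin /dot (bigD1 i)//= !mxE -expr2 lerDl.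
    by apply: sumr_ge0 => j _; rewrite -expr2 sqr_ge0.
  - by exists g.
exists (fun y => \row_i s i y) => [i|n].
  by under eq_fun do rewrite mxE; case: (sP i).
have -> : (\int[mu]_(y in D) (dot (f n y - \row_i s i y) (f n y - \row_i s i y))%:E =
   \sum_(i < d) \int[mu]_(y in D) ((f n y ord0 i - s i y) ^+ 2)%:E)%E.
  rewrite -ge0_integral_sum//.
  - apply: eq_integral => y _; rewrite /dot -sumEFin; apply: eq_bigr => i _.
    by rewrite !mxE expr2.
  - move=> i; apply/measurable_EFinP/measurable_funX; apply: measurable_funB => //.
    by case: (sP i).
  - by move=> i y _; rewrite lee_fin sqr_ge0.
apply: (@le_trans _ _ (\sum_(i < d) ((8 ^+ n)^-1)%:E)%E).
  by apply: lee_sum => i _; case: (sP i).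
by rewrite sumEFin sumr_const card_ord lee_fin -[X in X <= _]mulr_natl.
Qed.

Section mobility.
Context (N : T -> 'M[R]_d) (k K : R) (k0 : 0 < k) (K0 : 0 < K)
  (mN : forall i j, measurable_fun D (fun y => N y i j))
  (pN : forall y, D y -> posdef k (N y) /\
    forall z : 'rV[R]_d, enorm (z *m N y) <= K * enorm z).

Definition mobility_form p q : R := \int[mu]_(y in D) dot (p y *m N y) (q y).

Lemma integrable_form p q : square_integrable p -> square_integrable q ->
  mu.-integrable D (EFin \o (fun y => dot (p y *m N y) (q y))).
Proof.
move=> [mp ip] [mq iq]; apply: (@le_integrable _ _ _ mu D mD _
  (EFin \o (fun y => K * dot (p y) (p y) + K * dot (q y) (q y)))).
- by apply/measurable_EFinP; exact: measurable_dot_mulmx.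
- move=> y Dy; rewrite lee_fin [X in _ <= X]ger0_norm; last first.
    by rewrite addr_ge0// mulr_ge0 ?dot_ge0// ltW.
  apply: (le_trans (cauchy_schwarz _ _)); rewrite -!sqr_enorm.
  have := proj2 (pN Dy) (p y); have := enorm_ge0 (q y); have := enorm_ge0 (p y).
  move: (enorm (p y *m N y)) (enorm (p y)) (enorm (q y)) => e a b a0 b0 eK.
  apply: (@le_trans _ _ (K * a * b)); first by rewrite ler_wpM2r.
  rewrite -mulrDr -mulrA ler_pM2l//; nra.
- exact: (integrableD mD (integrableZl mD K ip) (integrableZl mD K iq)).
Qed.

Lemma formC p q : mobility_form p q = mobility_form q p.
Proof.
by apply: eq_Rintegral => y /set_mem Dy; apply: dot_sym; case: (pN Dy) => -[].
Qed.

Lemma form_linl (l : R) p q r : square_integrable p -> square_integrable q ->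
  square_integrable r ->
  mobility_form (fun y => l *: p y + q y) r = l * mobility_form p r + mobility_form q r.
Proof.
move=> sp sq sr; have ipr := integrable_form sp sr; have iqr := integrable_form sq sr.
rewrite /mobility_form -RintegralZl// -RintegralD//; last exact: (integrableZl mD l ipr).
by apply: eq_Rintegral => y _; rewrite mulmxDl dotDl -scalemxAl dotZl.
Qed.

Lemma form_addZ (l : R) p q : square_integrable p -> square_integrable q ->
  mobility_form (fun y => l *: p y + q y) (fun y => l *: p y + q y) =
  l ^+ 2 * mobility_form p p + 2 * l * mobility_form p q + mobility_form q q.
Proof.
move=> sp sq; have spq := square_integrableZD l sp sq.
rewrite [LHS]form_linl// [mobility_form p _]formC [X in _ + X]formC !form_linl// (formC q p).
by ring.
Qed.

Lemma form_ge0 p : 0 <= mobility_form p p.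
Proof.
by apply: Rintegral_ge0 => y Dy; case: (pN Dy) => pNy _; exact: posdef_ge0 k0 pNy _.
Qed.

Lemma form_le p (M : R) : square_integrable p ->
  \int[mu]_(y in D) dot (p y) (p y) <= M -> mobility_form p p <= K * M.
Proof.
move=> sp pM; apply: (@le_trans _ _ (K * \int[mu]_(y in D) dot (p y) (p y))).
  have [_ ip] := sp; rewrite -RintegralZl//; apply: le_Rintegral => //.
  - exact: integrable_form.
  - exact: (integrableZl mD K ip).
  move=> y Dy; apply: (le_trans (le_trans (ler_norm _) (cauchy_schwarz _ _))).
  by rewrite -sqr_enorm expr2 mulrA ler_wpM2r ?enorm_ge0//; case: (pN Dy) => _; exact.
by rewrite ler_pM2l.
Qed.

Lemma form_ge p : square_integrable p ->
  k * \int[mu]_(y in D) dot (p y) (p y) <= mobility_form p p.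
Proof.
move=> sp; have [_ ip] := sp; rewrite -RintegralZl//; apply: le_Rintegral => //.
- exact: (integrableZl mD k ip).
- exact: integrable_form.
by move=> y Dy; case: (pN Dy) => -[].
Qed.

(** The form is nonnegative at l p + q and at l p - q. *)
Lemma form_young (l : R) p q : 0 < l -> square_integrable p -> square_integrable q ->
  `|mobility_form p q| <= (l * mobility_form p p + l^-1 * mobility_form q q) / 2.
Proof.
move=> l0 sp sq.
have h1 := form_ge0 (fun y => l *: p y + q y); rewrite form_addZ// in h1.
have h2 := form_ge0 (fun y => (- l) *: p y + q y); rewrite form_addZ// in h2.
rewrite -(ler_pM2l l0) mulrA mulrDr [l * (l^-1 * _)]mulrA divff ?gt_eqF// mul1r.
rewrite -{1}(gtr0_norm l0) -normrM ler_norml.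
move: h1 h2; rewrite sqrrN; move: (mobility_form p p) (mobility_form q q) (mobility_form p q) => a b e.
by rewrite mulrA -expr2 => h1 h2; apply/andP; split; lra.
Qed.

(** The substitution rho = p N identifies the quadratic form of N^-1 at rho with
    that of N at p. *)
Lemma square_integrable_mulmx p : square_integrable p ->
  square_integrable (fun y => p y *m N y).
Proof.
move=> [mp ip].
have mpN i : measurable_fun D (fun y => (p y *m N y) ord0 i).
  by under eq_fun do rewrite mxE; apply: measurable_sum => j; exact: measurable_funM.
split => //; apply: (@le_integrable _ _ _ mu D mD _
  (EFin \o (fun y => K ^+ 2 * dot (p y) (p y)))) (integrableZl mD _ ip).
  by apply/measurable_EFinP; exact: measurable_dot.
move=> y Dy; rewrite lee_fin (ger0_norm (dot_ge0 _)) ger0_norm ?mulr_ge0 ?dot_ge0 ?exprn_ge0 ?(ltW K0)//.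
rewrite -!sqr_enorm -exprMn ler_sqr ?nnegrE ?mulr_ge0 ?enorm_ge0 ?(ltW K0)//.
by case: (pN Dy) => _; exact.
Qed.

Lemma square_integrable_invmx p : square_integrable p ->
  square_integrable (fun y => p y *m invmx (N y)).
Proof.
move=> [mp ip].
have mpN i : measurable_fun D (fun y => (p y *m invmx (N y)) ord0 i).
  under eq_fun do rewrite mxE; apply: measurable_sum => j; apply: measurable_funM => //.
  exact: measurable_fun_invmx.
split => //; apply: (@le_integrable _ _ _ mu D mD _
  (EFin \o (fun y => k^-1 ^+ 2 * dot (p y) (p y)))) (integrableZl mD _ ip).
  by apply/measurable_EFinP; exact: measurable_dot.
move=> y Dy; rewrite lee_fin (ger0_norm (dot_ge0 _)) ger0_norm ?mulr_ge0 ?dot_ge0 ?exprn_ge0 ?invr_ge0 ?(ltW k0)//.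
rewrite -!sqr_enorm -exprMn ler_sqr ?nnegrE ?mulr_ge0 ?enorm_ge0 ?invr_ge0 ?(ltW k0)//.
by rewrite mulrC; case: (pN Dy) => pNy _; exact: enorm_invmx pNy _.
Qed.

End mobility.

End fields.

(** * The infimum over fluxes *)

Lemma le0_geometric (R : realType) (a C : R) :
  (forall n, a <= C * (2 ^+ n)^-1) -> a <= 0.
Proof.
move=> aC; rewrite leNgt; apply/negP => a0.
pose n := Num.truncn (`|C| / a).
have Cn : `|C| / a < 2 ^+ n.+1.
  apply: lt_trans (truncnS_gt _) _; rewrite -natrX ltr_nat; exact: ltn_expl.
have := aC n.+1; rewrite leNgt => /negP; apply.
rewrite ltr_pdivrMr ?exprn_gt0//; apply: le_lt_trans (ler_norm _) _.
by rewrite mulrC -ltr_pdivrMr.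
Qed.

Lemma midpoint_gap (R : realFieldType) (s e1 e2 ph pg eg b eh : R) :
  s - e1 <= 1 * ph + pg - (eg + 1 * b + 1 ^+ 2 * eh) -> s - e2 <= pg - eg ->
  2^-1 * ph + pg - (eg + 2^-1 * b + 2^-1 ^+ 2 * eh) <= s -> eh <= 2 * (e1 + e2).
Proof. by have -> : 2^-1 ^+ 2 = 4^-1 :> R by [field]; rewrite expr1n; lra. Qed.

Lemma dual_error_le (R : realFieldType) (e x A b ad ag L E : R) :
  e <= 1 -> 0 < x -> x <= 1 -> 0 <= E -> 0 <= L -> `|A| <= e * x ^+ 3 * (1 + E) ->
  `|b| <= (x^-1 * ad + x^-1^-1 * ag) / 2 -> ad <= L * x ^+ 3 -> ag = 2 * E ->
  `|A + b| <= (1 + 2 * E + L) * x.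
Proof.
move=> e1 x0 x1 E0 L0 hA hb had agE; rewrite agE invrK in hb.
have x2 : x ^+ 2 <= x by rewrite expr2 ler_piMl// ltW.
have x3 : x ^+ 3 <= x.
  by rewrite exprS; apply: (le_trans _ x2); rewrite [leRHS]expr2 ler_wpM2l// ltW.
have h1 : e * x ^+ 3 * (1 + E) <= x * (1 + E).
  rewrite ler_wpM2r ?addr_ge0//; apply: le_trans x3.
  by rewrite ler_piMl// exprn_ge0// ltW.
have h2 : x^-1 * ad <= L * x.
  rewrite ler_pdivrMl//; apply: (le_trans had).
  by rewrite exprS mulrCA ler_pM2l// ler_wpM2l.
apply: (le_trans (ler_normD _ _)).
have : 0 <= L * x by rewrite mulr_ge0// ltW.
lra.
Qed.

Section flux.
Context (R : realType) (d : nat) (w0 w1 : set 'rV[R]_d)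
  (c : 'rV[R]_d -> 'rV[R]_d -> R)
  (u0 ub : {finite_measure set (borel R d) -> \bar R})
  (phib : 'rV[R]_d -> R) (Tb : 'rV[R]_d -> 'rV[R]_d) (eps gamma : R).
Context (S : regular_transport w0 w1 c u0 ub phib Tb eps gamma).
Local Notation B := (energy_form w0 w1 c u0 phib Tb).
Local Notation E := (energy w0 w1 c u0 phib Tb).
Context (Phi : ('rV[R]_d -> R) -> R) (dPhi : C1_dual w1 Phi).
Local Notation sPhi := (dual_energy w0 w1 c u0 phib Tb Phi).

(** The concavity gap of Phi - E at the midpoint of f and g is E (f - g) / 4. *)
Lemma near_maximizers_close f g (s e1 e2 : R) : C1 w1 f -> C1 w1 g ->
  sPhi = s%:E -> s - e1 <= Phi f - E f -> s - e2 <= Phi g - E g ->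
  E (fun x => -1 * g x + f x) <= 2 * (e1 + e2).
Proof.
move=> C1f C1g sE sf sg; set h := fun x => _.
have C1h : C1 w1 h := C1_lin (-1) C1g C1f.
have fE : f = (fun x => 1 * h x + g x).
  by apply/funext => x; rewrite /h mulN1r mul1r addrC addrA subrr add0r.
have Ef : E f = E g + 1 * B g h + 1 ^+ 2 * E h.
  by rewrite [in LHS]fE; exact: (energy_addZ S 1 C1g C1h).
have Pf : Phi f = 1 * Phi h + Phi g by rewrite [in LHS]fE; exact: (proj1 dPhi).
have Em : E (fun x => 2^-1 * h x + g x) = E g + 2^-1 * B g h + 2^-1 ^+ 2 * E h.
  exact: (energy_addZ S _ C1g C1h).
have Pm : Phi (fun x => 2^-1 * h x + g x) = 2^-1 * Phi h + Phi g.
  exact: (proj1 dPhi).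
have : Phi (fun x => 2^-1 * h x + g x) - E (fun x => 2^-1 * h x + g x) <= s.
  rewrite -lee_fin -sE; apply: ereal_sup_ubound.
  by exists (fun x => 2^-1 * h x + g x) => //; exact: C1_lin.
rewrite Em Pm => h1; rewrite Ef Pf in sf.
exact: midpoint_gap sf sg h1.
Qed.

Context (N : 'rV[R]_d -> 'M[R]_d) (k K : R) (k0 : 0 < k) (K0 : 0 < K)
  (mN : forall i j, measurable_fun (w1 : set (borel R d)) (fun y => N y i j))
  (pN : forall y, w1 y -> posdef k (N y) /\
    forall z : 'rV[R]_d, enorm (z *m N y) <= K * enorm z).
Local Notation a := (mobility_form ub (w1 : set (borel R d)) N).
Local Notation sqint := (@square_integrable _ (borel R d) R ub w1 d).
Local Notation gr := (gradc w1).
Context (BN : forall f g, C1 w1 f -> C1 w1 g -> B f g = a (gr f) (gr g)).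

Let mw : measurable (w1 : set (borel R d)) := mw1 S.

Lemma sqint_grad f : C1 w1 f -> sqint (gr f).
Proof.
move=> C1f; have cg i : {within w1, continuous (fun y => gr f y ord0 i)}.
  exact: (within_continuous_coord (continuous_gradc (rt_cl S) C1f)).
have bg i := bmf_w1 S (cg i).
split=> [i|]; first by case: (bg i).
apply: bmf_integrable => //; first exact: (fin_ub S).
by apply: bmf_sum => i; exact: bmfM.
Qed.

Let EN f : C1 w1 f -> 2 * E f = a (gr f) (gr f).
Proof. by move=> C1f; rewrite -BN// /energy mulrC divfK. Qed.

(** The form is nonnegative at p - grad f. *)
Lemma le_flux_energy p f : sqint p ->
  (forall f, C1 w1 f -> Phi f = a p (gr f)) -> C1 w1 f ->
  Phi f - E f <= a p p / 2.
Proof.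
move=> sp pPhi C1f; have sg := sqint_grad C1f.
have := form_ge0 ub k0 pN (fun y => -1 *: p y + gr f y).
rewrite (form_addZ mw K0 mN pN _ sp sg) -pPhi// -EN//.
move: (Phi f) (E f) (a p p) => x y z; rewrite sqrrN expr1n; lra.
Qed.

(** The gradients of a maximizing sequence f_n converge in L^2 (ub), because the
    energy controls their distances. The limit p represents Phi by the
    Euler-Lagrange equation, and its form exceeds twice the values of Phi - E at
    f_n by the form at the difference of p and grad f_n. *)
Lemma flux_exists s : sPhi = s%:E -> exists p, [/\ sqint p,
  forall f, C1 w1 f -> Phi f = a p (gr f) & a p p / 2 <= s].
Proof.
move=> sE.
(* Values within (e q n)^2 of the supremum keep the squared L^2 distances of the
   gradients below 8 (e q n)^2 / k, hence below the rate q n of L2_complete. *)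
pose e := Num.min (2^-1) (k / 8).
have e0 : 0 < e by rewrite lt_min invr_gt0 ltr0n divr_gt0.
have e2 : e <= 2^-1 by rewrite ge_min lexx.
have ek : e <= k / 8 by rewrite ge_min lexx orbT.
pose q n : R := (8 ^+ n)^-1.
have q0 n : 0 < q n by rewrite invr_gt0 exprn_gt0.
have q1 n : q n <= 1 by rewrite invf_le1 ?exprn_gt0// exprn_ege1// ler1n.
have eta0 n : 0 < e * q n by rewrite mulr_gt0.
have sfin : sPhi \is a fin_num by rewrite sE.
have /choice[f fP] : forall n, exists f, C1 w1 f /\ s - (e * q n) ^+ 2 <= Phi f - E f.
  move=> n; have e3 : 0 < (e * q n) ^+ 2 by rewrite exprn_gt0.
  have [_ [g C1g <-]] := ub_ereal_sup_adherent e3 sfin.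
  by rewrite -/sPhi sE -EFinB lte_fin => /ltW h; exists g.
have C1f n : C1 w1 (f n) by case: (fP n).
have Jf n : s - (e * q n) ^+ 2 <= Phi (f n) - E (f n) by case: (fP n).
have sf n := sqint_grad (C1f n).
have qn n m : (n <= m)%N -> q m <= q n.
  by move=> nm; rewrite lef_pV2 ?posrE ?exprn_gt0// ler_weXn2l// ler1n.
have cauchy n m : (n <= m)%N -> (\int[ub]_(y in w1)
    (dot (gr (f n) y - gr (f m) y) (gr (f n) y - gr (f m) y))%:E <= (q n)%:E)%E.
  move=> nm; set g := fun x => -1 * f m x + f n x.
  have C1g : C1 w1 g := C1_lin (-1) (C1f m) (C1f n).
  have [mg ig] := sqint_grad C1g.
  rewrite (eq_integral (fun y : borel R d => (dot (gr g y) (gr g y))%:E)); last first.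
    move=> y /set_mem w1y; rewrite /g (gradc_lin _ (rt_cl S))//.
    by rewrite scaleN1r addrC.
  rewrite -[X in (X <= _)%E]fineK ?lee_fin; last exact: integrable_fin_num.
  have hk := form_ge mw K0 mN pN (conj mg ig); rewrite -EN// in hk.
  have hE := near_maximizers_close (C1f n) (C1f m) sE (Jf n) (Jf m).
  rewrite -(ler_pM2l k0); apply: (le_trans hk).
  have qnm := qn n m nm.
  have s1 : (e * q m) ^+ 2 <= (e * q n) ^+ 2.
    by rewrite ler_sqr ?nnegrE ?(ltW (eta0 _))// ler_pM2l.
  have s2 : (e * q n) ^+ 2 <= k / 8 * q n.
    rewrite expr2 -mulrA; apply: ler_pM; rewrite ?(ltW e0)//.
      by rewrite mulr_ge0// ltW.
    rewrite ler_piMr ?(ltW (q0 _))//.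
    by rewrite (le_trans _ (q1 n))// ler_piMl ?(ltW (q0 _))//; lra.
  by move: hE; rewrite -/g; lra.
have [sg msg hsg] := @L2_complete_field _ (borel R d) R ub w1 mw d
  (fun n => gr (f n)) (fun n i => proj1 (sf n) i) cauchy.
pose dl n y := gr (f n) y - sg y.
have dlP n : sqint (dl n) /\ \int[ub]_(y in w1) dot (dl n y) (dl n y) <= d%:R * q n.
  apply: square_integrable_le => [//|i|]; last exact: hsg.
  under eq_fun do rewrite !mxE; apply: measurable_funB => //.
  exact: (proj1 (sf n)).
have sgE n : sg = (fun y => -1 *: dl n y + gr (f n) y).
  by apply/funext => y; rewrite scaleN1r opprB subrK.
have ssg : sqint sg.
  rewrite (sgE 0%N); apply: square_integrableZD => //; exact: (proj1 (dlP 0%N)).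
have ad n : a (dl n) (dl n) <= K * (d%:R * q n).
  by case: (dlP n) => sd; exact: (form_le mw K0 mN pN).
have dual g : C1 w1 g -> Phi g = a sg (gr g).
  move=> C1g; have sgg := sqint_grad C1g.
  apply/eqP; rewrite -subr_eq0 -normr_le0.
  apply: (@le0_geometric _ _ (1 + 2 * E g + K * d%:R)) => n.
  have [sd _] := dlP n.
  have -> : Phi g - a sg (gr g) = Phi g - B (f n) g + a (dl n) (gr g).
    rewrite (sgE n) (form_linl mw K0 mN pN _ sd (sf n) sgg) BN//; ring.
  have x3 : q n = (2 ^+ n)^-1 ^+ 3.
    by rewrite /q exprVn -exprM mulnC exprM (_ : 8 = 2 ^+ 3)//; ring.
  have x0 : 0 < (2 ^+ n)^-1 :> R by rewrite invr_gt0 exprn_gt0.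
  apply: (dual_error_le (e := e) (ad := a (dl n) (dl n)) (ag := a (gr g) (gr g))) => //.
  - lra.
  - by rewrite invf_le1 ?exprn_gt0// exprn_ege1// ler1n.
  - exact: (energy_ge0 S).
  - by rewrite mulr_ge0// ltW.
  - by rewrite -x3; exact: (near_euler_lagrange S dPhi (eta0 n) (C1f n) C1g sE (Jf n)).
  - by apply: (form_young mw k0 K0 mN pN) => //; rewrite !invr_gt0.
  - by rewrite -x3 -mulrA; exact: ad.
  - by rewrite -EN.
exists sg; split => //.
rewrite -subr_le0; apply: (@le0_geometric _ _ (K * d%:R)) => n.
have [sd _] := dlP n.
have e1 : a sg (gr (f n)) = - a (dl n) (gr (f n)) + a (gr (f n)) (gr (f n)).
  by rewrite [in LHS](sgE n) (form_linl mw K0 mN pN _ sd (sf n) (sf n)) mulN1r.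
have e3 : a sg sg =
    a (dl n) (dl n) - 2 * a (dl n) (gr (f n)) + a (gr (f n)) (gr (f n)).
  by rewrite [in LHS](sgE n) (form_addZ mw K0 mN pN _ sd (sf n)); ring.
have e4 := dual _ (C1f n); have e5 := EN (C1f n).
have e6 : Phi (f n) - E (f n) <= s.
  by rewrite -lee_fin -sE; apply: ereal_sup_ubound; exists (f n).
have e7 := ad n.
have e8 : K * (d%:R * q n) <= K * d%:R * (2 ^+ n)^-1.
  rewrite mulrA ler_wpM2l ?mulr_ge0 ?(ltW K0)// lef_pV2 ?posrE ?exprn_gt0//.
  by rewrite lerXn2r ?nnegrE// ler_nat.
have : 0 <= K * (d%:R * q n) by rewrite !mulr_ge0 ?(ltW K0) ?(ltW (q0 n)).
move: e1 e3 e4 e5 e6 e7 e8; lra.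
Qed.

Section half_energies.
Context (H : 'rV[R]_d -> 'M[R]_d)
  (HN : forall rho : 'rV[R]_d -> 'rV[R]_d,
    measurable_fun (w1 : set (borel R d)) (rho : borel R d -> borel R d) ->
    (\int[ub]_(y in w1) ((rho y *m H y *m (rho y)^T) ord0 ord0)%:E =
     \int[ub]_(y in w1) (dot (rho y *m invmx (N y)) (rho y))%:E)%E).
Local Notation halves := (half_energies w1 ub H Phi).

Let uN y : w1 y -> N y \in unitmx.
Proof. by move=> /pN[pNy _]; exact: posdef_unit k0 pNy. Qed.

Let formE p : sqint p ->
  ((2^-1)%:E * \int[ub]_(y in w1) (dot (p y *m N y) (p y))%:E = (a p p / 2)%:E)%E.
Proof.
move=> sp; have ip := integrable_form mw K0 mN pN sp sp.
by rewrite mulrC EFinM fineK//; exact: integrable_fin_num.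
Qed.

(** The fluxes are the fields rho = p N. *)
Lemma half_energiesP l : halves l <-> exists p, [/\ sqint p,
  forall f, C1 w1 f -> Phi f = a p (gr f) & l = (a p p / 2)%:E].
Proof.
split=> [[rho [[mrho irho] Phirho] <-]|[p [sp pPhi ->]]].
- have srho : sqint rho.
    have mr i : measurable_fun (w1 : set (borel R d)) (fun y => rho y ord0 i).
      exact: (measurableT_comp (coord_borel i) mrho).
    split => //; apply/integrableP; split.
      by apply/measurable_EFinP; exact: measurable_dot.
    apply: le_lt_trans irho; rewrite le_eqVlt; apply/orP; left; apply/eqP.
    by apply: eq_integral => y _ /=; rewrite ger0_norm ?dot_ge0// sqr_enorm.
  have sp := square_integrable_invmx mw k0 mN pN srho.
  exists (fun y => rho y *m invmx (N y)); split => //.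
    move=> f C1f; rewrite Phirho//; apply: eq_Rintegral => y /set_mem w1y.
    by rewrite mulmxKV// uN.
  rewrite HN// -formE//; congr (_ * _)%E; apply: eq_integral => y /set_mem w1y.
  by rewrite mulmxKV ?uN// dotC.
- have [mr ir] := square_integrable_mulmx mw K0 mN pN sp.
  have mrho : measurable_fun (w1 : set (borel R d))
    ((fun y => p y *m N y) : borel R d -> borel R d) by exact: borel_coord.
  exists (fun y => p y *m N y).
    split; last by move=> f C1f; rewrite pPhi.
    split => //; have /integrableP[_] := ir; apply: le_lt_trans.
    rewrite le_eqVlt; apply/orP; left; apply/eqP; apply: eq_integral => y _ /=.
    by rewrite ger0_norm ?dot_ge0// sqr_enorm.
  rewrite HN// -formE//; congr (_ * _)%E; apply: eq_integral => y /set_mem w1y.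
  by rewrite mulmxK ?uN// dotC.
Qed.

Lemma dual_energy_le_halves l : halves l -> (sPhi <= l)%E.
Proof.
move=> /half_energiesP[p [sp pPhi ->]]; apply: ge_ereal_sup => _ [f C1f <-].
by rewrite lee_fin; exact: le_flux_energy.
Qed.

(** Any flux has at least the energy s, by duality. *)
Lemma dual_energy_halves s : sPhi = s%:E -> halves s%:E.
Proof.
move=> sE; have [p [sp pPhi ps]] := flux_exists sE.
apply/half_energiesP; exists p; split => //; apply/eqP.
rewrite eqe eq_le ps andbT -lee_fin -sE; apply: dual_energy_le_halves.
by apply/half_energiesP; exists p.
Qed.

Lemma inf_half_energies : ereal_inf halves = sPhi /\ (halves !=set0 -> halves sPhi).
Proof.
have s0 := dual_energy_ge0 S dPhi.
split; last first.
  move=> [l hl]; have := dual_energy_le_halves hl.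
  have /half_energiesP[p [_ _ lE]] := hl.
  case sE : sPhi s0 => [s| |]//; first by move=> _ _; exact: dual_energy_halves.
  by move=> _; rewrite lE leye_eq.
apply/eqP; rewrite eq_le; apply/andP; split; last first.
  by apply: le_ereal_inf_tmp => l; exact: dual_energy_le_halves.
case sE : sPhi s0 => [s| |]// _; last by rewrite leey.
by apply: ereal_inf_lbound; exact: dual_energy_halves.
Qed.

End half_energies.

End flux.

Unset Implicit Arguments.

Theorem theorem4p13 (R : realType) (d : nat) (w0 w1 : set 'rV[R]_d)
  (c : 'rV[R]_d -> 'rV[R]_d -> R)
  (u0 ub : {finite_measure set (borel R d) -> \bar R})
  (phib : 'rV[R]_d -> R) (Tb : 'rV[R]_d -> 'rV[R]_d) (eps gamma : R) :
  (* standing assumptions *)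
  compact w0 -> compact w1 ->
  closure w1° = w1 -> unif_loc_quasiconvex w1° ->
  {within w0 `*` w1, continuous (fun z => c z.1 z.2)} ->
  carried_by w0 u0 -> (0 < u0 w0)%E -> msupp u0 = w0 ->
  carried_by w1 ub -> ub w1 = u0 w0 ->
  (* (a) *)
  cont_diff2_on (w0 `*` w1) (fun z => c z.1 z.2) ->
  (* (b) *)
  msupp ub `<=` w1° ->
  (* (c) *)
  C1 w1 phib -> kantorovich_potential w0 w1 c u0 ub phib ->
  0 < eps -> set_add (msupp ub) (closed_eball 0 eps) `<=` w1° ->
  cont_diff2_on (set_add (msupp ub) (closed_eball 0 eps)) phib ->
  (* (d) *)
  (forall x, w0 x -> w1 (Tb x)) -> 0 < gamma ->
  (forall x y, w0 x -> w1 y ->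
     c x (Tb x) - phib (Tb x) + gamma / 2 * enorm (y - Tb x) ^+ 2 <=
     c x y - phib y) ->
  let D := transport_dual w0 w1 c u0 in
  let ub' := Pi w1 (charge_of_finite_measure ub) in
  (forall uh : 'rV[R]_d -> probability (borel R d) R,
     disintegration w0 w1 u0 ub Tb uh ->
     forall Phi, C1_dual w1 Phi ->
       let S := half_energies w1 ub (Hmat w0 c phib Tb uh) Phi in
       ((2^-1)%:E * second_subderivative w1 D ub' phib Phi = ereal_inf S)%E /\
       (S !=set0 -> S (ereal_inf S))) /\
  twice_epi_differentiable w1 D ub' phib.
Proof.
move=> cw0 cw1 clw1 _ cc cu0 _ su0 cub _ c2c sub C1p kant e0 nb c2p Tw g0 growth D ub'.
have S : regular_transport w0 w1 c u0 ub phib Tb eps gamma by split.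
split=> [uh uhP Phi dPhi|Phi dPhi t t0].
  have [N [k [K [[k0 K0] mN pN BN HN]]]] := mobility_exists S uhP.
  move=> halves; rewrite /halves; have [-> attained] := inf_half_energies S dPhi k0 K0 mN pN
    (fun f g C1f C1g => proj2 (BN f g C1f C1g)) (fun rho mrho => proj2 (HN rho mrho)).
  split; last exact: attained.
  by rewrite (second_subderivativeE S dPhi) muleA -EFinM mulVf ?pnatr_eq0// mul1e.
by rewrite (second_subderivativeE S dPhi); exact: (recovery_cvg S dPhi).
Qed.
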